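(* Let $\Gamma(H_{\mathbb R},U_t)''$ be an almost-periodic free Araki-Woods factor with vacuum state $\varphi_\Omega$, written as $\Gamma(H_{\mathbb R},U_t)''=(z_i:i\in\mathbb N)''$, where $(z_i)_{i\in\mathbb N}$ is a free family (with respect to $\varphi_\Omega$) of generalized circular elements with left variance $\varphi_\Omega(z_i^*z_i)=1$ and right variance $\varphi_\Omega(z_iz_i^* )=\lambda_i$, where $1<\lambda_i<\infty$. For each $k\in\mathbb N$ let $$F(k)=\begin{pmatrix}0&D_{k+1}(1,\sqrt{\lambda_1},\dots,\sqrt{\lambda_k})^{-1}\\-D_{k+1}(1,\sqrt{\lambda_1},\dots,\sqrt{\lambda_k})&0\end{pmatrix}\in GL_{2k+2}(\mathbb C).$$ Then the family $(z_{i,k})_{i=1}^k=(\sqrt{N_{F(k)}}\,u_{1,i+1})_{i=1}^k\subset(C(O^+_{F(k)}),h_{O^+_{F(k)}})$ converges in joint distribution, as $k\to\infty$, to $(z_i)_{i\in\mathbb N}\subset(\Gamma(H_{\mathbb R},U_t)'',\varphi_\Omega)$.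
   Context: $D_m(a_1,\dots,a_m)$ is the diagonal matrix with the listed diagonal entries. For $F\in GL_N(\mathbb C)$ with $F\overline F=\pm1$ ($\overline F$ the entrywise conjugate), $C(O_F^+)$ is the universal unital C$^*$-algebra generated by $u_{ij}$ ($1\le i,j\le N$) subject to: $U=[u_{ij}]$ is unitary and $U=F\overline UF^{-1}$, where $\overline U=[u_{ij}^*]$; coproduct $\Delta(u_{ij})=\sum_m u_{im}\otimes u_{mj}$. The Haar state $h_{O_F^+}$ is the unique state $h$ with $(h\otimes\iota)\Delta(a)=(\iota\otimes h)\Delta(a)=h(a)1$ for all $a$. $N_F=\mathrm{Tr}(F^*F)$. Full Fock space: $\mathcal F(H)=\mathbb C\Omega\oplus\bigoplus_{n\ge1}H^{\otimes n}$, vacuum state $\varphi_\Omega=\langle\Omega|\cdot\,\Omega\rangle$, left creation operators $\ell(\xi)$. An $(\alpha,\beta)$-generalized circular element ($\alpha,\beta>0$) in a non-commutative probability space (unital C$^*$-algebra with a state) $(A,\varphi)$ is a variable $x$ with the same $*$-distribution as $\alpha\ell(\xi)+\beta\ell(\eta)^*$ under $\varphi_\Omega$, with $\xi,\eta$ orthonormal; its left and right variances are $\varphi(x^*x)=\alpha^2$ and $\varphi(xx^* )=\beta^2$. A family of variables is free if the unital $*$-subalgebras generated by the individual variables are freely independent. Free Araki-Woods factor: $(U_t)$ is an orthogonal representation of $\mathbb R$ on a real separable Hilbert space $H_{\mathbb R}$, $H=H_{\mathbb R}\otimes_{\mathbb R}\mathbb C$, $U_t=A^{it}$ on $H$, $j(\xi)=\big(\tfrac{2}{A^{-1}+1}\big)^{1/2}\xi$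 for $\xi\in H_{\mathbb R}$, $K_{\mathbb R}=j(H_{\mathbb R})$, and $\Gamma(H_{\mathbb R},U_t)''=W^*(\ell(\xi)+\ell(\xi)^*:\xi\in K_{\mathbb R})\subseteq\mathcal B(\mathcal F(H))$, with the faithful normal state given by the restriction of $\varphi_\Omega$. It is called almost-periodic when $(U_t)$ is almost-periodic (a direct sum of finite-dimensional representations). Convergence in joint distribution means convergence of all joint $*$-moments: for all $l$, $\epsilon:[l]\to\{1,\ast\}$ and $i:[l]\to\mathbb N$, where $[l]=\{1,\dots,l\}$, $h_{O^+_{F(k)}}(z_{i(1),k}^{\epsilon(1)}\cdots z_{i(l),k}^{\epsilon(l)})\to\varphi_\Omega(z_{i(1)}^{\epsilon(1)}\cdots z_{i(l)}^{\epsilon(l)})$ as $k\to\infty$ (the left side being defined for $k\ge\max_r i(r)$). *)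

(* Defs.v *)
From HB Require Import structures.
From mathcomp Require Import all_boot all_order all_algebra.
From mathcomp Require Import all_classical all_reals all_analysis.
From mathcomp Require Import sesquilinear complex.

Set Implicit Arguments.
Unset Strict Implicit.
Unset Printing Implicit Defensive.

Import Order.TTheory GRing.Theory Num.Theory.
Import numFieldNormedType.Exports.

Local Open Scope classical_set_scope.
Local Open Scope ring_scope.

Definition lin_span (K : numFieldType) (V : lmodType K) (S : set V) : set V :=
  [set v | exists n (c : 'I_n -> K) (w : 'I_n -> V),
    (forall i, S (w i)) /\ v = \sum_i c i *: w i].

(* A Hilbert space over K; theta is idfun for real spaces and conjC for complex
   ones.  The inner product is linear in its first argument. *)
HB.mixin Record isHilbert (K : numFieldType) (theta : K -> K) H
    of CompleteNormedModule K H := {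
  inner_subdef : {dot H for theta};
  inner_norm_subdef : forall x : H, `|x| ^+ 2 = inner_subdef x x
}.

#[short(type="hilbertType")]
HB.structure Definition Hilbert (K : numFieldType) (theta : K -> K) :=
  {H of CompleteNormedModule K H & isHilbert K theta H}.

Definition inner (K : numFieldType) (theta : K -> K) (H : hilbertType theta) :
  {dot H for theta} := @inner_subdef K theta H.

Notation "''[' x , y ]" := (inner _ x%R y%R) : ring_scope.

HB.mixin Record isNontrivial (T : Type) of GRing.Nmodule T := {
  nontrivial_subdef : exists x : T, x != 0
}.

#[short(type="nzHilbertType")]
HB.structure Definition NzHilbert (C : numClosedFieldType) :=
  {H of @Hilbert C (@Num.conj C) H & isNontrivial H}.

HB.mixin Record hasStar (C : numClosedFieldType) A of GRing.Algebra C A := {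
  star : A -> A;
  starK : involutive star;
  starD : {morph star : x y / x + y};
  starZ : forall (c : C) x, star (c *: x) = c^* *: star x;
  starM : forall x y, star (x * y) = star y * star x
}.

#[short(type="starAlgType")]
HB.structure Definition StarAlgebra (C : numClosedFieldType) :=
  {A of GRing.Algebra C A & hasStar C A}.

(* The norm is a new operation rather than that of [completeNormedModType]: a
   structure inheriting from both the normed modules and the rings cannot be
   added below [numDomainType], where the two meet in the library. *)
HB.mixin Record isCStar (C : numClosedFieldType) A of StarAlgebra C A := {
  cnorm : A -> C;
  cnorm_ge0 : forall x, 0 <= cnorm x;
  cnorm0_eq0 : forall x, cnorm x = 0 -> x = 0;
  cnormD : forall x y, cnorm (x + y) <= cnorm x + cnorm y;
  cnormZ : forall c x, cnorm (c *: x) = `|c| * cnorm x;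
  cnormM : forall x y, cnorm (x * y) <= cnorm x * cnorm y;
  cnorm_star : forall x, cnorm (star x * x) = cnorm x ^+ 2;
  cnorm_complete : forall a : nat -> A,
    (forall e, 0 < e -> exists N, forall m n, (N <= m)%N -> (N <= n)%N ->
       cnorm (a m - a n) < e) ->
    exists x, forall e, 0 < e -> exists N, forall n, (N <= n)%N ->
       cnorm (a n - x) < e
}.

#[short(type="cstarAlgType")]
HB.structure Definition CStarAlgebra (C : numClosedFieldType) :=
  {A of StarAlgebra C A & isCStar C A}.

Section BoundedOperators.
Variable C : numClosedFieldType.

Section Bop.
Variable H : hilbertType (@Num.conj C).

(* B(H).  A bounded operator is carried together with its adjoint, which exists
   by the Riesz representation theorem and is unique (lemma bop_eq). *)
Record bop := Bop {
  bop_fun :> H -> H;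
  bop_adj : H -> H;
  bop_lin : linear bop_fun;
  bop_bound : exists M : C, forall x, `|bop_fun x| <= M * `|x|;
  bop_adjP : forall x y, '[bop_fun x, y] = '[x, bop_adj y]
}.

Lemma innerC (x y : H) : '[x, y] = '[y, x]^*.
Proof. by rewrite hermC /= expr0 mul1r. Qed.

Lemma inner_normE (x : H) : `|x| ^+ 2 = '[x, x].
Proof. exact: inner_norm_subdef. Qed.

Lemma innerBl (x y z : H) : '[x - y, z] = '[x, z] - '[y, z].
Proof. exact: linearBl. Qed.
Lemma innerDl (x y z : H) : '[x + y, z] = '[x, z] + '[y, z].
Proof. exact: linearDl. Qed.
Lemma innerZl a (x z : H) : '[a *: x, z] = a * '[x, z].
Proof. exact: linearZl_LR. Qed.
Lemma innerDr (x y z : H) : '[x, y + z] = '[x, y] + '[x, z].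
Proof. by rewrite innerC innerDl rmorphD /= -!innerC. Qed.
Lemma innerBr (x y z : H) : '[x, y - z] = '[x, y] - '[x, z].
Proof. by rewrite innerC innerBl rmorphB /= -!innerC. Qed.
Lemma innerZr a (x z : H) : '[x, a *: z] = a^* * '[x, z].
Proof. by rewrite innerC innerZl rmorphM /= -innerC. Qed.

Lemma inner_inj (x y : H) : (forall z, '[z, x] = '[z, y]) -> x = y.
Proof.
move=> e; apply/eqP; rewrite -subr_eq0 -normr_eq0 -sqrf_eq0 inner_normE.
by rewrite innerBr e subrr.
Qed.

Lemma inner_cauchy_schwarz (x y : H) : `|'[x, y]| <= `|x| * `|y|.
Proof.
have [->|y0] := eqVneq y 0.
  by rewrite -(scale0r 0) innerZr conjC0 mul0r normr0 mulr_ge0.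
have ny : 0 < `|y| by rewrite normr_gt0.
have nyn : '[y, y] != 0 by rewrite -inner_normE expf_neq0 ?gt_eqF.
rewrite -(@ler_pXn2r _ 2) ?nnegrE ?mulr_ge0 // exprMn !inner_normE normCK.
pose c := '[x, y] / '[y, y].
have : 0 <= '[x - c *: y, x - c *: y] by rewrite -inner_normE exprn_ge0.
have e : '[x - c *: y, y] = 0 by rewrite innerBl innerZl divfK ?subrr.
rewrite innerBr innerZr e mulr0 subr0 innerBl innerZl subr_ge0 /c.
by rewrite mulrAC ler_pdivrMr -?inner_normE ?exprn_gt0 // (innerC y x).
Qed.

Lemma bop_eq (S T : bop) : S =1 T -> S = T.
Proof.
case: S T => [s s' sl sb sa] [t t' tl tb ta] /= e.
have {e}e : s = t by apply/funext.
rewrite e in sl sb sa *.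
have e' : s' = t'.
  by apply/funext => y; apply: inner_inj => x; rewrite -sa -ta.
rewrite e' in sa *; f_equal; exact: Prop_irrelevance.
Qed.

Fact bop0_lin : linear (fun _ : H => 0 : H).
Proof. by move=> a x y; rewrite scaler0 addr0. Qed.
Fact bop0_bound : exists M : C, forall x : H, `|0 : H| <= M * `|x|.
Proof. by exists 0 => x; rewrite normr0 mul0r. Qed.
Fact bop0_adjP (x y : H) : '[0 : H, y] = '[x, 0].
Proof. by rewrite -(scale0r 0) innerZl innerZr conjC0 !mul0r. Qed.
Definition bop0 := Bop bop0_lin bop0_bound bop0_adjP.

Fact bop1_lin : linear (fun x : H => x). Proof. by []. Qed.
Fact bop1_bound : exists M : C, forall x : H, `|x| <= M * `|x|.
Proof. by exists 1 => x; rewrite mul1r. Qed.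
Fact bop1_adjP (x y : H) : '[x, y] = '[x, y]. Proof. by []. Qed.
Definition bop1 := Bop bop1_lin bop1_bound bop1_adjP.

Lemma bopZ (S : bop) a x : S (a *: x) = a *: S x.
Proof.
have S0 : S 0 = 0 by move: (bop_lin S (-1) 0 0); rewrite !scaler0 addr0 scaleN1r addNr.
by rewrite -[a *: x]addr0 bop_lin S0 addr0.
Qed.
Lemma bopD (S : bop) x y : S (x + y) = S x + S y.
Proof. by rewrite -[x]scale1r bop_lin !scale1r. Qed.

Lemma bop_bound_ge0 (S : bop) :
  exists2 M : C, 0 <= M & forall x, `|S x| <= M * `|x|.
Proof.
have [M SM] := bop_bound S.
have [[x x0]|n] := pselect (exists x : H, x != 0).
  exists M => //; have := le_trans (normr_ge0 _) (SM x).
  by rewrite pmulr_lge0 ?normr_gt0.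
exists 0 => // x; suff -> : x = 0 by rewrite -(scale0r 0) bopZ scale0r normr0 mul0r.
by apply: contrapT => /eqP x0; apply: n; exists x.
Qed.

Section AddScale.
Variables (c : C) (S T : bop).

Fact bop_add_lin : linear (fun x => S x + T x).
Proof. by move=> a x y; rewrite !bop_lin scalerDr addrACA. Qed.
Fact bop_add_bound : exists M : C, forall x, `|S x + T x| <= M * `|x|.
Proof.
have [[M SM] [N TN]] := (bop_bound S, bop_bound T); exists (M + N) => x.
by rewrite mulrDl (le_trans (ler_normD _ _)) ?lerD.
Qed.
Fact bop_add_adjP x y : '[S x + T x, y] = '[x, bop_adj S y + bop_adj T y].
Proof. by rewrite innerDl innerDr !bop_adjP. Qed.
Definition bop_add := Bop bop_add_lin bop_add_bound bop_add_adjP.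

Fact bop_scale_lin : linear (fun x => c *: S x).
Proof. by move=> a x y; rewrite bop_lin scalerDr !scalerA mulrC. Qed.
Fact bop_scale_bound : exists M : C, forall x, `|c *: S x| <= M * `|x|.
Proof.
have [M SM] := bop_bound S; exists (`|c| * M) => x.
by rewrite normrZ -mulrA ler_wpM2l.
Qed.
Fact bop_scale_adjP x y : '[c *: S x, y] = '[x, c^* *: bop_adj S y].
Proof. by rewrite innerZl innerZr conjCK bop_adjP. Qed.
Definition bop_scale := Bop bop_scale_lin bop_scale_bound bop_scale_adjP.

Fact bop_mul_lin : linear (fun x => S (T x)).
Proof. by move=> a x y; rewrite !bop_lin. Qed.
Fact bop_mul_bound : exists M : C, forall x, `|S (T x)| <= M * `|x|.
Proof.
have [M M0 SM] := bop_bound_ge0 S; have [N TN] := bop_bound T.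
by exists (M * N) => x; rewrite (le_trans (SM _)) // -mulrA ler_wpM2l.
Qed.
Fact bop_mul_adjP x y : '[S (T x), y] = '[x, bop_adj T (bop_adj S y)].
Proof. by rewrite !bop_adjP. Qed.
Definition bop_mul := Bop bop_mul_lin bop_mul_bound bop_mul_adjP.

Fact bop_star_adjP x y : '[bop_adj S x, y] = '[x, S y].
Proof. by rewrite innerC -bop_adjP -innerC. Qed.
Fact bop_star_lin : linear (bop_adj S).
Proof.
move=> a x y; apply: inner_inj => z.
by rewrite -bop_adjP !innerDr !innerZr !bop_adjP.
Qed.
Fact bop_star_bound : exists M : C, forall x, `|bop_adj S x| <= M * `|x|.
Proof.
have [M M0 SM] := bop_bound_ge0 S; exists M => x.
have [->|y0] := eqVneq (bop_adj S x) 0; first by rewrite normr0 mulr_ge0.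
have ny : 0 < `|bop_adj S x| by rewrite normr_gt0.
rewrite -(ler_pM2r ny) -expr2 inner_normE -bop_adjP.
have := inner_cauchy_schwarz (S (bop_adj S x)) x.
rewrite bop_adjP -inner_normE ger0_norm ?exprn_ge0 // => /le_trans; apply.
by rewrite mulrAC ler_wpM2r.
Qed.
Definition bop_star := Bop bop_star_lin bop_star_bound bop_star_adjP.

End AddScale.

HB.instance Definition _ := gen_eqMixin bop.
HB.instance Definition _ := gen_choiceMixin bop.

Fact bop_addA : associative bop_add.
Proof. by move=> S T V; apply: bop_eq => x /=; rewrite addrA. Qed.
Fact bop_addC : commutative bop_add.
Proof. by move=> S T; apply: bop_eq => x /=; rewrite addrC. Qed.
Fact bop_add0 : left_id bop0 bop_add.
Proof. by move=> S; apply: bop_eq => x /=; rewrite add0r. Qed.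
Fact bop_addN : left_inverse bop0 (bop_scale (- 1)) bop_add.
Proof. by move=> S; apply: bop_eq => x /=; rewrite scaleN1r addNr. Qed.
HB.instance Definition _ :=
  GRing.isZmodule.Build bop bop_addA bop_addC bop_add0 bop_addN.

Fact bop_scaleA a b (S : bop) :
  bop_scale a (bop_scale b S) = bop_scale (a * b) S.
Proof. by apply: bop_eq => x /=; rewrite scalerA. Qed.
Fact bop_scale1 : left_id 1 bop_scale.
Proof. by move=> S; apply: bop_eq => x /=; rewrite scale1r. Qed.
Fact bop_scaleDr : right_distributive bop_scale +%R.
Proof. by move=> a S T; apply: bop_eq => x /=; rewrite scalerDr. Qed.
Fact bop_scaleDl (S : bop) : {morph bop_scale^~ S : a b / a + b}.
Proof. by move=> a b; apply: bop_eq => x /=; rewrite scalerDl. Qed.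
HB.instance Definition _ := GRing.Zmodule_isLmodule.Build C bop
  bop_scaleA bop_scale1 bop_scaleDr bop_scaleDl.

Fact bop_mulA : associative bop_mul.
Proof. by move=> S T V; apply: bop_eq. Qed.
Fact bop_mul1l : left_id bop1 bop_mul.
Proof. by move=> S; apply: bop_eq. Qed.
Fact bop_mul1r : right_id bop1 bop_mul.
Proof. by move=> S; apply: bop_eq. Qed.
Fact bop_mulDl : left_distributive bop_mul +%R.
Proof. by move=> S T V; apply: bop_eq. Qed.
Fact bop_mulDr : right_distributive bop_mul +%R.
Proof. by move=> S T V; apply: bop_eq => x /=; rewrite bopD. Qed.
HB.instance Definition _ := GRing.Zmodule_isPzRing.Build bop
  bop_mulA bop_mul1l bop_mul1r bop_mulDl bop_mulDr.

End Bop.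

Variable H : nzHilbertType C.

Fact bop_oner_neq0 : (1 : bop H) != 0.
Proof.
have [x /eqP x0] := @nontrivial_subdef C H.
by apply/eqP => /(congr1 (fun S : bop H => S x)) /= /x0.
Qed.
HB.instance Definition _ :=
  GRing.PzSemiRing_isNonZero.Build (bop H) bop_oner_neq0.

Fact bop_scaleAl a (S T : bop H) : a *: (S * T) = (a *: S) * T.
Proof. by apply: bop_eq. Qed.
HB.instance Definition _ :=
  GRing.LSemiModule_isLSemiAlgebra.Build C (bop H) bop_scaleAl.

Fact bop_scaleAr a (S T : bop H) : a *: (S * T) = S * (a *: T).
Proof. by apply: bop_eq => x /=; rewrite bopZ. Qed.
HB.instance Definition _ :=
  GRing.LSemiAlgebra_isSemiAlgebra.Build C (bop H) bop_scaleAr.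

Fact bop_starK : involutive (@bop_star H).
Proof. by move=> S; apply: bop_eq. Qed.
Fact bop_starD : {morph @bop_star H : S T / S + T}.
Proof. by move=> S T; apply: bop_eq. Qed.
Fact bop_starZ (c : C) (S : bop H) : bop_star (c *: S) = c^* *: bop_star S.
Proof. by apply: bop_eq. Qed.
Fact bop_starM (S T : bop H) : bop_star (S * T) = bop_star T * bop_star S.
Proof. by apply: bop_eq. Qed.
HB.instance Definition _ := hasStar.Build C (bop H)
  bop_starK bop_starD bop_starZ bop_starM.

End BoundedOperators.

Section Probability.
Variable C : numClosedFieldType.

Definition is_state (A : starAlgType C) (phi : A -> C) : Prop :=
  [/\ scalar phi, phi 1 = 1 & forall x, 0 <= phi (star x * x)].

Definition star_hom (A B : starAlgType C) (f : {lrmorphism A -> B}) : Prop :=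
  {morph f : x / star x}.

(* The letter x of a *-word, where [true] stands for the exponent *. *)
Definition starpow (A : starAlgType C) (e : bool) (x : A) : A :=
  if e then star x else x.

Definition same_stardist (A B : starAlgType C) (phi : A -> C) (psi : B -> C)
    (x : A) (y : B) : Prop :=
  forall l (eps : 'I_l -> bool),
    phi (\prod_(r < l) starpow (eps r) x) = psi (\prod_(r < l) starpow (eps r) y).

Inductive star_alg (A : starAlgType C) (x : A) : A -> Prop :=
| star_alg_gen : star_alg x x
| star_alg_one : star_alg x 1
| star_alg_add a b : star_alg x a -> star_alg x b -> star_alg x (a + b)
| star_alg_scale c a : star_alg x a -> star_alg x (c *: a)
| star_alg_mul a b : star_alg x a -> star_alg x b -> star_alg x (a * b)
| star_alg_star a : star_alg x a -> star_alg x (star a).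

Definition free_family (I : Type) (A : starAlgType C) (phi : A -> C)
    (x : I -> A) : Prop :=
  forall l (i : 'I_l -> I) (a : 'I_l -> A),
    (0 < l)%N ->
    (forall r, star_alg (x (i r)) (a r)) ->
    (forall r, phi (a r) = 0) ->
    (forall r s : 'I_l, s = r.+1 :> nat -> i r <> i s) ->
    phi (\prod_(r < l) a r) = 0.

End Probability.

Section FockSpace.
Variable C : numClosedFieldType.

(* The full Fock space of H, up to unitary isomorphism: [tens [:: x1; ..; xn]]
   is the elementary tensor of the xi, and [tens [::]] the vacuum vector. *)
Definition full_fock (H F : nzHilbertType C) (tens : seq H -> F) : Prop :=
  (forall s t : seq H, '[tens s, tens t] =
     if size s == size t then \prod_(i < size s) '[s`_i, t`_i] else 0) /\
  dense (lin_span (range tens)).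

(* <Omega | T Omega>: the inner product being linear in its first argument, Omega
   is the second one. *)
Definition vacuum (H F : nzHilbertType C) (tens : seq H -> F) (T : bop F) : C :=
  '[T (tens [::]), tens [::]].

Definition creation (H F : nzHilbertType C) (tens : seq H -> F) (x : H)
    (L : bop F) : Prop :=
  forall s, L (tens s) = tens (x :: s).

Definition gen_circular (a b : C) (A : starAlgType C) (phi : A -> C) (x : A) :
    Prop :=
  [/\ 0 < a, 0 < b &
  exists (H F : nzHilbertType C) (tens : seq H -> F) (xi eta : H) (L M : bop F),
    [/\ full_fock tens,
        [/\ '[xi, xi] = 1, '[eta, eta] = 1 & '[xi, eta] = 0],
        creation tens xi L, creation tens eta M &
        same_stardist phi (vacuum tens) x (a *: L + b *: star M)]].

Definition commutant (F : nzHilbertType C) (S : set (bop F)) : set (bop F) :=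
  [set T | forall X, S X -> T * X = X * T].

(* The von Neumann algebra S'' generated by S, by the bicommutant theorem. *)
Definition vN_gen (F : nzHilbertType C) (S : set (bop F)) : set (bop F) :=
  commutant (commutant (S `|` star @` S)).

End FockSpace.

Section FreeArakiWoods.
Variable R : realType.
Notation C := (R[i]).

Definition separable (K : numFieldType) (V : normedModType K) : Prop :=
  exists a : nat -> V, dense (range a).

Section RealRepresentation.
Variable HR : hilbertType (idfun : R -> R).

Definition orthogonal_rep (U : R -> HR -> HR) : Prop :=
  [/\ forall t, linear (U t),
      forall t x y, '[U t x, U t y] = '[x, y],
      forall x, U 0 x = x,
      forall s t x, U (s + t) x = U s (U t x) &
      forall x, continuous (fun t => U t x)].

(* (U_t) is a direct sum of finite-dimensional representations. *)
Definition almost_periodic (U : R -> HR -> HR) : Prop :=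
  exists (I : Type) (P : I -> set HR),
    [/\ forall i, exists n (b : 'I_n -> HR), P i = lin_span (range b),
        forall i t x, P i x -> P i (U t x),
        forall i j x y, i <> j -> P i x -> P j y -> '[x, y] = 0 &
        dense (lin_span (\bigcup_i P i))].

End RealRepresentation.

(* H is the complexification of HR, with canonical embedding iota. *)
Definition complexification (HR : hilbertType (idfun : R -> R))
    (H : nzHilbertType C) (iota : HR -> H) : Prop :=
  [/\ forall (a : R) x y, iota (a *: x + y) = a%:C%C *: iota x + iota y,
      forall x y, '[iota x, iota y] = ('[x, y])%:C%C &
      forall v, exists x y, v = iota x + 'i%C *: iota y].

(* E is a projection-valued Borel measure on R, with scalar measures
   mu x B = <E B x, x>. *)
Definition spectral_measure (H : nzHilbertType C) (E : set R -> bop H)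
    (mu : H -> {measure set (measurableTypeR R) -> \bar R}) : Prop :=
  [/\ E setT = 1,
      forall B, measurable B -> star (E B) = E B,
      forall B B', measurable B -> measurable B' -> E (B `&` B') = E B * E B' &
      forall x B, measurable B -> (mu x B = (complex.Re '[E B x, x])%:E)%E].

(* T = f(A) = \int f dE, for a bounded Borel function f. *)
Definition borel_calculus (H : nzHilbertType C)
    (mu : H -> {measure set (measurableTypeR R) -> \bar R})
    (f : R -> C) (T : bop H) : Prop :=
  forall x, '[T x, x] =
    Complex (\int[mu x]_s complex.Re (f s)) (\int[mu x]_s complex.Im (f s)).

(* M = Gamma(HR, U)''.  The generator A, a positive nonsingular self-adjoint
   operator that may be unbounded, is given by its spectral measure E, and V is
   the complexification of U, so that V t = A^{it}. *)
Definition free_araki_woods (HR : hilbertType (idfun : R -> R))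
    (U : R -> HR -> HR) (H : nzHilbertType C) (iota : HR -> H)
    (F : nzHilbertType C) (tens : seq H -> F) (M : set (bop F)) : Prop :=
  exists (V : R -> bop H) (E : set R -> bop H)
         (mu : H -> {measure set (measurableTypeR R) -> \bar R}) (J : bop H),
    [/\ forall t x, V t (iota x) = iota (U t x),
        spectral_measure E mu /\ E [set s | 0 < s] = 1,
        forall t, borel_calculus mu
          (fun s => Complex (cos (t * ln s)) (sin (t * ln s))) (V t),
        borel_calculus mu
          (fun s => (Num.sqrt (2 / (s^-1 + 1)))%:C%C) J &
        M = vN_gen [set T | exists (x : HR) (L : bop F),
                      creation tens (J (iota x)) L /\ T = L + star L]].

End FreeArakiWoods.

Section FreeOrthogonal.
Variable C : numClosedFieldType.

Definition OF_relations (N : nat) (F : 'M[C]_N) (A : starAlgType C)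
    (u : 'M[A]_N) : Prop :=
  let ubar := map_mx star u in
  [/\ u *m ubar^T = 1%:M, ubar^T *m u = 1%:M &
      u = map_mx (in_alg A) F *m ubar *m map_mx (in_alg A) (invmx F)].

(* (A, u) is C(O_F^+) with its matrix of generators. *)
Definition free_orthogonal (N : nat) (F : 'M[C]_N) (A : cstarAlgType C)
    (u : 'M[A]_N) : Prop :=
  OF_relations F u /\
  forall (B : cstarAlgType C) (v : 'M[B]_N), OF_relations F v ->
    exists f : {lrmorphism A -> B},
      [/\ star_hom f, map_mx f u = v &
          forall g : {lrmorphism A -> B},
            star_hom g -> map_mx g u = v -> g =1 f].

Definition hilbert_tensor (H K HK : nzHilbertType C) (tau : H -> K -> HK) :
    Prop :=
  (forall x x' y y', '[tau x y, tau x' y'] = '[x, x'] * '[y, y']) /\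
  dense (lin_span [set v | exists x y, v = tau x y]).

Definition cdense (A : cstarAlgType C) (S : set A) : Prop :=
  forall (x : A) (e : C), 0 < e -> exists2 y, S y & cnorm (x - y) < e.

(* T is the minimal (spatial) tensor product of A and B, with elementary
   tensors [tens a b]. *)
Definition min_tensor (A B T : cstarAlgType C) (tens : A -> B -> T) : Prop :=
  cdense (lin_span [set z | exists a b, z = tens a b]) /\
  exists (H K HK : nzHilbertType C) (tau : H -> K -> HK)
      (pi : {lrmorphism A -> bop H}) (sigma : {lrmorphism B -> bop K})
      (rho : {lrmorphism T -> bop HK}),
    [/\ hilbert_tensor tau,
        star_hom pi /\ injective pi,
        star_hom sigma /\ injective sigma,
        star_hom rho /\ injective rho &
        forall a b x y, rho (tens a b) (tau x y) = tau (pi a x) (sigma b y)].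

Definition cbounded (A B : cstarAlgType C) (f : A -> B) : Prop :=
  exists M : C, forall x, cnorm (f x) <= M * cnorm x.

(* h is the Haar state of the compact quantum group (A, u); sl and sr are the
   slice maps h (x) id and id (x) h. *)
Definition haar_state (N : nat) (A : cstarAlgType C) (u : 'M[A]_N)
    (h : A -> C) : Prop :=
  is_state h /\
  exists (T : cstarAlgType C) (tens : A -> A -> T) (Delta : {lrmorphism A -> T})
      (sl sr : {linear T -> A}),
    [/\ min_tensor tens,
        star_hom Delta /\
        forall i j, Delta (u i j) = \sum_m tens (u i m) (u m j),
        cbounded sl /\ forall a b, sl (tens a b) = h a *: b,
        cbounded sr /\ forall a b, sr (tens a b) = h b *: a &
        forall a, sl (Delta a) = (h a)%:A /\ sr (Delta a) = (h a)%:A].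

End FreeOrthogonal.

Section TheMatrices.
Variable R : realType.

(* lam is indexed from 0: lam i stands for lambda_{i+1}. *)
Definition Dmat (lam : nat -> R) (k : nat) : 'M[R[i]]_k.+1 :=
  diag_mx (\row_(j < k.+1)
    (if j == 0 :> nat then 1 else Num.sqrt (lam j.-1))%:C%C).

Definition Fmat (lam : nat -> R) (k : nat) : 'M[R[i]]_(k.+1 + k.+1) :=
  block_mx 0 (invmx (Dmat lam k)) (- Dmat lam k) 0.

Definition NF (N : nat) (F : 'M[R[i]]_N) : R[i] :=
  \tr ((map_mx Num.conj F)^T *m F).

Lemma Dmat_unit (lam : nat -> R) k :
  (forall i, 1 < lam i) -> Dmat lam k \in unitmx.
Proof.
move=> lam1; rewrite unitmxE unitfE det_diag; apply/prodf_neq0 => j _.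
rewrite mxE fmorph_eq0; case: ifP => _; first exact: oner_neq0.
by rewrite gt_eqF // sqrtr_gt0 (lt_trans ltr01).
Qed.

Lemma Dmat_conj (lam : nat -> R) k : map_mx Num.conj (Dmat lam k) = Dmat lam k.
Proof.
apply/matrixP => i j; rewrite !mxE rmorphMn /=; congr (_ *+ _).
exact: conjc_real.
Qed.

Lemma Fmat_conj (lam : nat -> R) k : (forall i, 1 < lam i) ->
  Fmat lam k *m map_mx Num.conj (Fmat lam k) = - 1%:M.
Proof.
move=> lam1; rewrite /Fmat map_block_mx !map_mx0 map_mxN map_invmx Dmat_conj.
rewrite mulmx_block !mul0mx !mulmx0 !addr0 !add0r.
rewrite mulmxN mulNmx mulVmx ?mulmxV ?Dmat_unit //.
by rewrite (scalar_mx_block k.+1 k.+1) opp_block_mx !oppr0.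
Qed.

Lemma Fmat_unit (lam : nat -> R) k :
  (forall i, 1 < lam i) -> Fmat lam k \in unitmx.
Proof.
move=> /(@Fmat_conj lam k) FF.
have /mulmx1_unit[//] : Fmat lam k *m (- map_mx Num.conj (Fmat lam k)) = 1%:M.
by rewrite mulmxN FF opprK.
Qed.

(* z_{i+1,k}; only the indices i < k are meaningful, [inord] being junk beyond. *)
Definition zk (lam : nat -> R) (k : nat) (A : starAlgType R[i])
    (u : 'M[A]_(k.+1 + k.+1)) (i : nat) : A :=
  sqrtC (NF (Fmat lam k)) *: u (lshift k.+1 ord0) (lshift k.+1 (inord i.+1)).

End TheMatrices.

(* Main.v *)
Require Import Defs.
From HB Require Import structures.
From mathcomp Require Import all_boot all_order all_algebra.
From mathcomp Require Import all_classical all_reals all_analysis.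
From mathcomp Require Import sesquilinear complex ring.

Set Implicit Arguments.
Unset Strict Implicit.
Unset Printing Implicit Defensive.

Import Order.TTheory GRing.Theory Num.Theory.
Import numFieldNormedType.Exports.

Local Open Scope classical_set_scope.
Local Open Scope ring_scope.

(* The C*-algebra C(O_F^+) is represented on the direct sum of the H_n (x) K_n,
   where H_n and K_n are towers of spaces with C^N (x) H_n = H_{n+1} (+) H_{n-1}
   (the irreducible corepresentations): u_ij acts as a raising operator plus the
   adjoint of another one, with weights sqrt (c_n), c_{n+1} (N_F - c_n) = 1.  A
   unit vector of the lowest level is invariant under slicing with the coproduct,
   because the compressions are intertwiners, and hence implements the Haar state.
   For F = F(k), sqrt N_F u_{1,i+1} becomes S_i + sqrt lambda_i T_i^* for scaled
   raising operators S_i, T_i, whose Gram relations S^* S' = delta + O(1 / N_F)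
   converge to those of the creation operators of the full Fock space.  On the
   side of the limit, freeness and the marginals determine all the moments, and
   so they are those of the Fock space model. *)

(** * Bounded operators *)

(** The algebra [A k] is known only by its universal property, and that property accepts only
    C*-algebras as targets; hence the operator norm on [bop]. The weights are ratios c_n = d_(n-1) /
    d_n of quantum dimensions, d_(n+1) = N_F d_n - d_(n-1) with d_(-1) = 0; with them the raising
    and lowering parts of the rows and columns of U add up to 1. There are two ladders, for F^T and
    for F, because the coproduct of u_ij alters the row index alone: one tensor factor carries the
    rows and moves, the other carries the columns and stays put. The identity of the Haar state h
    with the vector state phi comes from convolving them: (h (x) phi) Delta equals h by the
    invariance of h, and equals phi because the lowest level carries the trivial corepresentation.
    For F(k), every row and column has a single nonzero entry, so twisting a letter only rescales
    another one, by at most sqrt lambda_i. The corrections to the Gram relations are therefore of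
    the order of c_n, and c_n <= 1 / (N_F - 1) <= 1 / (k + 1) at all levels n at once. *)

Section OperatorNorm.
Variables (R : realType) (F : nzHilbertType R[i]).
Implicit Types S T : bop F.

Definition opnorm S : R[i] :=
  (sup [set r : R | exists2 x : F, `|x| <= 1 & r = complex.Re `|S x|])%:C%C.

Lemma ge0_RRe (c : R[i]) : 0 <= c -> c = (complex.Re c)%:C%C.
Proof. by case: c => a b; rewrite lecE /= => /andP[/eqP -> _]. Qed.

Lemma bop0E S : S 0 = 0.
Proof. by rewrite -[in LHS](scale0r (0 : F)) bopZ scale0r. Qed.

Lemma bopB S (x y : F) : S (x - y) = S x - S y.
Proof. by rewrite bopD -scaleN1r bopZ scaleN1r. Qed.

Lemma opnorm_has_sup S :
  has_sup [set r : R | exists2 x : F, `|x| <= 1 & r = complex.Re `|S x|].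
Proof.
split; first by exists (complex.Re `|S 0|), 0; rewrite ?normr0 ?ler01.
have [M M0 SM] := bop_bound_ge0 S; exists (complex.Re M) => _ [x x1 ->].
rewrite -(@lecR R) -!ge0_RRe //.
by rewrite (le_trans (SM x)) // ler_piMr.
Qed.

Lemma opnormP S x : `|S x| <= opnorm S * `|x|.
Proof.
have [->|x0] := eqVneq x 0.
  by rewrite bop0E !normr0 mulr0.
have nx : 0 < `|x| by rewrite normr_gt0.
rewrite -ler_pdivrMr // mulrC.
have -> : `|x|^-1 * `|S x| = `|S (`|x|^-1 *: x)|.
  by rewrite bopZ normrZ ger0_norm ?invr_ge0 // ltW.
rewrite [leLHS]ge0_RRe // lecR; apply: sup_upper_bound; first exact: opnorm_has_sup.
exists (`|x|^-1 *: x) => //.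
by rewrite normrZ ger0_norm ?invr_ge0 ?(ltW nx) // mulVf ?gt_eqF.
Qed.

Lemma opnorm_le S M : 0 <= M -> (forall x, `|S x| <= M * `|x|) -> opnorm S <= M.
Proof.
move=> M0 SM; rewrite (ge0_RRe M0) lecR; apply: ge_sup.
  by case: (opnorm_has_sup S).
move=> _ [x x1 ->]; rewrite -(@lecR R) -!ge0_RRe //.
by rewrite (le_trans (SM x)) // ler_piMr.
Qed.

Lemma opnorm_ge0 S : 0 <= opnorm S.
Proof.
rewrite lecR; apply: sup_upper_bound; first exact: opnorm_has_sup.
by exists 0; rewrite ?bop0E normr0 ?ler01.
Qed.

Lemma opnorm0_eq0 S : opnorm S = 0 -> S = 0.
Proof.
move=> S0; apply: bop_eq => x; apply/eqP; rewrite -normr_le0.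
by rewrite (le_trans (opnormP S x)) // S0 mul0r.
Qed.

Lemma opnormD S T : opnorm (S + T) <= opnorm S + opnorm T.
Proof.
apply: opnorm_le; first by rewrite addr_ge0 ?opnorm_ge0.
by move=> x; rewrite mulrDl (le_trans (ler_normD _ _)) ?lerD ?opnormP.
Qed.

Lemma opnormZ c S : opnorm (c *: S) = `|c| * opnorm S.
Proof.
have le d T : opnorm (d *: T) <= `|d| * opnorm T.
  apply: opnorm_le => [|x]; first by rewrite mulr_ge0 ?opnorm_ge0.
  by rewrite /= normrZ -mulrA ler_wpM2l ?opnormP.
apply/eqP; rewrite eq_le le /=; have [->|c0] := eqVneq c 0.
  by rewrite normr0 mul0r opnorm_ge0.
have := le c^-1 (c *: S); rewrite scalerA mulVf // scale1r.
by rewrite normfV ler_pdivlMl // normr_gt0.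
Qed.

Lemma opnormM S T : opnorm (S * T) <= opnorm S * opnorm T.
Proof.
apply: opnorm_le => [|x]; first by rewrite mulr_ge0 ?opnorm_ge0.
by rewrite (le_trans (opnormP S _)) // -mulrA ler_wpM2l ?opnorm_ge0 ?opnormP.
Qed.

(** Cauchy-Schwarz applied to |S x|^2 = <S* S x, x> shows that the square root of the right side is
    a bound for S. *)
Lemma opnorm_sqr_le S : opnorm S ^+ 2 <= opnorm (star S * S).
Proof.
have h x : `|S x| ^+ 2 <= opnorm (star S * S) * `|x| ^+ 2.
  have e : `|S x| ^+ 2 = '[(star S * S) x, x].
    by rewrite inner_normE (bop_adjP (star S)).
  rewrite -[leLHS]ger0_norm ?exprn_ge0 // e (le_trans (inner_cauchy_schwarz _ _)) //.
  by rewrite (expr2 `|x|) mulrA ler_wpM2r // opnormP.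
rewrite -(sqrtCK (opnorm (star S * S))) ler_pXn2r ?nnegrE ?opnorm_ge0 //;
  last by rewrite sqrtC_ge0 opnorm_ge0.
apply: opnorm_le => [|x]; first by rewrite sqrtC_ge0 opnorm_ge0.
rewrite -(@ler_pXn2r _ 2) ?nnegrE ?mulr_ge0 ?sqrtC_ge0 ?opnorm_ge0 //.
by rewrite exprMn sqrtCK h.
Qed.

Lemma opnorm_star_le S : opnorm (star S) <= opnorm S.
Proof.
have [->|S0] := eqVneq (opnorm (star S)) 0; first exact: opnorm_ge0.
have p : 0 < opnorm (star S) by rewrite lt0r S0 opnorm_ge0.
rewrite -(ler_pM2r p) -expr2 (le_trans (opnorm_sqr_le _)) //.
by rewrite starK (le_trans (opnormM _ _)).
Qed.

Lemma opnorm_star S : opnorm (star S * S) = opnorm S ^+ 2.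
Proof.
apply/eqP; rewrite eq_le opnorm_sqr_le andbT.
by rewrite (le_trans (opnormM _ _)) // expr2 ler_wpM2r ?opnorm_ge0 ?opnorm_star_le.
Qed.

Definition converges (x : nat -> F) (l : F) : Prop :=
  forall e : R[i], 0 < e -> exists K, forall n, (K <= n)%N -> `|x n - l| < e.

Lemma hilbert_complete (x : nat -> F) :
  (forall e : R[i], 0 < e ->
    exists K, forall m n, (K <= m)%N -> (K <= n)%N -> `|x m - x n| < e) ->
  exists l, converges x l.
Proof.
move=> xC; have /cvg_ex[l xl] : cvg (x @ \oo).
  apply/cauchy_cvgP/cauchy_exP => e e0; have [K xK] := xC e e0; exists (x K).
  by exists K => // n Kn; rewrite -ball_normE /=; apply: xK.
exists l => e e0; move/cvgrPdist_lt: xl => /(_ e e0) [K _ xK]; exists K => n Kn.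
by rewrite distrC xK.
Qed.

Lemma convergesB (x y : nat -> F) (l m : F) :
  converges x l -> converges y m -> converges (fun n => x n - y n) (l - m).
Proof.
move=> xl ym e e0; have e2 : 0 < e / 2 by rewrite divr_gt0.
have [K1 xK] := xl _ e2; have [K2 yK] := ym _ e2; exists (maxn K1 K2) => n.
rewrite geq_max => /andP[/xK xn /yK yn].
have -> : x n - y n - (l - m) = (x n - l) - (y n - m).
  by rewrite !opprB addrACA [- y n + _]addrC [RHS]addrACA [- l + _]addrC.
by rewrite (splitr e) (le_lt_trans (ler_normB _ _)) // ltrD.
Qed.

Lemma converges_cst (l : F) : converges (fun=> l) l.
Proof. by move=> e e0; exists 0%N => n _; rewrite subrr normr0. Qed.

Lemma converges_bop S (x : nat -> F) (l : F) :
  converges x l -> converges (fun n => S (x n)) (S l).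
Proof.
move=> xl e e0; have [M M0 SM] := bop_bound_ge0 S.
have M1 : 0 < M + 1 by rewrite ltr_wpDl.
have [K xK] := xl (e / (M + 1)) (divr_gt0 e0 M1); exists K => n /xK.
rewrite -bopB ltr_pdivlMr // => /(le_lt_trans _); apply.
by rewrite (le_trans (SM _)) // mulrC ler_wpM2l // lerDl.
Qed.

Lemma converges_ler_norm (x : nat -> F) (l : F) (M : R[i]) :
  converges x l -> (exists K, forall n, (K <= n)%N -> `|x n| <= M) -> `|l| <= M.
Proof.
move=> xl [K xM].
have M0 : M \is Num.real by rewrite ger0_real // (le_trans _ (xM K (leqnn K))).
rewrite real_leNgt ?normr_real //; apply/negP; rewrite -subr_gt0 => /xl[K' xK].
have := xK _ (leq_maxr K K'); have := xM _ (leq_maxl K K').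
move: (maxn _ _) => n xnM; rewrite ltrBrDr.
apply/negP; rewrite -real_leNgt ?realE ?addr_ge0 ?(le_trans _ xnM) ?normr_ge0 //.
rewrite (le_trans _ (_ : `|x n - l| + `|x n| <= _)) ?lerD2l //.
by rewrite -[X in `|X| <= _](subrK (x n)) (distrC (x n)) ler_normD.
Qed.

Lemma converges_uniq (x : nat -> F) (l m : F) :
  converges x l -> converges x m -> l = m.
Proof.
move=> xl xm; apply/eqP; rewrite -subr_eq0 -normr_le0.
apply: (converges_ler_norm (convergesB xl xm)).
by exists 0%N => n _; rewrite subrr normr0.
Qed.

Lemma converges_lin (a : R[i]) (x y : nat -> F) (l m : F) :
  converges x l -> converges y m ->
  converges (fun n => a *: x n + y n) (a *: l + m).
Proof.
move=> xl ym; have yn := convergesB (converges_cst 0) ym.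
have := convergesB (converges_bop (a *: 1) xl) yn.
by rewrite /= sub0r opprK; congr converges; apply/funext => n; rewrite sub0r opprK.
Qed.

(** Passes an adjoint relation to pointwise limits; this supplies the adjoint that every [bop] must
    carry when it is built as a limit. *)
Lemma converges_inner (x y : nat -> F) (l m a b : F) :
  converges x l -> converges y m -> (forall n, '[x n, b] = '[a, y n]) ->
  '[l, b] = '[a, m].
Proof.
move=> xl ym xy; apply/eqP; rewrite -subr_eq0 -normr_le0 real_leNgt ?normr_real //.
apply/negP => D0; set D := `|_| in D0.
pose c := `|b| + `|a| + 1; have c0 : 0 < c by rewrite ltr_wpDl ?addr_ge0.
have [K1 xK] := xl _ (divr_gt0 D0 c0); have [K2 yK] := ym _ (divr_gt0 D0 c0).
have := xK _ (leq_maxl K1 K2); have := yK _ (leq_maxr K1 K2).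
move: (maxn _ _) => n yn xn.
have : D <= `|b| * (D / c) + `|a| * (D / c).
  rewrite {1}/D; have -> : '[l, b] - '[a, m] = '[a, y n - m] - '[x n - l, b].
    by rewrite innerBl innerBr xy opprB [RHS]addrC addrA subrK.
  rewrite [leRHS]addrC (le_trans (ler_normB _ _)) // lerD //.
    by rewrite (le_trans (inner_cauchy_schwarz _ _)) // ler_wpM2l // ltW.
  by rewrite (le_trans (inner_cauchy_schwarz _ _)) // mulrC ler_wpM2l // ltW.
rewrite -mulrDl mulrCA -ler_pdivrMl // mulVf ?gt_eqF // ler_pdivlMr // mul1r.
by rewrite /c gerDl ler10.
Qed.

(** The sequence and the sequence of its adjoints, whose differences are no larger in norm, both
    converge pointwise; [converges_inner] makes the two limits adjoint to each other. *)
Lemma opnorm_complete (a : nat -> bop F) :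
  (forall e, 0 < e -> exists N, forall m n, (N <= m)%N -> (N <= n)%N ->
     opnorm (a m - a n) < e) ->
  exists S, forall e, 0 < e -> exists N, forall n, (N <= n)%N ->
     opnorm (a n - S) < e.
Proof.
move=> aC.
have lim (b : nat -> bop F) : (forall m n, opnorm (b m - b n) <= opnorm (a m - a n)) ->
    exists f : F -> F, forall x, converges (fun n => b n x) (f x).
  move=> ba; suff h x : exists l, converges (fun n => b n x) l.
    by have [f fP] := choice h; exists f.
  apply: hilbert_complete => e e0.
  have x1 : 0 < `|x| + 1 by rewrite ltr_wpDl.
  have [K aK] := aC _ (divr_gt0 e0 x1); exists K => m n Km Kn.
  have := le_lt_trans (ba m n) (aK m n Km Kn); rewrite ltr_pdivlMr //.
  apply: le_lt_trans; rewrite (_ : b m x - b n x = (b m - b n) x); last first.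
    by rewrite /= scaleN1r.
  by rewrite (le_trans (opnormP _ _)) // ler_wpM2l ?opnorm_ge0 // lerDl.
have [f af] := lim a (fun m n => lexx _).
have starB (S T : bop F) : star S - star T = star (S - T).
  by apply: bop_eq => x /=; rewrite rmorphN1.
have [g ag] : exists g : F -> F, forall x, converges (fun n => star (a n) x) (g x).
  by apply: lim => m n; rewrite starB opnorm_star_le.
have flin : linear f.
  move=> c x y; apply: (converges_uniq (af _)).
  have := converges_lin c (af x) (af y).
  by congr converges; apply/funext => n; rewrite bop_lin.
have fadj x y : '[f x, y] = '[x, g y].
  by apply: (converges_inner (af x) (ag y)) => n; rewrite bop_adjP.
have [K aK] := aC 1 ltr01.
have fbd : exists M : R[i], forall x, `|f x| <= M * `|x|.
  exists (opnorm (a K) + 1) => x; apply: (converges_ler_norm (af x)).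
  exists K => n Kn; rewrite (le_trans (opnormP _ _)) // ler_wpM2r //.
  rewrite -[a n](subrK (a K)) (le_trans (opnormD _ _)) // addrC lerD2l.
  exact/ltW/aK.
pose S := Bop flin fbd fadj; exists S => e e0.
have e2 : 0 < e / 2 by rewrite divr_gt0.
have [N aN] := aC _ e2; exists N => n Nn.
apply: (@le_lt_trans _ _ (e / 2)); last by rewrite ltr_pdivrMr // ltr_pMr // ltr1n.
apply: opnorm_le => [|x]; first exact: ltW.
have := convergesB (converges_cst (a n x)) (af x).
rewrite (_ : a n x - f x = (a n - S) x); last by rewrite /= scaleN1r.
move/converges_ler_norm; apply; exists N => m Nm.
rewrite (_ : a n x - a m x = (a n - a m) x); last by rewrite /= scaleN1r.
by rewrite (le_trans (opnormP _ _)) // ler_wpM2r // ltW // aN.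
Qed.

HB.instance Definition _ := isCStar.Build R[i] (bop F)
  (@opnorm_ge0) (@opnorm0_eq0) opnormD opnormZ opnormM opnorm_star opnorm_complete.

Lemma dense_approx (X : set F) (x : F) (e : R[i]) : dense X -> 0 < e ->
  exists2 y, X y & `|x - y| < e.
Proof.
move=> Xd e0; have := @Xd (ball x e); case; first by exists x; exact: ballxx.
  exact: ball_open.
by move=> y [+ Xy]; rewrite -ball_normE; exists y.
Qed.

Lemma bop_dense_eq S T (X : set F) : dense (lin_span X) ->
  (forall x, X x -> S x = T x) -> S = T.
Proof.
move=> Xd XE; apply: bop_eq => x; apply/eqP; rewrite -subr_eq0 -normr_le0.
rewrite real_leNgt ?normr_real //; apply/negP => D0.
pose Q : bop F := S - T; have QE y : Q y = S y - T y by rewrite /= scaleN1r.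
rewrite -QE in D0; have [M M0 QM] := bop_bound_ge0 Q.
have c0 : 0 < M + 1 by rewrite ltr_wpDl.
have [y [n [c [w [Xw yE]]]] xy] := dense_approx x Xd (divr_gt0 D0 c0).
have Qy : Q y = 0.
  have Qs : forall v w, Q (v + w) = Q v + Q w := bopD Q.
  rewrite yE (big_morph _ Qs (bop0E Q)) big1 // => k _.
  by rewrite bopZ QE XE // subrr scaler0.
have h : `|Q x| <= (M + 1) * `|x - y|.
  by rewrite -{1}[Q x]subr0 -Qy -bopB (le_trans (QM _)) // ler_wpM2r // lerDl.
by move: xy; rewrite ltr_pdivlMr // mulrC => /lt_le_trans /(_ h); rewrite ltxx.
Qed.

Lemma dense_inner_inj (x y : F) (X : set F) : dense (lin_span X) ->
  (forall z, X z -> '[x, z] = '[y, z]) -> x = y.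
Proof.
move=> Xd XE; apply/eqP; rewrite -subr_eq0 -normr_le0.
rewrite real_leNgt ?normr_real //; apply/negP => D0.
have [w [n [c [z [Xz wE]]]] xw] := dense_approx (x - y) Xd D0.
have h : '[x - y, w] = 0.
  have Dr : {morph (fun v : F => '[x - y, v]) : u v / u + v} by move=> u v; exact: innerDr.
  have r0 : '[x - y, 0] = 0 by rewrite -[0 in LHS](scale0r (0 : F)) innerZr conjC0 mul0r.
  rewrite wE (big_morph _ Dr r0) big1 // => k _.
  by rewrite innerZr innerBl XE // subrr mulr0.
have : `|x - y| ^+ 2 <= `|x - y| * `|x - y - w|.
  rewrite inner_normE -[X in X <= _]ger0_norm -?inner_normE ?exprn_ge0 //.
  by rewrite inner_normE -{1}['[x - y, x - y]]subr0 -h -innerBr inner_cauchy_schwarz.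
by rewrite expr2 ler_pM2l // => /le_lt_trans /(_ xw); rewrite ltxx.
Qed.

End OperatorNorm.

(** * Free generalized circular families *)

(* The algebraic full Fock space on orthonormal letters (i, false) = xi_i and
   (i, true) = eta_i: a vector is its function of coordinates on words, so that
   l(x) is [push x] and l(x)^* is [pop x]. *)
Section StackModel.
Variables (C : numClosedFieldType) (I : eqType).
Notation letter := (I * bool)%type.
Notation vect := (seq letter -> C).
Notation oper := (vect -> vect).
Implicit Types (f g : vect).

Definition push (x : letter) : oper := fun f s =>
  if s is y :: s' then if y == x then f s' else 0 else 0.
Definition pop (x : letter) : oper := fun f s => f (x :: s).

Definition stack_circ (a b : I -> C) (i : I) (e : bool) : oper := fun f s =>
  if e then (a i)^* * pop (i, false) f s + (b i)^* * push (i, true) f s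
  else a i * push (i, false) f s + b i * pop (i, true) f s.

Definition stack_vac : vect := fun s => (s == [::])%:R.

Definition stack_word (a b : I -> C) (w : seq (bool * I)) (f : vect) : vect :=
  foldr (fun x => stack_circ a b x.2 x.1) f w.

Definition stack_moment a b w : C := stack_word a b w stack_vac [::].

Definition oper_linear (p : oper) := forall (c : C) f g,
  p (fun s => c * f s + g s) = fun s => c * p f s + p g s.

Lemma stack_circ_linear a b i e : oper_linear (stack_circ a b i e).
Proof.
move=> c f g; apply/funext => -[|y s]; rewrite /stack_circ /push /pop; case: e.
- by rewrite !mulr0 !addr0 mulrDr mulrCA.
- by rewrite !mulr0 !add0r mulrDr mulrCA.
- by case: ifP => _; rewrite ?mulr0 ?addr0 !mulrDr ?(mulrCA c) // addrACA.
- by case: ifP => _; rewrite ?mulr0 ?add0r !mulrDr ?(mulrCA c) // addrACA.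
Qed.

Section Pairs.
Variables (A : starAlgType C) (z : A) (Z : bool -> oper).

(* Elements of the *-algebra of z together with their images in the model. *)
Inductive starpair : A -> oper -> Prop :=
| starpair_gen e : starpair (starpow e z) (Z e)
| starpair_one : starpair 1 id
| starpair_lin c a p b q : starpair a p -> starpair b q ->
    starpair (c *: a + b) (fun f s => c * p f s + q f s)
| starpair_mul a p b q : starpair a p -> starpair b q ->
    starpair (a * b) (p \o q).

Lemma starpair_star_alg a p : starpair a p -> star_alg z a.
Proof.
elim=> [[]| |c {}a {}p b q _ ha _ hb|{}a {}p b q _ ha _ hb].
- exact/star_alg_star/star_alg_gen.
- exact: star_alg_gen.
- exact: star_alg_one.
- exact/star_alg_add/hb/star_alg_scale.
- exact: star_alg_mul.
Qed.

Lemma starpair_linear a p :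
  (forall e, oper_linear (Z e)) -> starpair a p -> oper_linear p.
Proof.
move=> ZL; elim=> [e| |d {}a {}p b q _ ha _ hb|{}a {}p b q _ ha _ hb] c f g //=.
- exact: ZL.
- apply/funext => s; rewrite ha hb !mulrDr !mulrA (mulrC d c) -!addrA.
  by congr (_ + _); rewrite addrCA.
- by rewrite hb ha.
Qed.

End Pairs.

Section Locality.
Variables (a b : I -> C) (i : I).

(** Cutting a word after its maximal prefix of letters of index i factors the Fock space as (Fock
    space of these letters) (x) (words not beginning with one of them). [iconv f g] is f (x) g in
    this factorization, and the operators of index i act on the first factor. *)
Definition ilen (s : seq letter) := find (fun x : letter => x.1 != i) s.
Definition iconv f g : vect := fun s => f (take (ilen s) s) * g (drop (ilen s) s).

Lemma iconv_push x f g : x.1 = i -> push x (iconv f g) = iconv (push x f) g.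
Proof.
move=> xi; apply/funext => -[|y s]; first by rewrite /iconv /= mul0r.
rewrite /iconv /=; have [->|yx] := eqVneq y x; first by rewrite xi eqxx /= eqxx.
by case: ifP => /=; rewrite ?(negbTE yx) !mul0r.
Qed.

Lemma iconv_pop x f g : x.1 = i -> pop x (iconv f g) = iconv (pop x f) g.
Proof. by move=> xi; apply/funext => s; rewrite /pop /iconv /= xi eqxx. Qed.

Lemma starpair_iconv (A : starAlgType C) (z x : A) p f g :
  starpair z (stack_circ a b i) x p -> p (iconv f g) = iconv (p f) g.
Proof.
move=> h; elim: h f => {x p}[e| |c x p y q _ hx _ hy|x p y q _ hx _ hy] f //=.
- rewrite /stack_circ !iconv_push ?iconv_pop //; apply/funext => s.
  by case: e; rewrite /iconv mulrDl !mulrA.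
- by rewrite hx hy; apply/funext => s; rewrite /iconv mulrDl mulrA.
- by rewrite hy hx.
Qed.

(** The condition [ilen s = 0] covers the words starting with another index and also the empty word;
    the latter is what makes the vacuum coordinate vanish. *)
Definition leads g := forall s, ilen s = 0%N -> g s = 0.

(** Here g is vacuum (x) g, so p g is (p vacuum) (x) g by locality; on a word with empty i-prefix
    its coordinate is that of p vacuum at the empty word times a value of g, and the first factor is
    0 by centring. *)
Lemma starpair_leads (A : starAlgType C) (z x : A) p g :
  starpair z (stack_circ a b i) x p -> p stack_vac [::] = 0 ->
  (forall y s, y.1 = i -> g (y :: s) = 0) -> leads (p g).
Proof.
move=> xp p0 g0 s s0; have -> : g = iconv stack_vac g.
  apply/funext => -[|y t]; rewrite /iconv /stack_vac /= ?mul1r //.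
  by case: ifP => [_|/negbFE/eqP yi]; rewrite /= ?mul1r // mul0r g0.
by rewrite (starpair_iconv _ _ xp) /iconv s0 take0 drop0 p0 mul0r.
Qed.

End Locality.

Section Uniqueness.
Variables (A : starAlgType C) (phi : A -> C) (z : I -> A) (a b : I -> C).
Hypotheses (phi_lin : scalar phi) (phi1 : phi 1 = 1) (z_free : free_family phi z).
Hypothesis marginal : forall i (w : seq bool),
  phi (\prod_(e <- w) starpow e (z i)) = stack_moment a b [seq (e, i) | e <- w].

Notation pair i := (starpair (z i) (stack_circ a b i)).

(** Elements of A may satisfy relations that the operators are not known to satisfy, so there is no
    map x -> p to work with, and the induction runs over pairs. It is closed under products because
    of [Q]: y matches f after every word in z, and multiplying by x and applying p preserves
    this. *)
Lemma marginal_starpair i x p : pair i x p -> phi x = p stack_vac [::].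
Proof.
pose Q y f := forall w : seq bool, phi ((\prod_(e <- w) starpow e (z i)) * y) =
  stack_word a b [seq (e, i) | e <- w] f [::].
have wl w : oper_linear (fun f => stack_word a b w f).
  by elim: w => //= u w IH c f g; rewrite IH stack_circ_linear.
suff h : pair i x p -> forall y f, Q y f -> Q (x * y) (p f).
  move=> /h /(_ 1 stack_vac); rewrite /Q => /(_ _ [::]); rewrite big_nil mul1r mulr1.
  by apply => w; rewrite mulr1 marginal.
elim=> {x p}[e| |c x p y q _ hx _ hy|x p y q _ hx _ hy] u f uf w /=.
- have := uf (w ++ [:: e]); rewrite big_cat big_seq1 -mulrA => ->.
  by rewrite cats1 map_rcons /stack_word foldr_rcons.
- by rewrite mul1r uf.
- have := hx _ _ uf w; have := hy _ _ uf w; rewrite wl => <- <-.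
  by rewrite mulrDl mulrDr -scalerAl -scalerAr phi_lin.
- by rewrite -mulrA; apply: hx => //; apply: hy.
Qed.

Notation triple := (I * A * oper)%type.
Definition valid (t : triple) := pair t.1.1 t.1.2 t.2.
Definition vprod (s : seq triple) : A := \prod_(t <- s) t.1.2.
Definition oprod (s : seq triple) : vect := foldr (fun t : triple => t.2) stack_vac s.

Fixpoint allp (P : triple -> Prop) (s : seq triple) : Prop :=
  if s is t :: s' then P t /\ allp P s' else True.

Lemma allp_cat P (s t : seq triple) : allp P (s ++ t) <-> allp P s /\ allp P t.
Proof.
elim: s => [|x s IH] /=; first by split=> // -[].
by split=> [[Px /IH[]]|[[Px Ps] Pt]] //; split=> //; apply/IH.
Qed.

Lemma allp_nth P (s : seq triple) t0 k : allp P s -> (k < size s)%N -> P (nth t0 s k).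
Proof. by elim: s k => [|x s IH] //= [|k] [Px Ps] //; apply: IH. Qed.

Definition alternating : rel triple := fun t u => t.1.1 != u.1.1.

Lemma not_alternating (s : seq triple) : ~~ sorted alternating s ->
  exists s1 t u s2, s = s1 ++ [:: t, u & s2] /\ t.1.1 = u.1.1.
Proof.
case: s => // t s; elim: s t => // u s IH t /=; rewrite negb_and negbK.
have [tu _|_ /= /IH] := eqVneq t.1.1 u.1.1; first by exists [::], t, u, s.
by move=> [s1 [x [y [s2 [-> xy]]]]]; exists (t :: s1), x, y, s2.
Qed.

Lemma oprod_cat (s t : seq triple) :
  oprod (s ++ t) = foldr (fun u : triple => u.2) (oprod t) s.
Proof. by rewrite /oprod foldr_cat. Qed.

Lemma oprod_lin (s : seq triple) c f g : allp valid s ->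
  foldr (fun u : triple => u.2) (fun w => c * f w + g w) s =
  fun w => c * foldr (fun u : triple => u.2) f s w + foldr (fun u : triple => u.2) g s w.
Proof.
elim: s => //= t s IH [tv /IH ->].
by rewrite (starpair_linear (stack_circ_linear a b t.1.1) tv).
Qed.

(** For a nonempty list both sides are 0: the left one by freeness, the right one because each
    centred factor maps a vector led by the next index to a vector led by its own. *)
Lemma alternating_centered (s : seq triple) : sorted alternating s ->
  allp valid s -> allp (fun t => phi t.1.2 = 0) s ->
  phi (vprod s) = oprod s [::].
Proof.
case: s => [|t0 s]; first by rewrite /vprod big_nil phi1 /= /stack_vac eqxx.
move=> sa sv sc; rewrite /vprod (big_nth t0) big_mkord.
rewrite (z_free (i := fun r => (nth t0 (t0 :: s) r).1.1)) //; first 1 last.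
- by move=> r; apply: starpair_star_alg; apply: (allp_nth t0 sv).
- by move=> r; apply: (allp_nth t0 sc).
- move=> r q qr /eqP; apply/negP; rewrite qr.
  by apply: (pathP t0 sa); rewrite -ltnS -qr.
suff lead : leads t0.1.1 (oprod (t0 :: s)) by rewrite lead.
elim: s t0 sa sv sc => [|u s IH] t sa [tv sv] [tc sc].
  apply: (starpair_leads tv); first by rewrite -(marginal_starpair tv).
  by move=> y s yt; rewrite /= /stack_vac.
apply: (starpair_leads tv); first by rewrite -(marginal_starpair tv).
move: sa => /= /andP[tu sa] y w yt.
by apply: (IH u sa sv sc); rewrite /ilen /= yt (tu : t.1.1 != u.1.1).
Qed.

(** Freeness and marginals determine the moments. Factors are centred from left to right, [pre]
    being the part already centred; the scalar subtracted from a factor leaves a product with one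
    factor less, covered by the induction on the length. Once all are centred, the list either
    alternates or has two neighbours of equal index, and merging these shortens it again. *)
Lemma free_joint (s : seq triple) : allp valid s -> phi (vprod s) = oprod s [::].
Proof.
have [n] := ubnP (size s); elim: n s => // n IH s sn sv.
suff h suf pre : (size (pre ++ suf) < n.+1)%N -> allp valid (pre ++ suf) ->
    allp (fun t => phi t.1.2 = 0) pre -> phi (vprod (pre ++ suf)) = oprod (pre ++ suf) [::].
  exact: (h s [::]).
elim: suf pre => [|t suf IHs] pre.
  rewrite cats0 => pn pv pc; have [|/not_alternating] := boolP (sorted alternating pre).
    by move/alternating_centered; apply.
  move=> [s1 [t [u [s2 [E tu]]]]]; move: pv pn; rewrite {}E {pc}.
  move=> /allp_cat[v1 [vt [vu v2]]]; rewrite size_cat /= addnS => pn.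
  pose tt : triple := (t.1.1, t.1.2 * u.1.2, t.2 \o u.2).
  have := IH (s1 ++ tt :: s2); rewrite size_cat /= => /(_ pn).
  have -> : vprod (s1 ++ tt :: s2) = vprod (s1 ++ [:: t, u & s2]).
    by rewrite /vprod !big_cat !big_cons /= !mulrA.
  rewrite !oprod_cat; apply.
  apply/allp_cat; split=> //=; split=> //; apply: starpair_mul => //.
  by rewrite /tt /= tu.
move=> pn /allp_cat[pv [tv sv']] pc; pose c := phi t.1.2.
pose t' : triple :=
  (t.1.1, (- c) *: 1 + t.1.2, fun f w => - c * id f w + t.2 f w).
have t'v : valid t' by apply: starpair_lin => //; exact: starpair_one.
have t'c : phi t'.1.2 = 0 by rewrite /= phi_lin phi1 /= mulr1 addNr.
have := IHs (rcons pre t'); rewrite cat_rcons.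
have : (size (pre ++ suf) < n)%N by move: pn; rewrite !size_cat /= addnS.
move/IH => /(_ (proj2 (allp_cat _ _ _) (conj pv sv'))) h1.
have pn' : (size (pre ++ t' :: suf) < n.+1)%N by move: pn; rewrite !size_cat.
move=> /(_ pn') h2.
have {h2} := h2 (proj2 (allp_cat _ pre (t' :: suf)) (conj pv (conj t'v sv'))).
rewrite -cats1 => /(_ (proj2 (allp_cat _ pre [:: t']) (conj pc (conj t'c Logic.I)))).
move: h1; rewrite /vprod !big_cat !big_cons /= !oprod_cat /=.
rewrite mulrDl mulrDr -scalerAl mul1r -scalerAr phi_lin => h1.
by rewrite oprod_lin // h1 => /addrI.
Qed.

Lemma free_stack_moment (w : seq (bool * I)) :
  phi (\prod_(x <- w) starpow x.1 (z x.2)) = stack_moment a b w.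
Proof.
pose s : seq triple :=
  [seq (x.2, starpow x.1 (z x.2), stack_circ a b x.2 x.1) | x <- w].
have sv : allp valid s.
  by rewrite /s; elim: w {s} => //= x w IH; split=> //; exact: starpair_gen.
have := free_joint sv; rewrite /vprod /oprod big_map /= => ->.
by rewrite /stack_moment /stack_word foldr_map.
Qed.

End Uniqueness.

End StackModel.

(** * Moments of a generalized circular element in a Fock space *)

Section FockCircular.
Variables (R : realType) (H F : nzHilbertType R[i]) (tens : seq H -> F).
Hypothesis Ft : full_fock tens.
Local Notation C := R[i].

Lemma tens_cons (x y : H) (s t : seq H) :
  '[tens (x :: s), tens (y :: t)] = '[x, y] * '[tens s, tens t].
Proof.
rewrite !(proj1 Ft) /= eqSS; case: ifP => _; last by rewrite mulr0.
by rewrite big_ord_recl.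
Qed.

Lemma tens_nil (x : H) (s : seq H) : '[tens [::], tens (x :: s)] = 0.
Proof. by rewrite (proj1 Ft). Qed.

Lemma tens_vac : '[tens [::], tens [::]] = 1.
Proof. by rewrite (proj1 Ft) /= big_ord0. Qed.

Lemma tens_inj (x y : F) : (forall s, '[x, tens s] = '[y, tens s]) -> x = y.
Proof. by move=> xy; apply: (dense_inner_inj (proj2 Ft)) => _ [s _ <-]. Qed.

Lemma inner0l (G : nzHilbertType R[i]) (x : G) : '[0, x] = 0.
Proof. by rewrite -[0 in LHS](scale0r (0 : G)) innerZl mul0r. Qed.

Lemma inner0r (G : nzHilbertType R[i]) (x : G) : '[x, 0] = 0.
Proof. by rewrite innerC inner0l conjC0. Qed.

Lemma annihilation_cons (xi : H) (L : bop F) (x : H) (s : seq H) :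
  creation tens xi L -> star L (tens (x :: s)) = '[x, xi] *: tens s.
Proof.
by move=> cL; apply: tens_inj => t; rewrite bop_star_adjP cL tens_cons innerZl.
Qed.

Lemma annihilation_nil (xi : H) (L : bop F) :
  creation tens xi L -> star L (tens [::]) = 0.
Proof.
by move=> cL; apply: tens_inj => t; rewrite bop_star_adjP cL tens_nil inner0l.
Qed.

(** The coordinates of a Fock space vector against the tensors in xi and eta form a vector of the
    stack model, set to 0 on words with letters of index other than i. Passing to coordinates turns
    L, M and their adjoints into [push] and [pop]. *)
Lemma fock_stack_moment (I : eqType) (a b : I -> C) (i : I) (xi eta : H)
    (L M : bop F) (w : seq bool) :
  '[xi, xi] = 1 -> '[eta, eta] = 1 -> '[xi, eta] = 0 ->
  creation tens xi L -> creation tens eta M ->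
  vacuum tens (\prod_(e <- w) starpow e (a i *: L + b i *: star M)) =
  stack_moment a b [seq (e, i) | e <- w].
Proof.
move=> xi1 eta1 xieta cL cM.
have etaxi : '[eta, xi] = 0 by rewrite innerC xieta conjC0.
pose emb (x : I * bool) := if x.2 then eta else xi.
pose coord (v : F) (s : seq (I * bool)) : C :=
  if all (fun x => x.1 == i) s then '[v, tens (map emb s)] else 0.
have coord_push x N v : x.1 = i -> creation tens (emb x) N ->
    coord (N v) = push x (coord v).
  move=> xi' cN; apply/funext => -[|y s]; rewrite /coord /push /=.
    by rewrite bop_adjP -[bop_adj N _]/(star N _) (annihilation_nil cN) inner0r.
  case: eqP => [yi|yi] /=; last by case: eqP => // yx; case: yi; rewrite yx.
  rewrite bop_adjP -[bop_adj N _]/(star N _) (annihilation_cons _ _ cN) innerZr.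
  have -> : '[emb y, emb x] = (y == x)%:R.
    move: x y xi' yi {cN} => [j e] [k f] /= -> ->; rewrite xpair_eqE eqxx /=.
    by case: e; case: f; rewrite /emb /= ?xi1 ?eta1.
  by case: eqP => _; rewrite ?conjC1 ?mul1r ?conjC0 ?mul0r //; case: ifP.
have coord_pop x N v : x.1 = i -> creation tens (emb x) N ->
    coord (star N v) = pop x (coord v).
  move=> xi' cN; apply/funext => s; rewrite /coord /pop /= xi' eqxx /=.
  by rewrite bop_star_adjP cN.
have coord_lin c d v u s : coord (c *: v + d *: u) s = c * coord v s + d * coord u s.
  rewrite /coord; case: ifP => _; first by rewrite innerDl !innerZl.
  by rewrite !mulr0 addr0.
have cX e v : coord (starpow e (a i *: L + b i *: star M) v) =
    stack_circ a b i e (coord v).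
  apply/funext => s; case: e => /=.
    rewrite -[bop_adj L v]/(star L v).
    by rewrite coord_lin (coord_pop (i, false)) // (coord_push (i, true)).
  rewrite -[bop_adj M v]/(star M v).
  by rewrite coord_lin (coord_pop (i, true)) // (coord_push (i, false)).
have cvac : coord (tens [::]) = @stack_vac C I.
  apply/funext => s; rewrite /coord /stack_vac.
  case: s => [|x s] /=; first by rewrite tens_vac.
  by case: ifP => _; rewrite ?tens_nil.
rewrite /vacuum /stack_moment -cvac.
rewrite -[LHS]/(coord ((\prod_(e <- w) starpow e (a i *: L + b i *: star M)) _) [::]).
congr (_ [::]); elim: w => [|e w IH]; first by rewrite big_nil.
by rewrite big_cons /= -IH -cX.
Qed.

Lemma scalar_vacuum : scalar (vacuum tens).
Proof. by move=> c S T; rewrite /vacuum /= innerDl innerZl. Qed.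

Lemma vacuum1 : vacuum tens 1 = 1.
Proof. exact: tens_vac. Qed.

End FockCircular.

(** The parameters are positive and their squares are the two variances, so they are 1 and sqrt l.
    Only the value of [b] at i matters, since all letters of the word have index i. *)
Lemma gen_circular_marginal (R : realType) (A : starAlgType R[i]) (phi : A -> R[i])
    (z : A) (l : R) : 0 <= l ->
  (exists a b, gen_circular a b phi z) ->
  phi (star z * z) = 1 -> phi (z * star z) = l%:C%C ->
  forall (I : eqType) (i : I) (b : I -> R[i]) (w : seq bool),
    b i = (Num.sqrt l)%:C%C ->
    phi (\prod_(e <- w) starpow e z) = stack_moment (fun=> 1) b [seq (e, i) | e <- w].
Proof.
move=> l0 [a [b [a0 b0 [H [F [tens [xi [eta [L [M [Ft [xi1 eta1 xe] cL cM zd]]]]]]]]]]].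
have mom (I : eqType) (i : I) (w : seq bool) : phi (\prod_(e <- w) starpow e z) =
    stack_moment (fun=> a) (fun=> b) [seq (e, i) | e <- w].
  rewrite -(fock_stack_moment Ft (fun=> a) (fun=> b) i w xi1 eta1 xe cL cM).
  by rewrite big_tnth [in RHS]big_tnth; exact: zd.
have aR : a^* = a by apply/CrealP; rewrite ger0_real // ltW.
have bR : b^* = b by apply/CrealP; rewrite ger0_real // ltW.
(* The words z* z and z z*, evaluated in the stack model over a one-letter index set, give a^2 and
   b^2. *)
have := mom unit tt [:: true; false]; have := mom unit tt [:: false; true].
rewrite !big_cons !big_nil !mulr1 /stack_moment /= /stack_circ /push /pop /=.
rewrite /stack_vac /= aR bR => h1 h2 m1 m2 I i b' w bi.
have a1 : a = 1.
  apply/eqP; rewrite -(@eqrXn2 _ 2) ?ltW // expr1n.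
  by rewrite -m1 h2 !mulr1 !mulr0 !addr0.
have bl : b = (Num.sqrt l)%:C%C.
  apply/eqP; rewrite -(@eqrXn2 _ 2) ?(ltW b0) ?ler0c ?sqrtr_ge0 //.
  by rewrite -rmorphXn /= sqr_sqrtr // -m2 h1 !mulr0 !add0r mulr1.
rewrite (mom I i) /stack_moment; congr (_ [::]); rewrite -/(@stack_vac R[i] I).
elim: w => //= e w ->; apply/funext => s.
by rewrite /stack_circ a1 bl bi.
Qed.

(** * Towers of corepresentation spaces *)

Section Adjoint.
Variable C : numClosedFieldType.

Definition adjmx m n (A : 'M[C]_(m, n))  : 'M[C]_(n, m) := map_mx Num.conj A^T.

Lemma adjmxE m n (A : 'M[C]_(m, n)) i j : adjmx A i j = (A j i)^*.
Proof. by rewrite !mxE. Qed.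

Lemma adjmxK m n : cancel (@adjmx m n) (@adjmx n m).
Proof. by move=> A; apply/matrixP => i j; rewrite !mxE conjCK. Qed.

Lemma adjmxM m n p (A : 'M[C]_(m, n)) (B : 'M[C]_(n, p)) :
  adjmx (A *m B) = adjmx B *m adjmx A.
Proof. by rewrite /adjmx trmx_mul map_mxM. Qed.

Lemma adjmxZ m n c (A : 'M[C]_(m, n)) : adjmx (c *: A) = c^* *: adjmx A.
Proof. by apply/matrixP => i j; rewrite !mxE rmorphM. Qed.

Lemma adjmxD m n : {morph @adjmx m n : A B / A + B}.
Proof. by move=> A B; apply/matrixP => i j; rewrite !mxE rmorphD. Qed.

Lemma adjmxN m n : {morph @adjmx m n : A / - A}.
Proof. by move=> A; apply/matrixP => i j; rewrite !mxE rmorphN. Qed.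

Lemma adjmx0 m n : adjmx (0 : 'M[C]_(m, n)) = 0.
Proof. by apply/matrixP => i j; rewrite !mxE conjC0. Qed.

Lemma adjmx_sum m n (I : Type) (r : seq I) P (A : I -> 'M[C]_(m, n)) :
  adjmx (\sum_(i <- r | P i) A i) = \sum_(i <- r | P i) adjmx (A i).
Proof. exact: (big_morph _ (@adjmxD m n) (@adjmx0 m n)). Qed.

Lemma adjmx_delta m n i j : adjmx (delta_mx i j : 'M[C]_(m, n)) = delta_mx j i.
Proof. by rewrite /adjmx trmx_delta map_delta_mx. Qed.

(** Q is an orthonormal basis, by Gram-Schmidt, of the orthogonal complement of the rows of V.
    Stacking V on Q gives a square matrix with orthonormal rows, hence orthonormal columns, which is
    the last identity. *)
Lemma coisometry_complement d n (V : 'M[C]_(d, n)) : V *m adjmx V = 1%:M ->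
  exists D (Q : 'M[C]_(D, n)),
    [/\ Q *m adjmx Q = 1%:M, Q *m adjmx V = 0 &
        adjmx Q *m Q = 1%:M - adjmx V *m V].
Proof.
move=> VV; have VU : V \is unitarymx by apply/unitarymxP.
set P := orthomx (@Num.conj C) (mx_of_hermitian (hermitian1mx _)) V.
pose Q := schmidt (row_base P); exists (\rank P), Q.
have QQ : Q *m adjmx Q = 1%:M.
  by apply/unitarymxP/schmidt_unitarymx; exact: rank_leq_col.
have QV : Q *m adjmx V = 0.
  by apply/orthomx1P; rewrite eqmx_schmidt_free ?row_base_free // eq_row_base.
have VQ : V *m adjmx Q = 0 by rewrite -[LHS]adjmxK adjmxM adjmxK QV adjmx0.
split=> //; pose U := col_mx V Q.
have UU : U *m adjmx U = 1%:M.
  rewrite /U /adjmx tr_col_mx map_row_mx mul_col_row.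
  by rewrite -!/(adjmx _) VV QV VQ QQ -scalar_mx_block.
have dn : (d + \rank P)%N = n.
  by rewrite -(mxrank_unitary VU) add_rank_ortho.
(* The stacked matrix is square only through the propositional equality [dn], so the exchange of the
   factors is stated for two dimensions known to be equal. *)
have inv p q (X : 'M[C]_(p, q)) : p = q -> X *m adjmx X = 1%:M -> adjmx X *m X = 1%:M.
  by move=> pq; subst q; exact: mulmx1C.
have := inv _ _ _ dn UU.
rewrite /U /adjmx tr_col_mx map_row_mx mul_row_col -!/(adjmx _) => <-.
by rewrite addrAC subrr add0r.
Qed.

Section HStack.
Variable N : nat.

Definition hstack p q (M : 'I_N -> 'M[C]_(p, q)) : 'M[C]_(p, N * q) :=
  \matrix_a mxvec (\matrix_(j, b) M j a b).
Definition hslice p q (Q : 'M[C]_(p, N * q)) (j : 'I_N) : 'M[C]_(p, q) :=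
  \matrix_(a, b) Q a (mxvec_index j b).

Lemma hstackE p q (M : 'I_N -> 'M[C]_(p, q)) a j b :
  hstack M a (mxvec_index j b) = M j a b.
Proof. by rewrite mxE mxvecE mxE. Qed.

Lemma hsliceK p q (Q : 'M[C]_(p, N * q)) : hstack (hslice Q) = Q.
Proof.
by apply/matrixP => a i; case/mxvec_indexP: i => j b; rewrite hstackE mxE.
Qed.

Lemma hstack_mul p q r (M : 'I_N -> 'M[C]_(p, q)) (M' : 'I_N -> 'M[C]_(r, q)) :
  hstack M *m adjmx (hstack M') = \sum_j M j *m adjmx (M' j).
Proof.
apply/matrixP => a b; rewrite mxE summxE.
rewrite (reindex _ (curry_mxvec_bij _ _)) /=.
transitivity (\sum_(x : 'I_N * 'I_q) M x.1 a x.2 * (M' x.1 b x.2)^*).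
  by apply: eq_bigr => -[j k] _ /=; rewrite adjmxE !hstackE.
rewrite -(pair_bigA _ (fun j k => M j a k * (M' j b k)^*)) /=.
by apply: eq_bigr => j _; rewrite mxE; apply: eq_bigr => k _; rewrite adjmxE.
Qed.

Lemma mul_hstack p q r (M : 'I_N -> 'M[C]_(p, q)) (M' : 'I_N -> 'M[C]_(p, r)) j b k c :
  (adjmx (hstack M) *m hstack M') (mxvec_index j b) (mxvec_index k c) =
  (adjmx (M j) *m M' k) b c.
Proof.
by rewrite !mxE; apply: eq_bigr => a _; rewrite !adjmxE !hstackE.
Qed.

End HStack.
End Adjoint.

Section Ladder.
Variables (C : numClosedFieldType) (N : nat).

(** The map x -> sum_j e_j (x) twist F M j x inserts the vector sum F_mj e_j (x) e_m in front of x
    and lets M absorb its second leg. With M = [lup n] this is, up to a scalar, the embedding of H_n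
    into V (x) H_(n+1). *)
Definition twist (F : 'M[C]_N) p q (M : 'I_N -> 'M[C]_(p, q)) (j : 'I_N) :=
  \sum_m F m j *: M m.

(* [ladder F c]: V (x) H_n is the orthogonal sum of H_{n+1} and H_{n-1} for
   V = C^N, the compression of e_j (x) - to H_{n+1} being [lup n j] and the one
   to H_{n-1} being sqrt (c n) times the adjoint of [ltw n.-1 j]. *)
Record ladder (F : 'M[C]_N) (c : nat -> C) := Ladder {
  ldim : nat -> nat;
  lup : forall n, 'I_N -> 'M[C]_(ldim n.+1, ldim n);
  ltw := fun n => twist F (@lup n);
  ldim0 : (0 < ldim 0)%N;
  lup_sum : forall n, \sum_j lup n j *m adjmx (lup n j) = 1%:M;
  lup0 : forall j k, adjmx (lup 0 j) *m lup 0 k = (j == k)%:R%:M;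
  lupS : forall n j k, adjmx (lup n.+1 j) *m lup n.+1 k =
    (j == k)%:R%:M - c n.+1 *: (ltw n j *m adjmx (ltw n k));
  lup_tw : forall n, \sum_j lup n.+1 j *m ltw n j = 0;
  ltw_sum : forall n, c n.+1 *: (\sum_j adjmx (ltw n j) *m ltw n j) = 1%:M
}.

Variables (F : 'M[C]_N) (c : nat -> C).
Hypotheses (FF : F *m map_mx Num.conj F = - 1%:M) (c0 : c 0 = 0).
Hypothesis c_gt0 : forall n, 0 < c n.+1.
Hypothesis cS : forall n, c n.+1 * (\tr (adjmx F *m F) - c n) = 1.

Lemma twistK p q (M : 'I_N -> 'M[C]_(p, q)) j :
  \sum_m (F m j)^* *: twist F M m = - M j.
Proof.
rewrite /twist; under eq_bigr do rewrite scaler_sumr.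
rewrite exchange_big /=; transitivity (\sum_a (F *m map_mx Num.conj F) a j *: M a).
  apply: eq_bigr => a _; rewrite mxE scaler_suml; apply: eq_bigr => m _.
  by rewrite scalerA mxE mulrC.
rewrite FF (bigD1 j) //= big1 ?addr0 => [|a aj]; first by rewrite !mxE eqxx scaleN1r.
by rewrite !mxE (negbTE aj) oppr0 scale0r.
Qed.

Lemma twist_gram p q (M : 'I_N -> 'M[C]_(p, q)) :
  \sum_j adjmx (twist F M j) *m twist F M j =
  \sum_j \sum_m \sum_k ((F m j)^* * F k j) *: (adjmx (M m) *m M k).
Proof.
apply: eq_bigr => j _; rewrite /twist adjmx_sum mulmx_suml; apply: eq_bigr => m _.
rewrite mulmx_sumr; apply: eq_bigr => k _.
by rewrite adjmxZ -scalemxAl -scalemxAr scalerA.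
Qed.

(** Source of the recursion for c. The identity part of the Gram relation contributes Tr(F* F); in
    the correction a second twist, by conj F, undoes the first one up to sign ([twistK]), leaving e
    sum_j M'_j M'_j*, that is e. *)
Lemma twist_sum p q r (M : 'I_N -> 'M[C]_(q, p)) (M' : 'I_N -> 'M[C]_(p, r)) e :
  (forall j k, adjmx (M j) *m M k =
     (j == k)%:R%:M - e *: (twist F M' j *m adjmx (twist F M' k))) ->
  e *: (\sum_j M' j *m adjmx (M' j)) = e%:M ->
  \sum_j adjmx (twist F M j) *m twist F M j = (\tr (adjmx F *m F) - e)%:M.
Proof.
move=> MM M1; rewrite twist_gram.
transitivity (\sum_j ((\sum_m (F m j)^* * F m j)%:M -
    e *: ((\sum_m (F m j)^* *: twist F M' m) *m
          adjmx (\sum_k (F k j)^* *: twist F M' k)))).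
  apply: eq_bigr => j _; rewrite mulmx_suml scaler_sumr raddf_sum /= -sumrB.
  apply: eq_bigr => m _; under eq_bigr do rewrite MM scalerBr.
  rewrite sumrB; congr (_ - _).
    rewrite (bigD1 m) //= big1 ?addr0 => [|k km]; first by rewrite eqxx scalemx1.
    by rewrite eq_sym (negbTE km) raddf0 scaler0.
  rewrite adjmx_sum mulmx_sumr scaler_sumr; apply: eq_bigr => k _.
  rewrite adjmxZ conjCK -scalemxAr -scalemxAl !scalerA; congr (_ *: _).
  by rewrite mulrC (mulrC (F k j)).
rewrite sumrB -raddf_sum /= -scaler_sumr raddfB /=; congr (_ - _).
  rewrite /mxtrace; congr (_%:M); apply: eq_bigr => j _; rewrite mxE.
  by apply: eq_bigr => m _; rewrite adjmxE.
rewrite -M1; congr (_ *: _); apply: eq_bigr => j _.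
by rewrite !twistK adjmxN mulNmx mulmxN opprK.
Qed.

(** One rung of the tower: the dimensions of H_n and H_(n+1) with the maps [lup n]. They are packed
    in a dependent sum because the next dimension is a rank found during the construction. *)
Definition stage := {p : nat & {q : nat & 'I_N -> 'M[C]_(q, p)}}.

Definition stage_ok (n : nat) (s : stage) : Prop :=
  let M := projT2 (projT2 s) in
  \sum_j M j *m adjmx (M j) = 1%:M /\
  c n.+1 *: (\sum_j adjmx (twist F M j) *m twist F M j) = 1%:M.

Definition next_ok (n : nat) (s : stage)
    (t : {D : nat & 'I_N -> 'M[C]_(D, projT1 (projT2 s))}) : Prop :=
  let M := projT2 (projT2 s) in let M' := projT2 t in
  [/\ \sum_j M' j *m adjmx (M' j) = 1%:M,
      (forall j k, adjmx (M' j) *m M' k =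
        (j == k)%:R%:M - c n.+1 *: (twist F M j *m adjmx (twist F M k))) &
      \sum_j M' j *m twist F M j = 0].

(** H_(n+2) is the orthogonal complement of the copy of H_n in V (x) H_(n+1), and the new maps are
    the N slices of the coisometry onto it. With the implication below the existential, [next] is
    total and [stages] is defined before its correctness is known. *)
Lemma next_ex n s : exists t, stage_ok n s -> @next_ok n s t.
Proof.
case: (pselect (stage_ok n s)) => [ok|nok]; last first.
  by exists (existT _ 0%N (fun=> 0)).
case: s ok => p [q M] [/= M1 tw1].
pose k := sqrtC (c n.+1); have k_real : k^* = k.
  by apply/CrealP; rewrite ger0_real // sqrtC_ge0 ltW.
have k0 : k != 0 by rewrite sqrtC_eq0 gt_eqF.
have kk : k * k = c n.+1 by rewrite -expr2 sqrtCK.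
(* The scalar sqrt (c_(n+1)) makes V a coisometry, by the second half of [stage_ok]. *)
pose V := hstack (fun j => k *: adjmx (twist F M j)).
have VV : V *m adjmx V = 1%:M.
  rewrite hstack_mul -tw1 scaler_sumr; apply: eq_bigr => j _.
  by rewrite adjmxZ adjmxK k_real -scalemxAl -scalemxAr scalerA kk.
have [D [Q [QQ QV Q1]]] := coisometry_complement VV.
exists (existT _ D (hslice Q)) => _; rewrite /next_ok /=.
rewrite -(hsliceK Q) in QQ QV; rewrite !hstack_mul in QQ QV.
split=> //.
- move=> j l; apply/matrixP => a b.
  rewrite -mul_hstack hsliceK Q1 mxE [in RHS]mxE; congr (_ + _).
    rewrite !mxE (inj_eq (@cast_ord_inj _ _ _)) (inj_eq enum_rank_inj) xpair_eqE.
    by case: eqP; case: eqP.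
  rewrite mxE mul_hstack adjmxZ adjmxK k_real.
  by rewrite [in RHS]mxE -scalemxAl -scalemxAr scalerA kk.
- apply: (scalerI k0); rewrite scaler0 -[RHS]QV scaler_sumr; apply: eq_bigr => j _.
  by rewrite adjmxZ adjmxK k_real scalemxAr.
Qed.

Definition next n s := projT1 (cid (next_ex n s)).

Fixpoint stages (n : nat) : stage :=
  if n is m.+1 then
    let s := stages m in
    existT _ (projT1 (projT2 s))
      (existT _ (projT1 (next m s)) (projT2 (next m s)))
  else existT _ 1%N (existT _ N (fun j => delta_mx j 0)).

Lemma delta_gram (j k : 'I_N) :
  adjmx (delta_mx j 0 : 'M[C]_(N, 1)) *m delta_mx k 0 = (j == k)%:R%:M.
Proof.
rewrite adjmx_delta mul_delta_mx_cond; case: eqP => _; last by rewrite mulr0n raddf0.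
by apply/matrixP => a b; rewrite !ord1 !mxE.
Qed.

Lemma stages_ok n : stage_ok n (stages n).
Proof.
elim: n => [|n IH].
  have trF : c 1 * \tr (adjmx F *m F) = 1 by rewrite -[RHS](cS 0) c0 subr0.
  split=> /=; last first.
    (* The level below H_0 is the zero space, a matrix with no columns, and its weight is c_0 =
       0. *)
    rewrite (@twist_sum _ _ _ _ (fun=> 0 : 'M[C]_(1, 0)) 0).
    - by rewrite subr0 -scalemx1 scalerA trF scale1r.
    - by move=> j k; rewrite scale0r subr0 delta_gram.
    - by rewrite scale0r raddf0.
  rewrite mx1_sum_delta; apply: eq_bigr => j _.
  by rewrite adjmx_delta mul_delta_mx.
have [/= h1 h2 h3] := projT2 (cid (next_ex n (stages n))) IH.
split=> //=; rewrite (@twist_sum _ _ _ _ _ (c n.+1) h2).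
  by rewrite -scalemx1 scalerA cS scale1r.
by rewrite (proj1 IH) scalemx1.
Qed.

Lemma ladder_exists : inhabited (ladder F c).
Proof.
pose d n := projT1 (stages n); pose T n : 'I_N -> 'M[C]_(d n.+1, d n) :=
  projT2 (projT2 (stages n)).
have ok n : next_ok n (next n (stages n)) :=
  projT2 (cid (next_ex n (stages n))) (stages_ok n).
constructor; apply: (@Ladder F c d T) => //.
- by move=> n; case: (stages_ok n).
- by move=> j k; exact: delta_gram.
- by move=> n j k; case: (ok n) => _ h _; exact: h.
- by move=> n; case: (ok n).
- by move=> n; case: (stages_ok n).
Qed.

End Ladder.

(** * Operators on the sum of the blocks *)

Section StrongSum.
Variables (R : realType) (G : nzHilbertType R[i]).
Local Notation C := R[i].

Lemma bounded_monotone_cauchy (t : nat -> R) (B : R) :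
  {homo t : m n / (m <= n)%N >-> m <= n} -> (forall n, t n <= B) ->
  forall e, 0 < e -> exists K, forall n, (K <= n)%N -> t n - t K < e.
Proof.
move=> tmono tB e e0; pose E := range t.
have Es : has_sup E by split; [exists (t 0%N), 0%N|exists B => _ [n _ <-]].
have [_ [K _ <-] tK] := sup_adherent e0 Es; exists K => n Kn.
rewrite ltrBlDr -ltrBlDl (le_lt_trans _ tK) // lerB //.
by apply: sup_upper_bound => //; exists n.
Qed.

Lemma bounded_sum_cauchy (a : nat -> C) (B : C) :
  (forall n, 0 <= a n) -> (forall K, \sum_(n < K) a n <= B) ->
  forall e, 0 < e -> exists K, forall m, \sum_(n < m) a (K + n)%N < e.
Proof.
move=> a0 aB e e0; pose t K := complex.Re (\sum_(n < K) a n).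
have tE K : \sum_(n < K) a n = (t K)%:C%C by apply/ge0_RRe/sumr_ge0.
have ee : e = (complex.Re e)%:C%C by apply/ge0_RRe/ltW.
have BE : B = (complex.Re B)%:C%C.
  by apply: ge0_RRe; have := aB 0%N; rewrite big_ord0.
have tS K m : \sum_(n < m) a (K + n)%N = (t (K + m)%N - t K)%:C%C.
  by rewrite rmorphB /= -!tE big_split_ord /= addrC addrK.
have [|||K tK] := @bounded_monotone_cauchy t (complex.Re B) _ _ (complex.Re e).
- move=> m n /subnKC <-; rewrite -subr_ge0 -(@lecR R) -tS.
  by apply: sumr_ge0.
- by move=> n; rewrite -(@lecR R) -tE -BE.
- by rewrite -(@ltcR R) -ee.
by exists K => m; rewrite tS ee ltcR tK // leq_addr.
Qed.

Lemma pythagoras (x : nat -> G) K : (forall m n, m <> n -> '[x m, x n] = 0) ->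
  `|\sum_(n < K) x n| ^+ 2 = \sum_(n < K) `|x n| ^+ 2.
Proof.
move=> xo; elim: K => [|K IH]; first by rewrite !big_ord0 normr0 expr0n.
have o : '[\sum_(n < K) x n, x K] = 0.
  rewrite (big_morph (fun v => '[v, x K]) (fun u v => innerDl u v (x K)) (inner0l _)).
  by rewrite big1 // => n _; apply: xo => nK; have := ltn_ord n; rewrite nK ltnn.
rewrite !big_ord_recr /= -IH !inner_normE innerDl !innerDr o.
by rewrite (innerC (x K)) o conjC0 addr0 add0r.
Qed.

Lemma orthogonal_series (x : nat -> G) (B : C) :
  (forall m n, m <> n -> '[x m, x n] = 0) ->
  (forall K, \sum_(n < K) `|x n| ^+ 2 <= B) ->
  exists l, converges (fun K => \sum_(n < K) x n) l.
Proof.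
move=> xo xB; apply: hilbert_complete => e e0.
have e2 : 0 < (e / 2) ^+ 2 by rewrite exprn_gt0 // divr_gt0.
have [|K xK] := @bounded_sum_cauchy (fun n => `|x n| ^+ 2) B _ xB _ e2;
  first by move=> n; rewrite exprn_ge0.
have tail m : (K <= m)%N -> `|\sum_(n < m) x n - \sum_(n < K) x n| < e / 2.
  move=> /subnKC <-; rewrite big_split_ord /= addrAC subrr add0r.
  rewrite -(@ltr_pXn2r _ 2) ?nnegrE ?divr_ge0 ?(ltW e0) //.
  by rewrite (@pythagoras (fun n => x (K + n)%N)) // => i j ij; apply: xo => /addnI.
exists K => m n Km Kn; rewrite -[X in _ - X](subrK (\sum_(n < K) x n)) opprD addrA.
rewrite addrAC (splitr e) (le_lt_trans (ler_normB _ _)) // ltrD // ?tail //.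
Qed.

(** Orthogonality of the ranges makes the series converge at every vector; orthogonality of the
    ranges of the adjoints does the same for the adjoint series, which becomes the adjoint of the
    sum. *)
Lemma strong_sum (Q : nat -> bop G) (B : C) : 0 <= B ->
  (forall m n x y, m <> n -> '[Q m x, Q n y] = 0) ->
  (forall m n x y, m <> n -> '[star (Q m) x, star (Q n) y] = 0) ->
  (forall K x, \sum_(n < K) `|Q n x| ^+ 2 <= B * `|x| ^+ 2) ->
  (forall K x, \sum_(n < K) `|star (Q n) x| ^+ 2 <= B * `|x| ^+ 2) ->
  exists S : bop G,
    [/\ forall x, converges (fun K => \sum_(n < K) Q n x) (S x),
        forall x, converges (fun K => \sum_(n < K) star (Q n) x) (star S x) &
        forall x, `|S x| ^+ 2 <= B * `|x| ^+ 2].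
Proof.
move=> B0 o o' b b'.
have /choice[f Qf] x := orthogonal_series (fun m n => o m n x x) (b^~ x).
have /choice[g Qg] x := orthogonal_series (fun m n => o' m n x x) (b'^~ x).
have flin : linear f.
  move=> a x y; apply: (converges_uniq (Qf _)).
  have := converges_lin a (Qf x) (Qf y); congr converges; apply/funext => K.
  by rewrite scaler_sumr -big_split; apply: eq_bigr => n _; rewrite /= bop_lin.
have fadj x y : '[f x, y] = '[x, g y].
  apply: (converges_inner (Qf x) (Qg y)) => K.
  rewrite (big_morph (fun v => '[v, y]) (fun u v => innerDl u v y) (inner0l _)).
  rewrite (big_morph (fun v => '[x, v]) (fun u v => innerDr x u v) (inner0r _)).
  by apply: eq_bigr => n _; rewrite bop_adjP.
have fle x : `|f x| ^+ 2 <= B * `|x| ^+ 2.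
  have sB : 0 <= sqrtC B by rewrite sqrtC_ge0.
  rewrite -[B]sqrtCK -exprMn ler_pXn2r ?nnegrE ?mulr_ge0 //.
  apply: (converges_ler_norm (Qf x)); exists 0%N => K _.
  rewrite -(@ler_pXn2r _ 2) ?nnegrE ?mulr_ge0 // exprMn sqrtCK.
  by rewrite (@pythagoras (fun n => Q n x)) ?b // => m n; exact: o.
have fbd : exists M : C, forall x, `|f x| <= M * `|x|.
  have sB : 0 <= sqrtC B by rewrite sqrtC_ge0.
  exists (sqrtC B) => x; rewrite -(@ler_pXn2r _ 2) ?nnegrE ?mulr_ge0 //.
  by rewrite exprMn sqrtCK fle.
by exists (Bop flin fbd fadj); split.
Qed.

End StrongSum.

Section Frobenius.
Variable C : numClosedFieldType.

Definition fro m n (X Y : 'M[C]_(m, n)) : C := \tr (X *m adjmx Y).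

Lemma froE m n (X Y : 'M[C]_(m, n)) : fro X Y = \sum_i \sum_j X i j * (Y i j)^*.
Proof.
by apply: eq_bigr => i _; rewrite mxE; apply: eq_bigr => j _; rewrite adjmxE.
Qed.

Lemma fro_ge0 m n (X : 'M[C]_(m, n)) : 0 <= fro X X.
Proof.
by rewrite froE; do 2!apply: sumr_ge0 => ? _; rewrite -normCK exprn_ge0.
Qed.

Lemma fro_mull m n p (A : 'M[C]_(p, m)) (X : 'M[C]_(m, n)) Y :
  fro (A *m X) Y = fro X (adjmx A *m Y).
Proof. by rewrite /fro adjmxM adjmxK -mulmxA mxtrace_mulC mulmxA. Qed.

Lemma fro_tr m n (X Y : 'M[C]_(m, n)) : fro X^T Y^T = fro X Y.
Proof.
rewrite !froE exchange_big /=; apply: eq_bigr => i _; apply: eq_bigr => j _.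
by rewrite !mxE.
Qed.

Lemma fro_mulr m n p (A : 'M[C]_(p, n)) (X : 'M[C]_(m, n)) Y :
  fro (X *m A^T) Y = fro X (Y *m (adjmx A)^T).
Proof. by rewrite -fro_tr trmx_mul trmxK fro_mull -fro_tr trmx_mul !trmxK. Qed.

Lemma froZl m n a (X Y : 'M[C]_(m, n)) : fro (a *: X) Y = a * fro X Y.
Proof. by rewrite /fro -scalemxAl mxtraceZ. Qed.

Lemma froC m n (X Y : 'M[C]_(m, n)) : fro X Y = (fro Y X)^*.
Proof.
rewrite !froE rmorph_sum; apply: eq_bigr => i _; rewrite rmorph_sum.
by apply: eq_bigr => j _; rewrite rmorphM /= conjCK mulrC.
Qed.

Lemma froZr m n a (X Y : 'M[C]_(m, n)) : fro X (a *: Y) = a^* * fro X Y.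
Proof. by rewrite froC froZl rmorphM /= -froC. Qed.

Lemma froDl m n (X Y Z : 'M[C]_(m, n)) : fro (X + Y) Z = fro X Z + fro Y Z.
Proof. by rewrite /fro mulmxDl mxtraceD. Qed.

Lemma fro_inj m n (X Y : 'M[C]_(m, n)) : (forall Z, fro X Z = fro Y Z) -> X = Y.
Proof.
move=> XY; apply/matrixP => i j; have := XY (delta_mx i j); rewrite !froE.
have h Z : \sum_k \sum_l Z k l * ((delta_mx i j : 'M[C]_(m, n)) k l)^* = Z i j.
  rewrite (bigD1 i) //= (bigD1 j) //= !big1 ?addr0.
  - by rewrite mxE !eqxx conjC1 mulr1.
  - by move=> k ki; apply: big1 => l _; rewrite mxE (negbTE ki) conjC0 mulr0.
  - by move=> l lj; rewrite mxE (negbTE lj) andbF conjC0 mulr0.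
by rewrite !h.
Qed.

Lemma froDr m n (X Y Z : 'M[C]_(m, n)) : fro X (Y + Z) = fro X Y + fro X Z.
Proof. by rewrite froC froDl rmorphD /= -!froC. Qed.

Lemma froBr m n (X Y Z : 'M[C]_(m, n)) : fro X (Y - Z) = fro X Y - fro X Z.
Proof. by rewrite froDr -scaleN1r froZr rmorphN /= conjC1 mulN1r. Qed.

Variables (N : nat) (F : 'M[C]_N) (c : nat -> C) (L : ladder F c).
Hypothesis c_gt0 : forall n, 0 < c n.+1.

(** lup* lup is 1 at level 0, and above it 1 minus the positive operator c tw tw*. *)
Lemma lup_contract n j p (X : 'M[C]_(ldim L n, p)) :
  fro (lup L n j *m X) (lup L n j *m X) <= fro X X.
Proof.
rewrite fro_mull mulmxA; case: n X => [|n] X; first by rewrite lup0 eqxx mul1mx.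
rewrite lupS eqxx mulmxBl mul1mx froBr gerBl -scalemxAl froZr.
rewrite -mulmxA.
have -> Z : fro X (ltw L n j *m Z) = fro (adjmx (ltw L n j) *m X) Z.
  by rewrite fro_mull adjmxK.
by rewrite mulr_ge0 ?conjC_ge0 ?(ltW (c_gt0 n)) ?fro_ge0.
Qed.

(** The left side is one of the nonnegative terms into which [lup_sum] splits fro Y Y. *)
Lemma ldn_contract n j p (Y : 'M[C]_(ldim L n.+1, p)) :
  fro (adjmx (lup L n j) *m Y) (adjmx (lup L n j) *m Y) <= fro Y Y.
Proof.
have E k : fro (adjmx (lup L n k) *m Y) (adjmx (lup L n k) *m Y) =
    fro Y ((lup L n k *m adjmx (lup L n k)) *m Y).
  by rewrite fro_mull adjmxK mulmxA.
rewrite -[X in _ <= fro _ X]mul1mx -(lup_sum L n) mulmx_suml.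
rewrite (big_morph (fro Y) (froDr Y) (_ : fro Y 0 = 0)); last first.
  by rewrite -(scale0r 0) froZr conjC0 mul0r.
under eq_bigr do rewrite -E.
by rewrite (bigD1 j) //= lerDl sumr_ge0 // => k _; exact: fro_ge0.
Qed.

End Frobenius.

Section Blocks.
Variables (R : realType) (G : nzHilbertType R[i]) (e : nat -> G).
Local Notation C := R[i].
Hypothesis e_on : forall m n, '[e m, e n] = (m == n)%:R.
Variables p q : nat -> nat.

(** Any injection of the triples (n, a, b) into nat places the matrix blocks along the orthonormal
    sequence e; whatever part of G is not reached is handled by [perp]. *)
Definition bidx n (a : 'I_(p n)) (b : 'I_(q n)) : nat :=
  pickle (Tagged (fun n => ('I_(p n) * 'I_(q n))%type) (a, b)).

(* The isometric embeddings, with orthogonal ranges, of the blocks. *)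
Definition blk n (X : 'M[C]_(p n, q n)) : G :=
  \sum_a \sum_b X a b *: e (bidx a b).
Definition coblk n (x : G) : 'M[C]_(p n, q n) :=
  \matrix_(a, b) '[x, e (bidx a b)].

Lemma blk_adj n X x : '[blk X, x] = fro X (coblk n x).
Proof.
have D := fun u v => innerDl u v x.
rewrite /blk froE (big_morph (fun v => '[v, x]) D (inner0l x)); apply: eq_bigr => a _.
rewrite (big_morph (fun v => '[v, x]) D (inner0l x)); apply: eq_bigr => b _.
by rewrite innerZl mxE -innerC.
Qed.

Lemma coblk_blk n (X : 'M[C]_(p n, q n)) : coblk n (blk X) = X.
Proof.
apply/matrixP => a b; rewrite mxE blk_adj froE (bigD1 a) //= (bigD1 b) //=.
have E a' b' : (coblk n (e (bidx a b)) a' b')^* = ((a', b') == (a, b))%:R.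
  rewrite mxE -innerC e_on (inj_eq (pcan_inj pickleK)) -tag_eqE /tag_eq /= eqxx /= tagged_asE.
  by [].
rewrite !E eqxx mulr1 !big1 ?addr0 // => [a' a'a|b' b'b].
  by apply: big1 => b' _; rewrite E xpair_eqE (negbTE a'a) mulr0.
by rewrite E xpair_eqE (negbTE b'b) andbF mulr0.
Qed.

Lemma coblk_blk0 m n (X : 'M[C]_(p n, q n)) : m <> n -> coblk m (blk X) = 0.
Proof.
move=> mn; apply/matrixP => a b; rewrite !mxE blk_adj froE big1 // => a' _.
rewrite big1 // => b' _; rewrite mxE -innerC e_on (inj_eq (pcan_inj pickleK)).
by case: eqP => [/(congr1 tag)/= nm|_]; [case: mn|rewrite mulr0].
Qed.

Lemma blkD n : {morph @blk n : X Y / X + Y}.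
Proof.
move=> X Y; rewrite /blk -big_split; apply: eq_bigr => a _; rewrite -big_split.
by apply: eq_bigr => b _; rewrite mxE scalerDl.
Qed.

Lemma blkZ n c (X : 'M[C]_(p n, q n)) : blk (c *: X) = c *: blk X.
Proof.
rewrite /blk scaler_sumr; apply: eq_bigr => a _; rewrite scaler_sumr.
by apply: eq_bigr => b _; rewrite mxE scalerA.
Qed.

Lemma blk0 n : blk (0 : 'M[C]_(p n, q n)) = 0.
Proof. by rewrite -(scale0r 0) blkZ scale0r. Qed.

Lemma coblkZD n c x y : coblk n (c *: x + y) = c *: coblk n x + coblk n y.
Proof. by apply/matrixP => a b; rewrite !mxE innerDl innerZl. Qed.

Lemma blk_norm n (X : 'M[C]_(p n, q n)) : `|blk X| ^+ 2 = fro X X.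
Proof. by rewrite inner_normE blk_adj coblk_blk. Qed.

Lemma blk_ortho m n (X : 'M[C]_(p m, q m)) (Y : 'M[C]_(p n, q n)) : m <> n ->
  '[blk X, blk Y] = 0.
Proof. by move=> mn; rewrite blk_adj coblk_blk0 // froC /fro mul0mx mxtrace0 conjC0. Qed.

Lemma blk_adjr n x Y : '[x, blk Y] = fro (coblk n x) Y.
Proof. by rewrite innerC blk_adj -froC. Qed.

Lemma bessel (s : nat -> nat) K x : injective s ->
  \sum_(n < K) fro (coblk (s n) x) (coblk (s n) x) <= `|x| ^+ 2.
Proof.
move=> sI; pose y := \sum_(n < K) blk (coblk (s n) x).
have yx : '[y, x] = \sum_(n < K) fro (coblk (s n) x) (coblk (s n) x).
  rewrite (big_morph (fun v => '[v, x]) (fun u v => innerDl u v x) (inner0l x)).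
  by apply: eq_bigr => n _; rewrite blk_adj.
have yy : '[y, y] = '[y, x].
  rewrite -inner_normE /y (@pythagoras _ _ (fun n => blk (coblk (s n) x))) => [|m n mn].
    by rewrite -/y yx; apply: eq_bigr => n _; rewrite blk_norm.
  by apply: blk_ortho => /sI.
have xy : '[x, y] = '[y, x].
  by rewrite innerC -yy -inner_normE; apply/CrealP; rewrite ger0_real // exprn_ge0.
have : 0 <= `|x - y| ^+ 2 by rewrite exprn_ge0.
by rewrite !inner_normE innerBl !innerBr xy yy subrr subr0 -yx subr_ge0.
Qed.

Definition perp x := forall n, coblk n x = 0.

(** Block n goes to block s n, so the injectivity of s gives both orthogonality conditions of
    [strong_sum]. Linearity of [A n] follows from its having an adjoint. *)
Lemma block_operator (s : nat -> nat) (B : C)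
  (A : forall n, 'M[C]_(p n, q n) -> 'M[C]_(p (s n), q (s n)))
  (A' : forall n, 'M[C]_(p (s n), q (s n)) -> 'M[C]_(p n, q n)) :
  injective s -> 0 <= B ->
  (forall n X Y, fro (A n X) Y = fro X (A' n Y)) ->
  (forall n X, fro (A n X) (A n X) <= B * fro X X) ->
  (forall n Y, fro (A' n Y) (A' n Y) <= B * fro Y Y) ->
  exists S : bop G,
    [/\ forall n X, S (blk X) = blk (A n X),
        forall n Y, star S (blk Y) = blk (A' n Y),
        forall m (Y : 'M[C]_(p m, q m)), (forall n, s n <> m) -> star S (blk Y) = 0,
        forall x, perp x -> S x = 0 /\ star S x = 0 &
        forall x, `|S x| ^+ 2 <= B * `|x| ^+ 2].
Proof.
move=> sI B0 AA AB AB'.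
have Alin n c X Y : A n (c *: X + Y) = c *: A n X + A n Y.
  by apply: fro_inj => Z; rewrite AA froDl froZl -!AA -froZl -froDl.
pose Qf n x := blk (A n (coblk n x)); pose Qg n y := blk (A' n (coblk (s n) y)).
have Qlin n : linear (Qf n).
  by move=> c x y; rewrite /Qf coblkZD Alin blkD blkZ.
have Qadj n x y : '[Qf n x, y] = '[x, Qg n y].
  by rewrite /Qf /Qg blk_adj AA blk_adjr.
have Qle n x : `|Qf n x| ^+ 2 <= B * fro (coblk n x) (coblk n x).
  by rewrite blk_norm.
have Qle' n y : `|Qg n y| ^+ 2 <= B * fro (coblk (s n) y) (coblk (s n) y).
  by rewrite blk_norm.
have idI : injective (@id nat) by [].
have fro_le n x : fro (coblk n x) (coblk n x) <= `|x| ^+ 2.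
  have := bessel n.+1 x idI; apply: le_trans; rewrite big_ord_recr /= lerDr.
  by apply: sumr_ge0 => i _; exact: fro_ge0.
have Qbd n : exists M : C, forall x, `|Qf n x| <= M * `|x|.
  exists (sqrtC B) => x; rewrite -(@ler_pXn2r _ 2) ?nnegrE ?mulr_ge0 ?sqrtC_ge0 //.
  by rewrite exprMn sqrtCK (le_trans (Qle n x)) // ler_wpM2l.
pose Q n := Bop (Qlin n) (Qbd n) (Qadj n).
have [|m n x y mn|K x|K x|S [SQ SQ' Sle]] := @strong_sum _ _ Q B B0.
- by move=> m n x y mn; apply: blk_ortho => /sI.
- exact: blk_ortho.
- rewrite (le_trans _ (ler_wpM2l B0 (bessel K x idI))) // mulr_sumr.
  by apply: ler_sum => n _; exact: Qle.
- rewrite (le_trans _ (ler_wpM2l B0 (bessel K x sI))) // mulr_sumr.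
  by apply: ler_sum => n _; exact: Qle'.
have one (T : nat -> G) (l : G) k : converges (fun K => \sum_(n < K) T n) l ->
    (forall n, n <> k -> T n = 0) -> l = T k.
  move=> Tl T0; apply: (converges_uniq Tl) => d d0; exists k.+1 => K kK.
  rewrite (bigD1 (Ordinal kK)) //= big1 ?addr0 ?subrr ?normr0 // => i ik.
  by apply: T0 => ik'; case/eqP: ik; exact: val_inj.
have A0 n : A n 0 = 0 by have := Alin n (- 1) 0 0; rewrite !scaler0 addr0 scaleN1r addNr.
have A'0 n : A' n 0 = 0.
  by apply: fro_inj => Z; rewrite froC -AA -froC /fro !mul0mx !mxtrace0.
exists S; split=> //.
- move=> n X; rewrite (one (Qf^~ (blk X)) _ n (SQ (blk X))) /= /Qf ?coblk_blk // => m mn.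
  by rewrite coblk_blk0 // A0 blk0.
- move=> n Y; rewrite (one (Qg^~ (blk Y)) _ n (SQ' (blk Y))) /= /Qg ?coblk_blk // => m mn.
  by rewrite coblk_blk0 ?A'0 ?blk0 // => /sI.
- move=> m Y sm; rewrite (one (Qg^~ (blk Y)) _ 0%N (SQ' (blk Y))) /= /Qg => [|n _].
    by rewrite coblk_blk0 ?A'0 ?blk0.
  by rewrite coblk_blk0 ?A'0 ?blk0.
- move=> x x0; split; last first.
    by rewrite (one (Qg^~ x) _ 0%N (SQ' x)) /= /Qg => [|n _]; rewrite x0 A'0 blk0.
  by rewrite (one (Qf^~ x) _ 0%N (SQ x)) /= /Qf => [|n _]; rewrite x0 A0 blk0.
Qed.

(** P is the block operator of the identity maps. For the extensionality clause, the difference of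
    the adjoints of S and T at any y is orthogonal to all blocks, so P kills it, and S and T agree
    on the range of P. *)
Lemma block_projection : exists P : bop G,
  [/\ forall n (X : 'M[C]_(p n, q n)), P (blk X) = blk X,
      forall x, perp x -> P x = 0,
      star P = P,
      forall x, perp (x - P x) &
      forall S T : bop G, (forall n (X : 'M[C]_(p n, q n)), S (blk X) = T (blk X)) ->
        (forall x, perp x -> S x = T x) -> S = T].
Proof.
have [|||||P [Pb P'b _ Pp Ple]] := @block_operator id 1 (fun n X => X) (fun n X => X) => //.
- by move=> n X; rewrite mul1r.
- by move=> n X; rewrite mul1r.
have perpP x : (forall n (X : 'M[C]_(p n, q n)), '[x, blk X] = 0) -> perp x.
  by move=> h n; apply: fro_inj => X; rewrite -blk_adjr h /fro mul0mx mxtrace0.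
have Pc x : perp (x - P x).
  by apply: perpP => n X; rewrite innerBl (bop_adjP P) -[bop_adj P _]/(star P _) P'b subrr.
have ext (S T : bop G) : (forall n (X : 'M[C]_(p n, q n)), S (blk X) = T (blk X)) ->
    (forall x, perp x -> S x = T x) -> S = T.
  move=> STb STp; apply: bop_eq => x.
  have e1 : S (P x) = T (P x).
    apply: inner_inj => y; rewrite innerC [RHS]innerC; congr (_^*); apply/eqP.
    rewrite -subr_eq0 !(bop_adjP _ (P x)) -innerBr bop_adjP -[bop_adj P _]/(star P _).
    rewrite (proj2 (Pp _ _)) ?inner0r //; apply: perpP => n X.
    by rewrite innerBl !bop_star_adjP STb subrr.
  by rewrite -[x](subrK (P x)) bopD [RHS]bopD e1 (STp _ (Pc x)).
exists P; split=> // [x /Pp[]//|].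
by apply: ext => [n X|x xp]; [rewrite P'b Pb|case: (Pp x xp) => -> ->].
Qed.

End Blocks.

(** * The model of the free orthogonal quantum group *)

Section StarAlgebra.
Variables (C : numClosedFieldType) (A : starAlgType C).

Lemma star0 : star (0 : A) = 0.
Proof. by rewrite -[0 in LHS](scale0r (0 : A)) starZ conjC0 scale0r. Qed.

Lemma star_sum (I : Type) (r : seq I) (T : I -> A) :
  star (\sum_(a <- r) T a) = \sum_(a <- r) star (T a).
Proof. exact: (big_morph _ (@starD _ A) star0). Qed.

Lemma star_one : star (1 : A) = 1.
Proof. by rewrite -[RHS]starK -[in RHS](mulr1 (star 1)) starM starK mulr1. Qed.

Lemma star_real_scale (a : bool) (x : A) : star (a%:R *: x) = a%:R *: star x.
Proof. by rewrite starZ conjC_nat. Qed.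

End StarAlgebra.

Section Model.
Variables (R : realType) (G : nzHilbertType R[i]) (e : nat -> G).
Local Notation C := R[i].
Hypothesis e_on : forall m n, '[e m, e n] = (m == n)%:R.
Variables (N : nat) (F : 'M[C]_N) (c : nat -> C) (B : C).
Hypotheses (FF : F *m map_mx Num.conj F = - 1%:M).
Hypothesis c_gt0 : forall n, 0 < c n.+1.
Hypothesis c_le : forall n, c n.+1 <= B.
Variables (K : ladder F^T c) (H : ladder F c).

Local Notation p := (ldim K).
Local Notation q := (ldim H).
Local Notation blk := (@blk R G e p q _).
Local Notation k n := (sqrtC (c n.+1)).

Lemma k_real n : (k n)^* = k n.
Proof. by apply/CrealP; rewrite ger0_real // sqrtC_ge0 ltW. Qed.

Lemma k_sqr n : k n * k n = c n.+1.
Proof. by rewrite -expr2 sqrtCK. Qed.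

Definition raises (D : bop G) (f : forall n, 'M[C]_(p n.+1, p n))
    (g : forall n, 'M[C]_(q n.+1, q n)) : Prop :=
  [/\ forall n X, D (blk X) = blk (k n *: (f n *m X *m (g n)^T)),
      forall n (Y : 'M[C]_(p n.+1, q n.+1)), star D (blk Y) =
        blk (k n *: (adjmx (f n) *m Y *m (adjmx (g n))^T)),
      forall Y : 'M[C]_(p 0, q 0), star D (blk Y) = 0 &
      forall x, perp e p q x -> D x = 0 /\ star D x = 0].

Lemma raising_ex (i j : 'I_N) : exists D : bop G,
  raises D (fun n => lup K n i) (fun n => lup H n j) /\
  forall x, `|D x| ^+ 2 <= B * `|x| ^+ 2.
Proof.
have B0 : 0 <= B by rewrite (le_trans _ (c_le 0)) // ltW.
have succI : injective S by move=> m n [].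
have [|||D [h1 h2 h3 h4 h5]] := @block_operator R G e e_on p q S B
  (fun n X => k n *: (lup K n i *m X *m (lup H n j)^T))
  (fun n Y => k n *: (adjmx (lup K n i) *m Y *m (adjmx (lup H n j))^T)) succI B0.
- move=> n X Y; rewrite froZl froZr k_real; congr (_ * _).
  by rewrite fro_mulr fro_mull mulmxA.
- move=> n X; rewrite froZl froZr k_real mulrA k_sqr.
  rewrite (le_trans (ler_wpM2r _ (c_le n))) ?fro_ge0 // ler_wpM2l //.
  rewrite -fro_tr trmx_mul trmxK (le_trans (lup_contract c_gt0 _ _)) //.
  by rewrite fro_tr lup_contract.
- move=> n Y; rewrite froZl froZr k_real mulrA k_sqr.
  rewrite (le_trans (ler_wpM2r _ (c_le n))) ?fro_ge0 // ler_wpM2l //.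
  rewrite -fro_tr trmx_mul trmxK (le_trans (ldn_contract _ _)) //.
  by rewrite fro_tr ldn_contract.
exists D; split=> //; split=> // Y.
by apply: h3.
Qed.

Definition raiser i j : bop G := projT1 (cid (raising_ex i j)).

Lemma raiser_raises i j : raises (raiser i j) (fun n => lup K n i) (fun n => lup H n j).
Proof. exact: (proj1 (projT2 (cid (raising_ex i j)))). Qed.

Lemma raiser_bound i j x : `|raiser i j x| ^+ 2 <= B * `|x| ^+ 2.
Proof. exact: (proj2 (projT2 (cid (raising_ex i j)))). Qed.

Definition bproj : bop G := projT1 (cid (block_projection e_on p q)).

Lemma bop_sumE (I : Type) (r : seq I) (T : I -> bop G) x :
  (\sum_(a <- r) T a) x = \sum_(a <- r) T a x.
Proof. by elim: r => [|a r IH]; rewrite ?big_nil // !big_cons /= IH. Qed.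

Lemma bop_mulE (S T : bop G) x : (S * T) x = S (T x). Proof. by []. Qed.
Lemma bop_addE (S T : bop G) x : (S + T) x = S x + T x. Proof. by []. Qed.

Lemma raises_suml (a : 'I_N -> C) (T : 'I_N -> bop G) f g :
  (forall m, raises (T m) (f m) g) ->
  raises (\sum_m a m *: T m) (fun n => \sum_m a m *: f m n) g.
Proof.
move=> Tr; split.
- move=> n X; rewrite bop_sumE !mulmx_suml scaler_sumr.
  rewrite (big_morph _ (@blkD _ _ e p q _) (@blk0 _ _ e p q _)).
  apply: eq_bigr => m _; case: (Tr m) => h _ _ _ /=.
  by rewrite h -!scalemxAl -blkZ !scalerA mulrC.
- move=> n Y; rewrite star_sum bop_sumE adjmx_sum !mulmx_suml scaler_sumr.
  rewrite (big_morph _ (@blkD _ _ e p q _) (@blk0 _ _ e p q _)).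
  apply: eq_bigr => m _; case: (Tr m) => _ h _ _ /=.
  by rewrite -[bop_adj _ _]/(star (T m) _) h adjmxZ -!scalemxAl -blkZ !scalerA mulrC.
- move=> Y; rewrite star_sum bop_sumE big1 // => m _; case: (Tr m) => _ _ h _ /=.
  by rewrite -[bop_adj _ _]/(star (T m) _) h scaler0.
- move=> x xp; split; rewrite ?star_sum bop_sumE big1 // => m _ /=.
    by case: (Tr m) => _ _ _ /(_ x xp)[-> _]; rewrite scaler0.
  rewrite -[bop_adj _ _]/(star (T m) _).
  by case: (Tr m) => _ _ _ /(_ x xp)[_ ->]; rewrite scaler0.
Qed.

Lemma raises_sumr (a : 'I_N -> C) (T : 'I_N -> bop G) f g :
  (forall m, raises (T m) f (g m)) ->
  raises (\sum_m a m *: T m) f (fun n => \sum_m a m *: g m n).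
Proof.
move=> Tr; split.
- move=> n X; rewrite bop_sumE raddf_sum mulmx_sumr scaler_sumr.
  rewrite (big_morph _ (@blkD _ _ e p q _) (@blk0 _ _ e p q _)).
  apply: eq_bigr => m _; case: (Tr m) => h _ _ _ /=.
  by rewrite h linearZ -!scalemxAr -blkZ !scalerA mulrC.
- move=> n Y; rewrite star_sum bop_sumE adjmx_sum raddf_sum mulmx_sumr scaler_sumr.
  rewrite (big_morph _ (@blkD _ _ e p q _) (@blk0 _ _ e p q _)).
  apply: eq_bigr => m _; case: (Tr m) => _ h _ _ /=.
  by rewrite -[bop_adj _ _]/(star (T m) _) h adjmxZ linearZ -!scalemxAr -blkZ !scalerA mulrC.
- move=> Y; rewrite star_sum bop_sumE big1 // => m _; case: (Tr m) => _ _ h _ /=.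
  by rewrite -[bop_adj _ _]/(star (T m) _) h scaler0.
- move=> x xp; split; rewrite ?star_sum bop_sumE big1 // => m _ /=.
    by case: (Tr m) => _ _ _ /(_ x xp)[-> _]; rewrite scaler0.
  rewrite -[bop_adj _ _]/(star (T m) _).
  by case: (Tr m) => _ _ _ /(_ x xp)[_ ->]; rewrite scaler0.
Qed.

(** Write D for the matrix of the raisers and conj for the entrywise adjoint. On the blocks U = F D
    + conj(D F), so U F and F conj(U) are both F D F - conj(D), because F conj(F) = conj(F) F = -1.
    This is the computation behind [model_F]. *)
Definition Dl i j : bop G := \sum_m F i m *: raiser m j.
Definition Dr i j : bop G := \sum_m F m j *: raiser i m.

Lemma Dl_raises i j : raises (Dl i j) (fun n => ltw K n i) (fun n => lup H n j).
Proof.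
have -> : (fun n => ltw K n i) = (fun n => \sum_m F i m *: lup K n m).
  by apply: functional_extensionality_dep => n; apply: eq_bigr => m _; rewrite mxE.
by apply: raises_suml => m; exact: raiser_raises.
Qed.

Lemma Dr_raises i j : raises (Dr i j) (fun n => lup K n i) (fun n => ltw H n j).
Proof. exact: (raises_sumr (F^~ j) (fun m => raiser_raises i m)). Qed.

Definition bprojC : bop G := 1 - bproj.

(** The blocks need not fill G. On their complement the scalar solution u_ij = delta_ij of the
    relations is added, so that U is unitary on all of G. *)
Definition model i j : bop G := Dl i j + star (Dr i j) + (i == j)%:R *: bprojC.

Lemma bprojE n (X : 'M[C]_(p n, q n)) : bproj (blk X) = blk X.
Proof. by case: (projT2 (cid (block_projection e_on p q))) => h _ _ _ _; exact: h. Qed.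

Lemma bproj_perp x : perp e p q x -> bproj x = 0.
Proof. by case: (projT2 (cid (block_projection e_on p q))) => _ h _ _ _; exact: h. Qed.

Lemma star_bproj : star bproj = bproj.
Proof. by case: (projT2 (cid (block_projection e_on p q))). Qed.

Lemma block_ext (S T : bop G) :
  (forall n (X : 'M[C]_(p n, q n)), S (blk X) = T (blk X)) ->
  (forall x, perp e p q x -> S x = T x) -> S = T.
Proof. by case: (projT2 (cid (block_projection e_on p q))) => _ _ _ _ h; exact: h. Qed.

Lemma raises_bproj (T : bop G) f g : raises T f g ->
  [/\ T * bproj = T, bproj * T = T, star T * bproj = star T & bproj * star T = star T].
Proof.
move=> [h1 h2 h3 h4].
have TP : T * bproj = T.
  apply: block_ext => [n X|x xp]; rewrite bop_mulE; first by rewrite bprojE.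
  by case: (h4 x xp) => ->; rewrite bproj_perp // bop0E.
have TP' : star T * bproj = star T.
  apply: block_ext => [n X|x xp]; rewrite bop_mulE; first by rewrite bprojE.
  by case: (h4 x xp) => _ ->; rewrite bproj_perp // bop0E.
split=> //.
  by rewrite -[LHS]starK starM star_bproj TP' starK.
by rewrite -[LHS]starK starM star_bproj starK TP.
Qed.

Lemma raises_sum_up_dn (T T' : 'I_N -> bop G) f g f' g' :
  (forall j, raises (T j) (f j) (g j)) -> (forall j, raises (T' j) (f' j) (g' j)) ->
  forall n (X : 'M[C]_(p n.+1, q n.+1)) , (\sum_j T j * star (T' j)) (blk X) =
    blk (c n.+1 *: \sum_j (f j n *m adjmx (f' j n) *m X *m (g j n *m adjmx (g' j n))^T)).
Proof.
move=> Tr Tr' n X; rewrite bop_sumE scaler_sumr.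
rewrite (big_morph _ (@blkD _ _ e p q _) (@blk0 _ _ e p q _)); apply: eq_bigr => j _.
case: (Tr j) => h _ _ _; case: (Tr' j) => _ h' _ _.
rewrite bop_mulE h' h -scalemxAr -scalemxAl scalerA k_sqr.
by rewrite trmx_mul !mulmxA.
Qed.

Lemma raises_sum_dn_up (T T' : 'I_N -> bop G) f g f' g' :
  (forall j, raises (T j) (f j) (g j)) -> (forall j, raises (T' j) (f' j) (g' j)) ->
  forall n (X : 'M[C]_(p n, q n)), (\sum_j star (T j) * T' j) (blk X) =
    blk (c n.+1 *: \sum_j (adjmx (f j n) *m f' j n *m X *m (adjmx (g j n) *m g' j n)^T)).
Proof.
move=> Tr Tr' n X; rewrite bop_sumE scaler_sumr.
rewrite (big_morph _ (@blkD _ _ e p q _) (@blk0 _ _ e p q _)); apply: eq_bigr => j _.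
case: (Tr j) => _ h _ _; case: (Tr' j) => h' _ _ _.
rewrite bop_mulE h' h -scalemxAr -scalemxAl scalerA k_sqr.
by rewrite trmx_mul !mulmxA.
Qed.

Lemma raises_sum_up_up (T T' : 'I_N -> bop G) f g f' g' :
  (forall j, raises (T j) (f j) (g j)) -> (forall j, raises (T' j) (f' j) (g' j)) ->
  (forall n (X : 'M[C]_(p n, q n)), \sum_j (f j n.+1 *m f' j n *m X *m
    (g j n.+1 *m g' j n)^T) = 0) ->
  \sum_j T j * T' j = 0.
Proof.
move=> Tr Tr' fg; apply: block_ext => [n X|x xp]; rewrite bop_sumE; last first.
  by rewrite big1 // => j _; case: (Tr' j) => _ _ _ /(_ x xp)[/= -> _]; exact: bop0E.
transitivity (blk (k n.+1 *: (k n *: \sum_j (f j n.+1 *m f' j n *m X *m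
    (g j n.+1 *m g' j n)^T)))); last by rewrite fg !scaler0 blk0.
rewrite !scaler_sumr (big_morph _ (@blkD _ _ e p q _) (@blk0 _ _ e p q _)).
apply: eq_bigr => j _; case: (Tr j) => h _ _ _; case: (Tr' j) => h' _ _ _.
by rewrite bop_mulE h' h -scalemxAr -scalemxAl trmx_mul !mulmxA.
Qed.

Lemma Dl_star_Dl0 (T T' : 'I_N -> bop G) f g f' g' :
  (forall j, raises (T j) (f j) (g j)) -> (forall j, raises (T' j) (f' j) (g' j)) ->
  forall X : 'M[C]_(p 0, q 0), (\sum_j T j * star (T' j)) (blk X) = 0.
Proof.
move=> Tr Tr' X; rewrite bop_sumE big1 // => j _; case: (Tr' j) => _ _ h _.
by rewrite bop_mulE h bop0E.
Qed.

(** Raising twice produces sum_j lup_j ltw_j on the column factor, which is 0 by [lup_tw]; in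
    [col_cross] the same happens on the row factor. *)
Lemma row_cross i l : \sum_j Dl i j * Dr l j = 0.
Proof.
apply: (raises_sum_up_up (fun j => Dl_raises i j) (fun j => Dr_raises l j)) => n X.
by rewrite -mulmx_sumr -raddf_sum /= lup_tw trmx0 mulmx0.
Qed.

Lemma col_cross j l : \sum_i Dr i j * Dl i l = 0.
Proof.
apply: (raises_sum_up_up (fun i => Dr_raises i j) (fun i => Dl_raises i l)) => n X.
by rewrite -mulmx_suml -mulmx_suml lup_tw !mul0mx.
Qed.

(** By [lup_sum] on the column factor the first sum acts on the rows as c ltw_i ltw_l*; by [ltw_sum]
    the second acts as lup_i* lup_l. [lupS] says that these add up to delta_il. On level 0 the first
    sum is absent and [lup0] replaces [lupS]. *)
Lemma row_diag i l :
  \sum_j Dl i j * star (Dl l j) + \sum_j star (Dr i j) * Dr l j = (i == l)%:R *: bproj.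
Proof.
apply: block_ext => [n X|x xp]; rewrite bop_addE; last first.
  rewrite !bop_sumE !big1 ?addr0 => [|j _|j _].
  - by rewrite /= bproj_perp ?scaler0.
  - by case: (Dr_raises l j) => _ _ _ /(_ x xp)[h _]; rewrite bop_mulE h bop0E.
  - by case: (Dl_raises l j) => _ _ _ /(_ x xp)[_ h]; rewrite bop_mulE h bop0E.
have -> : ((i == l)%:R *: bproj) (blk X) = blk ((i == l)%:R *: X) by rewrite /= bprojE blkZ.
have := raises_sum_dn_up (fun j => Dr_raises i j) (fun j => Dr_raises l j) X.
move=> ->; rewrite -mulmx_sumr -raddf_sum /= scalemxAr -linearZ /= ltw_sum trmx1 mulmx1.
case: n X => [|n] X.
  rewrite (Dl_star_Dl0 (fun j => Dl_raises i j) (fun j => Dl_raises l j)) add0r.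
  by rewrite lup0 mul_scalar_mx.
rewrite (raises_sum_up_dn (fun j => Dl_raises i j) (fun j => Dl_raises l j)) -blkD.
rewrite -mulmx_sumr -raddf_sum /= lup_sum trmx1 mulmx1 lupS mulmxBl mul_scalar_mx.
by rewrite -scalemxAl addrC subrK.
Qed.

Lemma col_diag j l :
  \sum_i star (Dl i j) * Dl i l + \sum_i Dr i j * star (Dr i l) = (j == l)%:R *: bproj.
Proof.
apply: block_ext => [n X|x xp]; rewrite bop_addE; last first.
  rewrite !bop_sumE !big1 ?addr0 => [|i _|i _].
  - by rewrite /= bproj_perp ?scaler0.
  - by case: (Dr_raises i l) => _ _ _ /(_ x xp)[_ h]; rewrite bop_mulE h bop0E.
  - by case: (Dl_raises i l) => _ _ _ /(_ x xp)[h _]; rewrite bop_mulE h bop0E.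
have -> : ((j == l)%:R *: bproj) (blk X) = blk ((j == l)%:R *: X) by rewrite /= bprojE blkZ.
have := raises_sum_dn_up (fun i => Dl_raises i j) (fun i => Dl_raises i l) X.
move=> ->; rewrite -!mulmx_suml !scalemxAl ltw_sum mul1mx.
case: n X => [|n] X.
  rewrite (Dl_star_Dl0 (fun i => Dr_raises i j) (fun i => Dr_raises i l)) addr0.
  by rewrite lup0 tr_scalar_mx mul_mx_scalar.
rewrite (raises_sum_up_dn (fun i => Dr_raises i j) (fun i => Dr_raises i l)) -blkD.
rewrite -!mulmx_suml lup_sum mul1mx lupS raddfB /= tr_scalar_mx mulmxBr mul_mx_scalar.
by rewrite linearZ /= -scalemxAr subrK.
Qed.

Lemma star_bprojC : star bprojC = bprojC.
Proof. by rewrite /bprojC starD star_one -scaleN1r starZ rmorphN1 star_bproj scaleN1r. Qed.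

Lemma star_model i j : star (model i j) = star (Dl i j) + Dr i j + (i == j)%:R *: bprojC.
Proof. by rewrite /model !starD starK star_real_scale star_bprojC. Qed.

Definition model_mx : 'M[bop G]_N := \matrix_(i, j) model i j.

Lemma delta_suml (V : lmodType C) (i : 'I_N) (f : 'I_N -> V) :
  \sum_j (i == j)%:R *: f j = f i.
Proof.
rewrite (bigD1 i) //= eqxx scale1r big1 ?addr0 // => j ji.
by rewrite eq_sym (negbTE ji) scale0r.
Qed.

Lemma raises_bprojC (T : bop G) f g : raises T f g ->
  [/\ T * bprojC = 0, bprojC * T = 0, star T * bprojC = 0 & bprojC * star T = 0].
Proof.
move=> /raises_bproj[h1 h2 h3 h4]; rewrite /bprojC !mulrBr !mulrBl !mulr1 !mul1r.
by rewrite h1 h2 h3 h4 !subrr.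
Qed.

Lemma bprojC_idem : bprojC * bprojC = bprojC.
Proof.
suff PP : bproj * bproj = bproj by rewrite /bprojC mulrBr !mulrBl !mul1r !mulr1 PP subrr subr0.
apply: block_ext => [n X|x xp]; rewrite bop_mulE ?bprojE //.
by rewrite !(bproj_perp xp) bop0E.
Qed.

Lemma mul_expand (a b a' b' : bop G) (d d' : C) :
  a * bprojC = 0 -> b * bprojC = 0 -> bprojC * a' = 0 -> bprojC * b' = 0 ->
  (a + b + d *: bprojC) * (a' + b' + d' *: bprojC) =
  a * a' + b * b' + (a * b' + b * a' + (d * d') *: bprojC).
Proof.
move=> ap bp pa pb; rewrite !mulrDl !mulrDr -!scalerAl -!scalerAr ap bp pa pb.
rewrite !scaler0 !addr0 !add0r bprojC_idem scalerA.
by rewrite (addrC (b * a')) addrACA -!addrA.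
Qed.

Lemma model_row i l : \sum_j model i j * star (model l j) = (i == l)%:R.
Proof.
transitivity (\sum_j (Dl i j * star (Dl l j) + star (Dr i j) * Dr l j +
    (Dl i j * Dr l j + star (Dl l j * Dr i j) + ((i == j)%:R * (l == j)%:R) *: bprojC))).
  apply: eq_bigr => j _; rewrite star_model mul_expand ?starM //.
  - by case: (raises_bprojC (Dl_raises i j)).
  - by case: (raises_bprojC (Dr_raises i j)).
  - by case: (raises_bprojC (Dl_raises l j)).
  - by case: (raises_bprojC (Dr_raises l j)).
rewrite !big_split /= row_diag row_cross -star_sum row_cross star0 !add0r.
under eq_bigr do rewrite -scalerA; rewrite delta_suml eq_sym -scalerDr /bprojC.
by rewrite addrC subrK scaler_nat.
Qed.

Lemma model_col j l : \sum_i star (model i j) * model i l = (j == l)%:R.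
Proof.
transitivity (\sum_i (star (Dl i j) * Dl i l + Dr i j * star (Dr i l) +
    (star (Dr i l * Dl i j) + Dr i j * Dl i l + ((j == i)%:R * (l == i)%:R) *: bprojC))).
  apply: eq_bigr => i _; rewrite star_model mul_expand ?starM //.
  - by rewrite ![_ == i]eq_sym.
  - by case: (raises_bprojC (Dl_raises i j)).
  - by case: (raises_bprojC (Dr_raises i j)).
  - by case: (raises_bprojC (Dl_raises i l)).
  - by case: (raises_bprojC (Dr_raises i l)).
rewrite !big_split /= col_diag col_cross -star_sum col_cross star0 !add0r.
under eq_bigr do rewrite -scalerA; rewrite delta_suml eq_sym -scalerDr /bprojC.
by rewrite addrC subrK scaler_nat.
Qed.

Lemma conjFF : map_mx Num.conj F *m F = - 1%:M.
Proof.
have /mulmx1C : F *m (- map_mx Num.conj F) = 1%:M by rewrite mulmxN FF opprK.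
by rewrite mulNmx => /(congr1 -%R); rewrite opprK.
Qed.

Lemma model_F i j : \sum_m F m j *: model i m = \sum_m F i m *: star (model m j).
Proof.
under eq_bigr do rewrite /model 2!scalerDr.
under [in RHS]eq_bigr do rewrite star_model 2!scalerDr.
rewrite !big_split /=.
have sum1 (M : 'M[C]_N) (a : 'I_N) (f : 'I_N -> bop G) : M = - 1%:M ->
    \sum_m M a m *: f m = - f a.
  move=> ->; rewrite -[RHS]scaleN1r -[in RHS](delta_suml a f) scaler_sumr.
  apply: eq_bigr => m _; rewrite !mxE scalerA mulN1r; congr (- _ *: _).
have e1 : \sum_m F m j *: star (Dr i m) = - star (raiser i j).
  transitivity (\sum_m (map_mx Num.conj F *m F)^T j m *: star (raiser i m)); last first.
    by apply: sum1; rewrite conjFF raddfN /= trmx1.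
  under eq_bigr do rewrite /Dr star_sum scaler_sumr.
  rewrite exchange_big /=; apply: eq_bigr => m _; rewrite !mxE scaler_suml.
  by apply: eq_bigr => n _; rewrite starZ scalerA !mxE mulrC.
have e2 : \sum_m F i m *: star (Dl m j) = - star (raiser i j).
  transitivity (\sum_m (F *m map_mx Num.conj F) i m *: star (raiser m j)); last first.
    exact: sum1.
  under eq_bigr do rewrite /Dl star_sum scaler_sumr.
  rewrite exchange_big /=; apply: eq_bigr => m _; rewrite !mxE scaler_suml.
  by apply: eq_bigr => n _; rewrite starZ scalerA; congr (_ *: _); rewrite mxE.
have e3 : \sum_m F m j *: Dl i m = \sum_m F i m *: Dr m j.
  transitivity (\sum_m \sum_n (F m j * F i n) *: raiser n m).
    apply: eq_bigr => m _; rewrite /Dl scaler_sumr; apply: eq_bigr => n _.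
    by rewrite scalerA.
  rewrite exchange_big; apply: eq_bigr => m _; rewrite /Dr scaler_sumr.
  by apply: eq_bigr => n _; rewrite scalerA mulrC.
have e4 : \sum_m F m j *: ((i == m)%:R *: bprojC) = \sum_m F i m *: ((m == j)%:R *: bprojC).
  under eq_bigr do rewrite scalerA mulrC -scalerA.
  rewrite delta_suml; under eq_bigr do rewrite eq_sym scalerA mulrC -scalerA.
  by rewrite delta_suml.
have key (s1 s2 s3 t1 t2 t3 d : bop G) :
    s1 = t2 -> s2 = d -> t1 = d -> s3 = t3 -> s1 + s2 + s3 = t1 + t2 + t3.
  by move=> -> -> -> ->; rewrite (addrC t2).
exact: key e3 e1 e2 e4.
Qed.

Lemma model_relations : OF_relations F model_mx.
Proof.
have Fu : F \in unitmx.
  by have /mulmx1_unit[] : F *m (- map_mx Num.conj F) = 1%:M by rewrite mulmxN FF opprK.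
split.
- apply/matrixP => i l; rewrite !mxE -model_row; apply: eq_bigr => j _.
  by rewrite !mxE.
- apply/matrixP => j l; rewrite !mxE -model_col; apply: eq_bigr => i _.
  by rewrite !mxE.
have <- : model_mx *m map_mx (in_alg (bop G)) F =
    map_mx (in_alg (bop G)) F *m map_mx star model_mx.
  apply/matrixP => i j; rewrite !mxE.
  transitivity (\sum_m F m j *: model i m).
    by apply: eq_bigr => m _; rewrite !mxE /= -scalerAr mulr1.
  by rewrite model_F; apply: eq_bigr => m _; rewrite !mxE /= -scalerAl mul1r.
by rewrite -mulmxA -map_mxM mulmxV // map_mx1 mulmx1.
Qed.

Lemma perp_bprojC x : perp e p q (bprojC x).
Proof.
have -> : bprojC x = x - bproj x by rewrite /= scaleN1r.
by case: (projT2 (cid (block_projection e_on p q))) => _ _ _ h _; exact: h.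
Qed.

End Model.

(** * The Haar state as a vector state *)

Section Cosum.
Variables (C : numClosedFieldType) (A B : algType C) (N : nat).
Variables (u : 'M[A]_N) (v : 'M[B]_N).

Definition entries (D : algType C) (w : 'M[D]_N) (s : seq ('I_N * 'I_N)) : D :=
  \prod_(x <- s) w x.1 x.2.

Lemma entries_cons (D : algType C) (w : 'M[D]_N) x s :
  entries w (x :: s) = w x.1 x.2 * entries w s.
Proof. exact: big_cons. Qed.

(* The sum of G a b over the terms a (x) b of the coproduct of the word
   [entries _ s]. *)
Fixpoint cosum (V : zmodType) (s : seq ('I_N * 'I_N)) (G : A -> B -> V) : V :=
  if s is x :: s' then
    \sum_m cosum s' (fun a b => G (u x.1 m * a) (v m x.2 * b))
  else G 1 1.

Lemma cosum_morph (V W : zmodType) (phi : V -> W) s G :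
  phi 0 = 0 -> {morph phi : x y / x + y} ->
  phi (cosum s G) = cosum s (fun a b => phi (G a b)).
Proof.
move=> p0 pD; elim: s G => //= x s IH G.
by rewrite (big_morph _ pD p0); apply: eq_bigr => m _; rewrite IH.
Qed.

Lemma cosumD (V : zmodType) s (G G' : A -> B -> V) :
  cosum s (fun a b => G a b + G' a b) = cosum s G + cosum s G'.
Proof.
elim: s G G' => //= x s IH G G'; rewrite -big_split; apply: eq_bigr => m _.
exact: IH.
Qed.

Lemma eq_cosum (V : zmodType) s (G G' : A -> B -> V) :
  (forall a b, G a b = G' a b) -> cosum s G = cosum s G'.
Proof.
move=> GG; elim: s G G' GG => //= x s IH G G' GG; apply: eq_bigr => m _.
by apply: IH => a b.
Qed.

End Cosum.

(** * Corepresentations on the levels of a ladder *)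

Section Intertwiners.
Variables (C : numClosedFieldType) (N : nat) (F : 'M[C]_N) (c : nat -> C).
Variables (A : starAlgType C) (u : 'M[A]_N) (K : ladder F^T c).
Hypothesis uF : OF_relations F u.
Hypothesis Fu : F \in unitmx.
Hypothesis FF : F *m map_mx Num.conj F = - 1%:M.

Local Notation p := (ldim K).
Local Notation L := (map_mx (in_alg A)).

Lemma lift_scale m n r (M : 'M[C]_(m, n)) (x : A) (Y : 'M[A]_(n, r)) :
  L M *m (x *: Y) = x *: (L M *m Y).
Proof.
apply/matrixP => i j; rewrite !mxE mulr_sumr; apply: eq_bigr => k _.
by rewrite !mxE /= !mulr_algl scalerAr.
Qed.

Lemma mul_alg_scale m n r (M : 'M[A]_(m, n)) a (Y : 'M[A]_(n, r)) :
  M *m (a%:A *: Y) = a%:A *: (M *m Y).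
Proof.
apply/matrixP => i j; rewrite !mxE mulr_sumr; apply: eq_bigr => k _.
by rewrite !mxE !mulr_algl scalerAr.
Qed.

Lemma liftM m n r (M : 'M[C]_(m, n)) (M' : 'M[C]_(n, r)) : L (M *m M') = L M *m L M'.
Proof. exact: map_mxM. Qed.

Lemma lift_sum m n (I : Type) (r : seq I) (M : I -> 'M[C]_(m, n)) :
  L (\sum_(i <- r) M i) = \sum_(i <- r) L (M i).
Proof. exact: raddf_sum. Qed.

Lemma lift_neq n (a b : 'I_N) : a != b -> L ((a == b)%:R%:M : 'M[C]_n) = 0.
Proof. by move=> /negbTE ->; rewrite mulr0n raddf0 map_mx0. Qed.

Lemma liftZ m n a (M : 'M[C]_(m, n)) : L (a *: M) = a%:A *: L M.
Proof. by apply/matrixP => i j; rewrite !mxE /= mulr_algl scalerA. Qed.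

Lemma u_col q m : \sum_a star (u a q) * u a m = (q == m)%:R.
Proof.
case: uF => _ /matrixP/(_ q m) + _; rewrite !mxE => <-; apply: eq_bigr => a _.
by rewrite !mxE.
Qed.

Lemma u_row i a : \sum_m u i m * star (u a m) = (i == a)%:R.
Proof.
case: uF => /matrixP/(_ i a) + _ _; rewrite !mxE => <-; apply: eq_bigr => m _.
by rewrite !mxE.
Qed.

Lemma uF_entry i q : \sum_m F m q *: u i m = \sum_m F i m *: star (u m q).
Proof.
have : u *m L F = L F *m map_mx star u.
  by case: uF => _ _ {1}->; rewrite -!mulmxA -map_mxM mulVmx // map_mx1 mulmx1.
move/matrixP/(_ i q); rewrite !mxE => h.
transitivity (\sum_m u i m * L F m q).
  by apply: eq_bigr => m _; rewrite !mxE /= mulr_algr.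
by rewrite h; apply: eq_bigr => m _; rewrite !mxE /= mulr_algl.
Qed.

Lemma uF_entry_star a r :
  \sum_q (F q r)^* *: star (u a q) = \sum_s (F a s)^* *: u s r.
Proof.
have := congr1 star (uF_entry a r); rewrite !star_sum.
under eq_bigr do rewrite starZ; under [X in _ = X -> _]eq_bigr do rewrite starZ starK.
by [].
Qed.

(** The compression to H_(n+1) of the tensor product of the adjoint matrix of U with [corep n];
    [star (u a b)] is the entry of that adjoint in row b and column a. These matrices describe how
    the coproduct acts on the row factor of the blocks, see [intertwine]. *)
Fixpoint corep n : 'M[A]_(p n) :=
  if n is m.+1 then
    \sum_a \sum_b star (u a b) *: (L (lup K m b) *m corep m *m L (adjmx (lup K m a)))
  else 1%:M.

Lemma corepS n : corep n.+1 = \sum_a \sum_b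
  star (u a b) *: (L (lup K n b) *m corep n *m L (adjmx (lup K n a))).
Proof. by []. Qed.

Lemma ltwE n i : ltw K n i = \sum_m F i m *: lup K n m.
Proof. by apply: eq_bigr => m _; rewrite mxE. Qed.

Definition corep_up n := forall b, corep n.+1 *m L (lup K n b) =
  \sum_q star (u b q) *: (L (lup K n q) *m corep n).

(** The relation U F = F conj(U) trades the coefficients star (u_mq) for u_im, once the maps [lup]
    are twisted by F. *)
Lemma corep_tw n i : corep_up n ->
  corep n.+1 *m L (ltw K n i) = \sum_m u i m *: (L (ltw K n m) *m corep n).
Proof.
move=> h; rewrite ltwE lift_sum mulmx_sumr.
transitivity (\sum_q (\sum_m F i m *: star (u m q)) *: (L (lup K n q) *m corep n)).
  under [in RHS]eq_bigr do rewrite scaler_suml.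
  rewrite exchange_big /=; apply: eq_bigr => m _.
  rewrite liftZ mul_alg_scale h scaler_sumr; apply: eq_bigr => q _.
  by rewrite scalerA mulr_algl.
under eq_bigr do rewrite -uF_entry scaler_suml.
rewrite exchange_big /=; apply: eq_bigr => m _.
rewrite ltwE lift_sum mulmx_suml scaler_sumr; apply: eq_bigr => q _.
by rewrite liftZ -scalemxAl scalerA mulr_algr.
Qed.

(** Expanding [corep n.+1] leaves lup_a* lup_b in the middle. Its delta part is the claim. In the
    correction, [corep_tw] at the level below pulls out u_am, the unitarity of U contracts it with
    star (u_aq), and what remains contains sum_q lup_q ltw_q = 0. *)
Lemma corep_lup n : corep_up n.
Proof.
have top m b : corep m.+1 *m L (lup K m b) = \sum_a \sum_q star (u a q) *:
    (L (lup K m q) *m corep m *m L (adjmx (lup K m a) *m lup K m b)).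
  rewrite corepS mulmx_suml; apply: eq_bigr => a _; rewrite mulmx_suml.
  by apply: eq_bigr => q _; rewrite -scalemxAl liftM !mulmxA.
have delta m b (Y : 'I_N -> 'M[A]_(p m.+1, p m)) :
    \sum_a \sum_q star (u a q) *: (Y q *m L (a == b)%:R%:M) = \sum_q star (u b q) *: Y q.
  rewrite (bigD1 b) //= eqxx [X in _ + X]big1 ?addr0 => [|a ab]; last first.
    by apply: big1 => q _; rewrite lift_neq // mulmx0 scaler0.
  by apply: eq_bigr => q _; rewrite map_mx1 mulmx1.
elim: n => [|n IH] b; rewrite top.
  by under eq_bigr do under eq_bigr do rewrite lup0; rewrite delta.
under eq_bigr do under eq_bigr do rewrite lupS raddfB /= mulmxBr scalerBr.
under eq_bigr do rewrite sumrB; rewrite sumrB delta; apply/eqP.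
rewrite subr_eq addrC -subr_eq subrr eq_sym; apply/eqP.
transitivity ((c n.+1)%:A *: ((\sum_a \sum_q \sum_m (star (u a q) * u a m) *:
    (L (lup K n.+1 q) *m L (ltw K n m) *m corep n)) *m L (adjmx (ltw K n b)))).
  rewrite mulmx_suml scaler_sumr; apply: eq_bigr => a _.
  rewrite [in RHS]mulmx_suml [in RHS]scaler_sumr; apply: eq_bigr => q _.
  rewrite liftZ mul_alg_scale liftM !mulmxA -(mulmxA (L _) (corep _)) corep_tw //.
  have -> M : star (u a q) *: ((c n.+1)%:A *: M) =
      (c n.+1)%:A *: (star (u a q) *: M) :> 'M[A]_(p n.+2, p n.+1).
    by rewrite !scalerA mulr_algl mulr_algr.
  congr (_ *: _); rewrite [in LHS]mulmx_sumr [in LHS]mulmx_suml.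
  rewrite [in LHS]scaler_sumr [in RHS]mulmx_suml; apply: eq_bigr => m _.
  by rewrite lift_scale -!scalemxAl scalerA mulmxA.
suff -> : \sum_a \sum_q \sum_m (star (u a q) * u a m) *:
    (L (lup K n.+1 q) *m L (ltw K n m) *m corep n) = 0 by rewrite mul0mx scaler0.
rewrite exchange_big /=.
transitivity (\sum_q L (lup K n.+1 q) *m L (ltw K n q) *m corep n).
  apply: eq_bigr => q _; rewrite exchange_big (bigD1 q) //= [X in _ + X]big1 ?addr0 => [|m mq].
    by rewrite -scaler_suml u_col eqxx scale1r.
  by rewrite -scaler_suml u_col eq_sym (negbTE mq) scale0r.
rewrite -mulmx_suml; under eq_bigr do rewrite -liftM.
by rewrite -lift_sum lup_tw raddf0 mul0mx.
Qed.

Lemma corep_raise n i :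
  \sum_m u i m *: (L (ltw K n m) *m corep n) = corep n.+1 *m L (ltw K n i).
Proof. by rewrite corep_tw //; exact: corep_lup. Qed.

(** Dual to [corep_lup], with the rows of U in place of its columns; the correction now contains the
    adjoint of sum_a lup_a ltw_a = 0. *)
Lemma corep_lower n i :
  \sum_m u i m *: (L (adjmx (lup K n m)) *m corep n.+1) =
  corep n *m L (adjmx (lup K n i)).
Proof.
have top l m' : \sum_m u l m *: (L (adjmx (lup K m' m)) *m corep m'.+1) =
    \sum_m \sum_a \sum_q (u l m * star (u a q)) *:
    (L (adjmx (lup K m' m) *m lup K m' q) *m corep m' *m L (adjmx (lup K m' a))).
  apply: eq_bigr => m _; rewrite corepS mulmx_sumr scaler_sumr; apply: eq_bigr => a _.
  rewrite mulmx_sumr scaler_sumr; apply: eq_bigr => q _.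
  by rewrite lift_scale scalerA liftM !mulmxA.
have delta l m' (Z : 'I_N -> 'M[A]_(p m', p m'.+1)) :
    \sum_m \sum_a \sum_q (u l m * star (u a q)) *: (L (m == q)%:R%:M *m Z a) = Z l.
  rewrite exchange_big /=; transitivity (\sum_a (l == a)%:R *: Z a).
    apply: eq_bigr => a _; rewrite -u_row scaler_suml; apply: eq_bigr => m _.
    rewrite (bigD1 m) //= eqxx map_mx1 mul1mx big1 ?addr0 // => q qm.
    by rewrite eq_sym lift_neq // mul0mx scaler0.
  rewrite (bigD1 l) //= eqxx scale1r big1 ?addr0 // => a al.
  by rewrite eq_sym (negbTE al) scale0r.
elim: n i => [|n IH] i; rewrite top.
  under eq_bigr do under eq_bigr do under eq_bigr do rewrite lup0 -mulmxA.
  exact: delta.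
(* The twisted form of the induction hypothesis: the starred F-relation converts star u into u. *)
have low a : \sum_q star (u a q) *: (L (adjmx (ltw K n q)) *m corep n.+1) =
    corep n *m L (adjmx (ltw K n a)).
  transitivity (\sum_s (F a s)^*%:A *: (\sum_r u s r *: (L (adjmx (lup K n r)) *m corep n.+1))).
    transitivity (\sum_r (\sum_q (F q r)^* *: star (u a q)) *:
        (L (adjmx (lup K n r)) *m corep n.+1)).
      under [in RHS]eq_bigr do rewrite scaler_suml.
      rewrite [in RHS]exchange_big /=; apply: eq_bigr => q _.
      rewrite ltwE adjmx_sum lift_sum mulmx_suml scaler_sumr; apply: eq_bigr => r _.
      by rewrite adjmxZ liftZ -scalemxAl scalerA mulr_algr.
    under eq_bigr do rewrite uF_entry_star scaler_suml.
    rewrite exchange_big /=; apply: eq_bigr => s _; rewrite scaler_sumr.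
    by apply: eq_bigr => r _; rewrite scalerA mulr_algl.
  rewrite ltwE adjmx_sum lift_sum mulmx_sumr; apply: eq_bigr => s _.
  by rewrite IH adjmxZ liftZ mul_alg_scale.
transitivity (\sum_m \sum_a \sum_q (u i m * star (u a q)) *:
    (L (m == q)%:R%:M *m (corep n.+1 *m L (adjmx (lup K n.+1 a)))) -
  (c n.+1)%:A *: (\sum_m u i m *: (L (ltw K n m) *m
    (\sum_a (\sum_q star (u a q) *: (L (adjmx (ltw K n q)) *m corep n.+1)) *m
      L (adjmx (lup K n.+1 a)))))).
  rewrite scaler_sumr -sumrB; apply: eq_bigr => m _.
  rewrite mulmx_sumr !scaler_sumr -sumrB; apply: eq_bigr => a _.
  rewrite [X in u i m *: (_ *m X)]mulmx_suml [X in u i m *: X]mulmx_sumr.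
  rewrite [X in _%:A *: X]scaler_sumr [X in _ - X]scaler_sumr -sumrB; apply: eq_bigr => q _.
  rewrite lupS raddfB /= !mulmxBl scalerBr !mulmxA; congr (_ - _).
  rewrite liftZ liftM -!scalemxAl lift_scale !scalerA mulr_algl mulr_algr !mulmxA.
  by rewrite -!scalemxAl !scalerA -scalerAl.
have zero : \sum_a (\sum_q star (u a q) *: (L (adjmx (ltw K n q)) *m corep n.+1)) *m
    L (adjmx (lup K n.+1 a)) = 0.
  transitivity (corep n *m L (adjmx (\sum_a lup K n.+1 a *m ltw K n a))).
    rewrite adjmx_sum lift_sum mulmx_sumr; apply: eq_bigr => a _.
    by rewrite low adjmxM liftM mulmxA.
  by rewrite lup_tw adjmx0 map_mx0 mulmx0.
rewrite delta zero big1 ?scaler0 ?subr0 // => m _.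
by rewrite mulmx0 scaler0.
Qed.

End Intertwiners.

Section Haar.
Variables (R : realType).
Local Notation C := R[i].

Section Tensor.
Variables (A B T : cstarAlgType C) (tens : A -> B -> T).
Hypothesis T_tens : min_tensor tens.

(** The product of elementary tensors is not part of [min_tensor]; it is read off in the faithful
    representation rho, on the dense span of the vectors tau x y. *)
Lemma min_tensor_mul a b a' b' : tens a b * tens a' b' = tens (a * a') (b * b').
Proof.
case: T_tens => _ [H [K [HK [tau [pi [sigma [rho [[_ tau_d] _ _ [_ rhoI] rhoE]]]]]]]].
apply: rhoI; rewrite rmorphM; apply: (bop_dense_eq tau_d) => _ [x [y ->]].
by rewrite bop_mulE !rhoE !rmorphM.
Qed.

Lemma min_tensor_one : tens 1 1 = 1.
Proof.
case: T_tens => _ [H [K [HK [tau [pi [sigma [rho [[_ tau_d] _ _ [_ rhoI] rhoE]]]]]]]].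
apply: rhoI; rewrite rmorph1; apply: (bop_dense_eq tau_d) => _ [x [y ->]].
by rewrite rhoE !rmorph1.
Qed.

End Tensor.

Lemma haar_cosum (N : nat) (A : cstarAlgType C) (u : 'M[A]_N) (h : A -> C) s :
  haar_state u h ->
  cosum u u s (fun a b => h a *: b) = (h (entries u s))%:A.
Proof.
move=> [_ [T [tens [Delta [sl [sr [Tt [_ Du] [_ slE] _ inv]]]]]]].
have DE : Delta (entries u s) = cosum u u s tens.
  elim: s => [|x s IH]; first by rewrite /entries big_nil /= rmorph1 min_tensor_one.
  rewrite entries_cons rmorphM /= IH Du mulr_suml.
  apply: eq_bigr => m _.
  rewrite (@cosum_morph _ _ _ _ _ _ _ _ (fun t => tens (u x.1 m) (u m x.2) * t)).
  - by apply: eq_cosum => a b; rewrite min_tensor_mul.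
  - exact: mulr0.
  - exact: mulrDr.
rewrite -(proj1 (inv _)) DE (@cosum_morph _ _ _ _ _ _ _ _ sl); first last.
- exact: raddfD.
- exact: raddf0.
by apply: eq_cosum => a b; rewrite slE.
Qed.

Lemma cosum_map (N : nat) (A B B' : algType C) (u : 'M[A]_N) (v : 'M[B]_N)
    (f : {lrmorphism B -> B'}) (V : zmodType) s (Q : A -> B' -> V) :
  cosum u v s (fun a b => Q a (f b)) = cosum u (map_mx f v) s Q.
Proof.
elim: s Q => [|x s IH] Q /=; first by rewrite rmorph1.
apply: eq_bigr => m _; rewrite -IH; apply: eq_cosum => a b.
by rewrite rmorphM /= mxE.
Qed.

Section ModelMoments.
Variables (G : nzHilbertType R[i]) (e : nat -> G).
Hypothesis e_on : forall m n, '[e m, e n] = (m == n)%:R.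
Variables (N : nat) (F : 'M[C]_N) (c : nat -> C) (B : C).
Hypotheses (FF : F *m map_mx Num.conj F = - 1%:M).
Hypothesis c_gt0 : forall n, 0 < c n.+1.
Hypothesis c_le : forall n, c n.+1 <= B.
Variables (K : ladder F^T c) (H : ladder F c).

Local Notation p := (ldim K).
Local Notation q := (ldim H).
Local Notation blk := (@blk R G e p q _).
Local Notation coblk := (@coblk R G e p q).
Local Notation k n := (sqrtC (c n.+1)).
Local Notation raises := (@raises R G e N F c K H).
Local Notation v := (model_mx e_on c_gt0 c_le K H).

Lemma raises_coblkS (T : bop G) f g n y : raises T f g ->
  coblk n.+1 (T y) = k n *: (f n *m coblk n y *m (g n)^T).
Proof.
move=> [h1 h2 h3 h4]; apply: fro_inj => X; rewrite -blk_adjr bop_adjP.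
rewrite -[bop_adj T _]/(star T _) h2 blk_adjr froZr (k_real c_gt0) froZl -mulmxA.
by rewrite fro_mulr fro_mull.
Qed.

Lemma raises_coblk0 (T : bop G) f g y : raises T f g -> coblk 0 (T y) = 0.
Proof.
move=> [h1 h2 h3 h4]; apply: fro_inj => X; rewrite -blk_adjr bop_adjP.
by rewrite -[bop_adj T _]/(star T _) h3 inner0r /fro mul0mx mxtrace0.
Qed.

Lemma raises_star_coblk (T : bop G) f g n y : raises T f g ->
  coblk n (star T y) = k n *: (adjmx (f n) *m coblk n.+1 y *m (adjmx (g n))^T).
Proof.
move=> [h1 h2 h3 h4]; apply: fro_inj => X; rewrite -blk_adjr bop_star_adjP h1.
rewrite blk_adjr froZr (k_real c_gt0) froZl fro_mulr fro_mull !adjmxK.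
by rewrite mulmxA.
Qed.

Lemma coblkD n y y' : coblk n (y + y') = coblk n y + coblk n y'.
Proof. by apply/matrixP => a b; rewrite !mxE innerDl. Qed.

Lemma coblkZ n a y : coblk n (a *: y) = a *: coblk n y.
Proof. by apply/matrixP => i j; rewrite !mxE innerZl. Qed.

Lemma coblk_model i j n y :
  coblk n (v i j y) = coblk n (Dl e_on c_gt0 c_le K H i j y) +
    k n *: (adjmx (lup K n i) *m coblk n.+1 y *m (adjmx (ltw H n j))^T).
Proof.
rewrite mxE /model !bop_addE !coblkD.
rewrite -(raises_star_coblk _ _ (Dr_raises e_on c_gt0 c_le K H i j)).
rewrite [X in _ + X](_ : _ = 0) ?addr0 //.
by rewrite [coblk n _](coblkZ n _ (bprojC e_on K H y)) (perp_bprojC e_on K H y n) scaler0.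
Qed.

Section Intertwine.
Variables (A : starAlgType C) (u : 'M[A]_N).
Hypothesis uF : OF_relations F u.
Local Notation L := (map_mx (in_alg A)).

Notation cor := (corep u K).

Lemma intertwine_step s om i r t n (a : C) (M : 'I_N -> 'M[C]_(r, p n))
    (M' : 'M[C]_(q n, t)) :
  cosum u v s (fun a b => a *: L (coblk n (b om))) =
    cor n *m L (coblk n (entries v s om)) ->
  \sum_m cosum u v s (fun x b => (u i m * x) *:
     L (a *: (M m *m coblk n (b om) *m M'))) =
  a%:A *: ((\sum_m u i m *: (L (M m) *m cor n)) *m L (coblk n (entries v s om)) *m L M').
Proof.
move=> IH; rewrite !mulmx_suml scaler_sumr; apply: eq_bigr => m _.
pose phi (Z : 'M[A]_(p n, q n)) := a%:A *: (u i m *: (L (M m) *m Z *m L M')).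
have -> : a%:A *: (u i m *: (L (M m) *m cor n) *m L (coblk n (entries v s om)) *m L M') =
    phi (cor n *m L (coblk n (entries v s om))).
  by rewrite /phi -!scalemxAl !mulmxA.
rewrite -IH (@cosum_morph _ _ _ _ _ _ _ _ phi).
- apply: eq_cosum => x b; rewrite /phi liftZ lift_scale -scalemxAl !scalerA.
  by rewrite !liftM mulr_algr !mulr_algl scalerAl.
- by rewrite /phi mulmx0 mul0mx !scaler0.
- by move=> Z Z'; rewrite /phi mulmxDr mulmxDl !scalerDr.
Qed.

(** Applying the coproduct to a word and letting its second leg act on a vector of the lowest level
    amounts to multiplying the rows of block n by [corep n]. The first letter reaches block n either
    by lowering from n + 1, where [corep_lower] applies, or by raising from n - 1, where
    [corep_raise] does; the column factor is untouched. At n = 0, [corep 0] is 1, so (id (x) phi)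
    Delta = phi 1 for the vector states phi of this level. *)
Lemma intertwine s (W : 'M[C]_(p 0, q 0)) n :
  cosum u v s (fun a b => a *: L (coblk n (b (blk W)))) =
  cor n *m L (coblk n (entries v s (blk W))).
Proof.
have Fu : F \in unitmx.
  by have /mulmx1_unit[] : F *m (- map_mx Num.conj F) = 1%:M by rewrite mulmxN FF opprK.
elim: s n => [|[i j] s IH] n.
  rewrite /entries big_nil /= scale1r; case: n => [|n]; first by rewrite mul1mx.
  by rewrite (@coblk_blk0 _ _ _ e_on) // map_mx0 mulmx0.
have lower : \sum_m cosum u v s (fun x b => (u i m * x) *: L (k n *:
      (adjmx (lup K n m) *m coblk n.+1 (b (blk W)) *m (adjmx (ltw H n j))^T))) =
    cor n *m L (k n *: (adjmx (lup K n i) *m coblk n.+1 (entries v s (blk W)) *m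
      (adjmx (ltw H n j))^T)).
  rewrite (intertwine_step _ _ _ _ (IH n.+1)) (corep_lower K uF Fu) liftZ mul_alg_scale.
  by rewrite !liftM !mulmxA.
rewrite entries_cons bop_mulE coblk_model raddfD mulmxDr /= -lower.
transitivity (\sum_m cosum u v s (fun x b => (u i m * x) *:
    L (coblk n (Dl e_on c_gt0 c_le K H m j (b (blk W))))) +
  \sum_m cosum u v s (fun x b => (u i m * x) *: L (k n *:
      (adjmx (lup K n m) *m coblk n.+1 (b (blk W)) *m (adjmx (ltw H n j))^T)))).
  rewrite -big_split; apply: eq_bigr => m _; apply: (etrans _ (cosumD _ _ _ _ _)).
  apply: eq_cosum => x b.
  by rewrite coblk_model raddfD scalerDr.
congr (_ + _); case: n {lower} => [|n].
  rewrite (raises_coblk0 _ (Dl_raises e_on c_gt0 c_le K H i j)) map_mx0 mulmx0.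
  apply: big1 => m _; transitivity (cosum u v s (fun _ _ => 0 : 'M[A]_(p 0, q 0))).
    apply: eq_cosum => x b.
    by rewrite (raises_coblk0 _ (Dl_raises e_on c_gt0 c_le K H m j)) map_mx0 scaler0.
  by elim: s {IH} => //= y s IH; apply: big1.
have E m y := raises_coblkS n y (Dl_raises e_on c_gt0 c_le K H m j).
rewrite E liftZ mul_alg_scale !liftM mulmxA mulmxA -(corep_raise K uF Fu).
rewrite -(intertwine_step _ _ _ _ (IH n)); apply: eq_bigr => m _; apply: eq_cosum => x b.
by rewrite E.
Qed.

End Intertwine.

Definition Om0 : G :=
  blk (delta_mx (Ordinal (ldim0 K)) (Ordinal (ldim0 H)) : 'M[C]_(p 0, q 0)).

Lemma coblk_Om0 y : coblk 0 y (Ordinal (ldim0 K)) (Ordinal (ldim0 H)) = '[y, Om0].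
Proof.
rewrite blk_adjr froE (bigD1 (Ordinal (ldim0 K))) //= (bigD1 (Ordinal (ldim0 H))) //=.
rewrite !big1 ?addr0.
- by rewrite [X in X^*]mxE !eqxx conjC1 mulr1.
- by move=> i /negbTE iK; apply: big1 => j _; rewrite [X in X^*]mxE iK conjC0 mulr0.
- by move=> j /negbTE jH; rewrite [X in X^*]mxE jH andbF conjC0 mulr0.
Qed.

Lemma Om0_norm : '[Om0, Om0] = 1.
Proof. by rewrite -coblk_Om0 (coblk_blk e_on) mxE !eqxx. Qed.

(** The convolution [S] of h with the vector state of [Om0] is computed twice: the invariance of h
    gives h ([haar_cosum]), and [intertwine] at level 0 gives the vector state. *)
Lemma haar_vacuum (A : cstarAlgType C) (u : 'M[A]_N) (h : A -> C)
    (f : {lrmorphism A -> bop G}) s :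
  OF_relations F u -> haar_state u h -> map_mx f u = v ->
  h (entries u s) = '[entries v s Om0, Om0].
Proof.
move=> uF hh fu; have [[h_lin h1 _] _] := hh.
have hD : {morph h : x y / x + y} by move=> x y; rewrite -[x]scale1r h_lin scale1r mul1r.
have h0 : h 0 = 0 by apply: (addrI (h 0)); rewrite -hD !addr0.
have hZ a x : h (a *: x) = a * h x by rewrite -[a *: x]addr0 h_lin h0 addr0.
pose S := cosum u v s (fun a b => h a * '[b Om0, Om0]).
transitivity S.
  pose phi (x : A) := '[f x Om0, Om0].
  have phi0 : phi 0 = 0 by rewrite /phi raddf0 inner0l.
  have phiD : {morph phi : x y / x + y} by move=> x y; rewrite /phi raddfD innerDl.
  have phiZ a x : phi (a *: x) = a * phi x by rewrite /phi linearZ innerZl.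
  have := congr1 phi (haar_cosum s hh); rewrite (cosum_morph u u s _ phi0 phiD) phiZ.
  rewrite {2}/phi rmorph1 Om0_norm mulr1 => <-; rewrite /S -fu -cosum_map.
  by apply: eq_cosum => a b; rewrite phiZ.
pose psi (Z : 'M[A]_(p 0, q 0)) := h (Z (Ordinal (ldim0 K)) (Ordinal (ldim0 H))).
have psi0 : psi 0 = 0 by rewrite /psi mxE.
have psiD : {morph psi : x y / x + y} by move=> x y; rewrite /psi mxE hD.
have psiL a Y : psi (a *: map_mx (in_alg A) (coblk 0 Y)) = h a * '[Y, Om0].
  by rewrite /psi mxE [in LHS]mxE coblk_Om0 /= mulr_algr hZ mulrC.
have := congr1 psi (intertwine uF s (delta_mx (Ordinal (ldim0 K)) (Ordinal (ldim0 H))) 0).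
rewrite (cosum_morph u v s _ psi0 psiD) mul1mx -[X in _ = psi X]scale1r psiL h1 mul1r => <-.
by apply: eq_cosum => a b; rewrite psiL.
Qed.

End ModelMoments.
End Haar.

(** * Asymptotics of the raising operators *)

Section Recursion.
Variables (C : numClosedFieldType) (t : C).
Hypothesis t2 : 2 <= t.

Fixpoint cseq n : C := if n is m.+1 then (t - cseq m)^-1 else 0.

Lemma t1_gt0 : 0 < t - 1.
Proof. by rewrite subr_gt0 (lt_le_trans _ t2) // ltr1n. Qed.

Lemma t1_le1 : (t - 1)^-1 <= 1.
Proof. by rewrite invf_le1 ?t1_gt0 // lerBrDr. Qed.

(** The bound reproduces itself: since t >= 2 it is at most 1, and c_n <= 1 gives t - c_n >= t -
    1. *)
Lemma cseq_bound n : 0 <= cseq n <= (t - 1)^-1.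
Proof.
elim: n => [|n /andP[c0 c1]]; first by rewrite lexx invr_ge0 ltW ?t1_gt0.
have h : t - 1 <= t - cseq n by rewrite lerD2l lerN2 (le_trans c1) // t1_le1.
have p : 0 < t - cseq n by rewrite (lt_le_trans t1_gt0).
by rewrite /= invr_ge0 ltW //= lef_pV2 // posrE ?t1_gt0.
Qed.

Lemma cseq_le1 n : cseq n <= 1.
Proof. by case/andP: (cseq_bound n) => _ /le_trans; apply; exact: t1_le1. Qed.

Lemma cseqD_gt0 n : 0 < t - cseq n.
Proof. by rewrite (lt_le_trans t1_gt0) // lerD2l lerN2 cseq_le1. Qed.

Lemma cseq_gt0 n : 0 < cseq n.+1.
Proof. by rewrite invr_gt0 cseqD_gt0. Qed.

Lemma cseqS n : cseq n.+1 * (t - cseq n) = 1.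
Proof. by rewrite mulVf // gt_eqF // cseqD_gt0. Qed.

(** By the recursion the difference is the product c_(n+1) c_n, one factor being at most 1 and the
    other at most 1 / (t - 1). *)
Lemma cseq_t n : `|t * cseq n.+1 - 1| <= (t - 1)^-1.
Proof.
have -> : t * cseq n.+1 - 1 = cseq n.+1 * cseq n.
  by rewrite -{1}(cseqS n) mulrC -mulrBr opprB addrC subrK.
have /andP[c0 c1] := cseq_bound n; have /andP[d0 d1] := cseq_bound n.+1.
by rewrite ger0_norm ?mulr_ge0 // -[leRHS]mulr1 ler_pM // cseq_le1.
Qed.

Lemma cseq_t_le2 n : t * cseq n.+1 <= 2.
Proof.
have := le_trans (cseq_t n) t1_le1; have /andP[d0 _] := cseq_bound n.+1.
have tr : t * cseq n.+1 - 1 \is Num.real.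
  by rewrite rpredB // ger0_real // mulr_ge0 // (le_trans _ t2).
by rewrite real_ler_norml // lerBlDr => /andP[].
Qed.

End Recursion.

(** * Rows, columns and size of F(k) *)

Section FmatEntries.
Variables (R : realType) (lam : nat -> R).
Hypothesis lam1 : forall i, 1 < lam i.
Local Notation C := R[i].

Definition dval (j : nat) : R := if j is i.+1 then Num.sqrt (lam i) else 1.

Lemma dval_ge1 j : 1 <= dval j.
Proof. by case: j => //= i; rewrite -sqrtr1 ler_wsqrtr // ltW. Qed.

Lemma dval_gt0 j : 0 < dval j. Proof. exact: lt_le_trans (dval_ge1 j). Qed.

Lemma DmatE k (i j : 'I_k.+1) : Dmat lam k i j = ((dval j)%:C%C) *+ (i == j).
Proof.
rewrite !mxE; have [->|//] := eqVneq i j; rewrite !mulr1n.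
by case: j => -[|j] //= _.
Qed.

Lemma invDmatE k (i j : 'I_k.+1) : invmx (Dmat lam k) i j = ((dval j)^-1%:C%C) *+ (i == j).
Proof.
have -> : invmx (Dmat lam k) = diag_mx (\row_j ((dval j)^-1)%:C%C).
  rewrite -[RHS]mul1mx -(mulVmx (Dmat_unit k lam1)) -mulmxA.
  rewrite (_ : Dmat lam k *m _ = 1%:M) ?mulmx1 //.
  apply/matrixP => a b; rewrite mul_mx_diag mxE DmatE !mxE.
  case: (a == b); last by rewrite mulr0n mul0r.
  by rewrite mulr1n -rmorphM divff ?rmorph1 // gt_eqF // dval_gt0.
by rewrite !mxE; have [->|//] := eqVneq i j.
Qed.

Local Notation F k := (Fmat lam k).

Lemma Fmat_ll k (i j : 'I_k.+1) : F k (lshift _ i) (lshift _ j) = 0.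
Proof. by rewrite block_mxEul mxE. Qed.
Lemma Fmat_rr k (i j : 'I_k.+1) : F k (rshift _ i) (rshift _ j) = 0.
Proof. by rewrite block_mxEdr mxE. Qed.
Lemma Fmat_lr k (i j : 'I_k.+1) :
  F k (lshift _ i) (rshift _ j) = ((dval j)^-1%:C%C) *+ (i == j).
Proof. by rewrite block_mxEur invDmatE. Qed.
Lemma Fmat_rl k (i j : 'I_k.+1) :
  F k (rshift _ i) (lshift _ j) = - ((dval j)%:C%C) *+ (i == j).
Proof. by rewrite block_mxEdl mxE DmatE mulNrn. Qed.

Lemma sum_delta (V : lmodType C) (I : finType) (j : I) (a : C) (f : I -> V) :
  \sum_i (a *+ (i == j)) *: f i = a *: f j.
Proof.
rewrite (bigD1 j) //= eqxx big1 ?addr0 // => i /negbTE ->.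
by rewrite mulr0n scale0r.
Qed.

Lemma sum_delta' (V : lmodType C) (I : finType) (j : I) (a : I -> C) (f : I -> V) :
  \sum_i (a i *+ (j == i)) *: f i = a j *: f j.
Proof.
rewrite (bigD1 j) //= eqxx big1 ?addr0 // => i ij.
by rewrite eq_sym (negbTE ij) mulr0n scale0r.
Qed.

Lemma Fmat_coll k (V : lmodType C) (j : 'I_k.+1) (f : _ -> V) :
  \sum_m F k m (lshift _ j) *: f m = - (dval j)%:C%C *: f (rshift _ j).
Proof.
rewrite big_split_ord /= big1 ?add0r => [|i _]; last by rewrite Fmat_ll scale0r.
by under eq_bigr do rewrite Fmat_rl; rewrite (sum_delta j _ (fun i => f (rshift _ i))).
Qed.

Lemma Fmat_colr k (V : lmodType C) (j : 'I_k.+1) (f : _ -> V) :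
  \sum_m F k m (rshift _ j) *: f m = (dval j)^-1%:C%C *: f (lshift _ j).
Proof.
rewrite big_split_ord /= [X in _ + X]big1 ?addr0 => [|i _]; last by rewrite Fmat_rr scale0r.
by under eq_bigr do rewrite Fmat_lr; rewrite (sum_delta j _ (fun i => f (lshift _ i))).
Qed.

Lemma Fmat_rowl k (V : lmodType C) (i : 'I_k.+1) (f : _ -> V) :
  \sum_m F k (lshift _ i) m *: f m = (dval i)^-1%:C%C *: f (rshift _ i).
Proof.
rewrite big_split_ord /= big1 ?add0r => [|j _]; last by rewrite Fmat_ll scale0r.
under eq_bigr do rewrite Fmat_lr.
exact: (sum_delta' i (fun j : 'I_k.+1 => (dval j)^-1%:C%C) (fun j => f (rshift _ j))).
Qed.

Lemma Fmat_rowr k (V : lmodType C) (i : 'I_k.+1) (f : _ -> V) :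
  \sum_m F k (rshift _ i) m *: f m = - (dval i)%:C%C *: f (lshift _ i).
Proof.
rewrite big_split_ord /= [X in _ + X]big1 ?addr0 => [|j _]; last by rewrite Fmat_rr scale0r.
under eq_bigr do rewrite Fmat_rl.
exact: (sum_delta' i (fun j : 'I_k.+1 => - (dval j)%:C%C) (fun j => f (lshift _ j))).
Qed.

Lemma NF_adjmx N (M : 'M[C]_N) : NF M = \tr (adjmx M *m M).
Proof. by rewrite /NF /adjmx map_trmx. Qed.

Lemma NF_sum N (M : 'M[C]_N) : NF M = \sum_j \sum_i `|M i j| ^+ 2.
Proof.
apply: eq_bigr => j _; rewrite mxE; apply: eq_bigr => i _.
by rewrite !mxE normCK mulrC.
Qed.

Lemma NF_tr N (M : 'M[C]_N) : NF M^T = NF M.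
Proof.
rewrite !NF_sum exchange_big; apply: eq_bigr => i _; apply: eq_bigr => j _.
by rewrite mxE.
Qed.

(** The k + 1 diagonal entries of -D have modulus at least 1, and the first entry of the inverse of
    D is 1. The extra unit is what gives N_F - 1 >= k + 1. *)
Lemma NF_ge k : (k.+2)%:R <= NF (F k).
Proof.
have sq0 (x : C) : 0 <= `|x| ^+ 2 by rewrite exprn_ge0.
rewrite NF_sum big_split_ord /= -[k.+2]addn1 natrD lerD //.
  rewrite -[k.+1 in leLHS]card_ord -sumr_const ler_sum // => j _.
  rewrite (bigD1 (rshift _ j)) //= ler_wpDr ?sumr_ge0 //.
  rewrite Fmat_rl eqxx mulr1n normrN exprn_ege1 //.
  have d1 : 1 <= (dval j)%:C%C by rewrite (lecR 1) dval_ge1.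
  by rewrite ger0_norm // (le_trans ler01).
rewrite (bigD1 ord0) //= ler_wpDr ?sumr_ge0 // => [? _|]; first exact: sumr_ge0.
rewrite (bigD1 (lshift _ ord0)) //= ler_wpDr ?sumr_ge0 //.
by rewrite Fmat_lr eqxx mulr1n invr1 normr1 expr1n.
Qed.

End FmatEntries.

Section GramRemainder.
Variables (R : realType) (N : nat) (F : 'M[R[i]]_N) (c : nat -> R[i]) (B : R[i]).
Local Notation C := R[i].
Hypothesis c_gt0 : forall n, 0 < c n.+1.
Hypothesis c_le : forall n, c n.+1 <= B.
Variable L : ladder F c.

(** If twisting a letter only rescales another one, the correction in [lupS] is c d conj(d') times
    lup_b lup_b'*, a product of two contractions. *)
Lemma gram_remainder n a a' b b' (d d' : C) :
  (forall m, ltw L m a = d *: lup L m b) ->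
  (forall m, ltw L m a' = d' *: lup L m b') ->
  exists2 S : 'M[C]_(ldim L n, ldim L n),
    adjmx (lup L n a) *m lup L n a' = (a == a')%:R%:M - S &
    forall r (X : 'M[C]_(ldim L n, r)),
      fro (S *m X) (S *m X) <= (B * (`|d| * `|d'|)) ^+ 2 * fro X X.
Proof.
move=> ha ha'; have B0 : 0 <= B by rewrite (le_trans _ (c_le 0)) // ltW.
case: n => [|n].
  exists 0 => [|r X]; first by rewrite subr0 lup0.
  rewrite mul0mx {1}/fro mul0mx mxtrace0 mulr_ge0 ?fro_ge0 // exprn_ge0 //.
  by rewrite !mulr_ge0.
exists (c n.+1 *: (ltw L n a *m adjmx (ltw L n a'))); first exact: lupS.
move=> r X; rewrite ha ha' adjmxZ -scalemxAr -!scalemxAl !scalerA.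
rewrite froZl froZr mulrA -mulmxA ler_pM ?fro_ge0 // ?mul_conjC_ge0 //.
  rewrite -normCK ler_pXn2r ?nnegrE // ?mulr_ge0 // !normrM norm_conjC.
  rewrite -mulrA [`|d'| * _]mulrC ler_wpM2r ?mulr_ge0 //.
  by rewrite gtr0_norm.
by rewrite (le_trans (lup_contract c_gt0 _ _)) // ldn_contract.
Qed.

End GramRemainder.

Section GramEstimate.
Variables (R : realType) (G : nzHilbertType R[i]) (e : nat -> G).
Local Notation C := R[i].
Hypothesis e_on : forall m n, '[e m, e n] = (m == n)%:R.
Variables (N : nat) (F : 'M[C]_N) (c : nat -> C) (B t : C).
Hypothesis c_gt0 : forall n, 0 < c n.+1.
Hypothesis c_le : forall n, c n.+1 <= B.
Hypothesis ct : forall n, `|t * c n.+1 - 1| <= B.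
Hypothesis ct2 : forall n, `|t * c n.+1| <= 2.
Variables (K : ladder F^T c) (H : ladder F c).

Local Notation p := (ldim K).
Local Notation q := (ldim H).
Local Notation blk := (@blk R G e p q _).

Lemma blk_le n (X Y : 'M[C]_(p n, q n)) (b : C) : 0 <= b ->
  fro Y Y <= b ^+ 2 * fro X X -> `|blk Y| <= b * `|blk X|.
Proof.
move=> b0; rewrite -!(blk_norm e_on) -exprMn.
by rewrite ler_pXn2r ?nnegrE // mulr_ge0.
Qed.

(** On block n the product is t c_(n+1) times (delta - S1) X (delta - S2)^T. Replacing t c_(n+1) by
    1 in the main term costs B; the three other terms have sizes b1, b2 and b1 b2, and 2 bounds
    their factor t c_(n+1). *)
Lemma gram_estimate (D D' : bop G) n (X : 'M[C]_(p n, q n)) a a' b b' sa sa' sb sb'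
    (da da' db db' : C) :
  raises e D (fun n => lup K n a) (fun n => lup H n b) ->
  raises e D' (fun n => lup K n a') (fun n => lup H n b') ->
  (forall m, ltw K m a = da *: lup K m sa) ->
  (forall m, ltw K m a' = da' *: lup K m sa') ->
  (forall m, ltw H m b = db *: lup H m sb) ->
  (forall m, ltw H m b' = db' *: lup H m sb') ->
  forall b1 b2, b1 = B * (`|da| * `|da'|) -> b2 = B * (`|db| * `|db'|) ->
  `|t *: star D (D' (blk X)) - ((a == a') && (b == b'))%:R *: blk X|
    <= (B + 2 * (b1 + b2 + b1 * b2)) * `|blk X|.
Proof.
move=> [_ Ds _ _] [D's _ _ _] ha ha' hb hb' b1 b2 e1 e2.
have B0 : 0 <= B by rewrite (le_trans _ (c_le 0)) // ltW.
have b10 : 0 <= b1 by rewrite e1 !mulr_ge0.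
have b20 : 0 <= b2 by rewrite e2 !mulr_ge0.
have [S1 g1 S1b] := gram_remainder c_gt0 c_le n ha ha'.
have [S2 g2 S2b] := gram_remainder c_gt0 c_le n hb hb'.
set x := (a == a'); set y := (b == b').
have mx : adjmx (lup K n a) *m (lup K n a' *m X *m (lup H n b')^T) *m
    (adjmx (lup H n b))^T = (x && y)%:R *: X -
    (y%:R *: (S1 *m X) + (x%:R *: (X *m S2^T) - S1 *m X *m S2^T)).
  rewrite !mulmxA g1 -(mulmxA _ (lup H n b')^T) -trmx_mul g2.
  rewrite raddfB /= tr_scalar_mx mulmxBr !mulmxBl mul_mx_scalar !mul_scalar_mx.
  rewrite mul_mx_scalar -!scalemxAl scalerA -natrM mulnb andbC.
  by rewrite -/x -/y [in RHS]opprD addrA.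
have -> : t *: star D (D' (blk X)) - (x && y)%:R *: blk X =
    (t * c n.+1 - 1) *: ((x && y)%:R *: blk X) - (t * c n.+1) *:
    (y%:R *: blk (S1 *m X) + (x%:R *: blk (X *m S2^T) - blk (S1 *m X *m S2^T))).
  have -> : star D (D' (blk X)) = c n.+1 *: blk ((x && y)%:R *: X -
    (y%:R *: (S1 *m X) + (x%:R *: (X *m S2^T) - S1 *m X *m S2^T))).
    rewrite D's Ds -scalemxAr -scalemxAl scalerA k_sqr // mx.
    exact: blkZ.
  have blkB (Y Z : 'M[C]_(p n, q n)) : blk (Y - Z) = blk Y - blk Z.
    by rewrite blkD -scaleN1r blkZ scaleN1r.
  rewrite !(blkB, blkD, blkZ) scalerA scalerBr [in RHS]scalerBl scale1r.
  by rewrite addrAC.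
have nb (d : bool) : `|d%:R : C| <= 1 by rewrite normr_nat; case: d.
have Zb (d : bool) (v : G) : `|d%:R *: v| <= `|v|.
  by rewrite normrZ ler_piMl.
have n1 r (Y : 'M[C]_(p n, r)) : fro (S1 *m Y) (S1 *m Y) <= b1 ^+ 2 * fro Y Y.
  by rewrite e1.
have n2 r (Y : 'M[C]_(r, q n)) : fro (Y *m S2^T) (Y *m S2^T) <= b2 ^+ 2 * fro Y Y.
  by rewrite -fro_tr trmx_mul trmxK e2 -(fro_tr Y) S2b.
have N1 := blk_le b10 (n1 _ X).
have N2 := blk_le b20 (n2 _ X).
have N3 := le_trans (blk_le b20 (n2 _ (S1 *m X))) (ler_wpM2l b20 N1).
rewrite mulrDl (le_trans (ler_normB _ _)) // lerD //.
  by rewrite normrZ ler_pM.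
rewrite normrZ -mulrA ler_pM // !mulrDl -addrA (le_trans (ler_normD _ _)) // lerD //.
  exact: le_trans (Zb _ _) N1.
rewrite (le_trans (ler_normB _ _)) // lerD //; first exact: le_trans (Zb _ _) N2.
by rewrite (mulrC b1) -mulrA.
Qed.

End GramEstimate.

(** * Convergence of moments from asymptotic Gram relations *)

Section Asymptotics.
Variables (R : realType) (G : nzHilbertType R[i]).
Local Notation C := R[i].

Definition tends (f : nat -> C) (l : C) : Prop :=
  forall e : C, 0 < e -> exists N, forall k, (N <= k)%N -> `|f k - l| < e.

Lemma tends_cst (l : C) : tends (fun=> l) l.
Proof. by move=> e e0; exists 0%N => k _; rewrite subrr normr0. Qed.

Lemma tends_lin (a : C) (f g : nat -> C) (l m : C) :
  tends f l -> tends g m -> tends (fun k => f k + a * g k) (l + a * m).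
Proof.
move=> fl gm e e0; have e2 : 0 < e / 2 by rewrite divr_gt0.
have a1 : 0 < `|a| + 1 by rewrite ltr_wpDl.
have [[N1 h1] [N2 h2]] := (fl _ e2, gm _ (divr_gt0 e2 a1)).
exists (maxn N1 N2) => k; rewrite geq_max => /andP[/h1 fk /h2].
rewrite ltr_pdivlMr // => gk.
rewrite [e]splitr opprD addrACA -mulrBr (le_lt_trans (ler_normD _ _)) // ltrD //.
rewrite normrM mulrC (le_lt_trans _ gk) // ler_wpM2l // lerDl //.
Qed.

Lemma tends_cvg (f : nat -> C) (l : C) :
  tends f l -> (f : nat -> C^o) @ \oo --> (l : C^o).
Proof.
move=> fl; apply/cvgrPdist_lt => e /fl[N Nf]; exists N => // k /= /Nf.
by rewrite distrC.
Qed.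

Variables (om : nat -> G) (S : nat -> nat * bool -> bop G) (b : nat -> C).

Definition stack_vect k s : G := foldr (S k) (om k) s.

Definition gen_op k (x : bool * nat) : bop G :=
  starpow x.1 (S k (x.2, false) + b x.2 *: star (S k (x.2, true))).

Hypothesis om1 : forall k, '[om k, om k] = 1.
Hypothesis om0 : forall k x, star (S k x) (om k) = 0.
Hypothesis Sb : forall k x y, `|S k x y| <= 2 * `|y|.
Hypothesis gram : forall x y s (e : C), 0 < e -> exists N, forall k, (N <= k)%N ->
  `|star (S k x) (stack_vect k (y :: s)) - (y == x)%:R *: stack_vect k s| < e.

Lemma star_bound k x y : `|star (S k x) y| <= 2 * `|y|.
Proof.
rewrite (le_trans (opnormP _ _)) // ler_wpM2r // (le_trans (opnorm_star_le _)) //.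
by apply: opnorm_le => // z; exact: Sb.
Qed.

(** Up to an error vector tending to 0, paired with the bounded W, the adjoint of S_x removes the
    top letter of the stack when it is x and gives 0 otherwise. On the empty stack [om0] gives
    exactly 0. *)
Lemma push_tends (W : nat -> G) (M : C) (g : seq (nat * bool) -> C) x s :
  (forall k, `|W k| <= M) -> (forall s, tends (fun k => '[W k, stack_vect k s]) (g s)) ->
  tends (fun k => '[W k, star (S k x) (stack_vect k s)]) (push x g s).
Proof.
move=> WM Wg; case: s => [|y s] /=.
  rewrite (_ : (fun k => _) = fun=> 0); first exact: tends_cst.
  by apply/funext => k; rewrite -[bop_adj _ _]/(star (S k x) _) om0 inner0r.
pose E k := star (S k x) (stack_vect k (y :: s)) - (y == x)%:R *: stack_vect k s.
have -> : (if y == x then g s else 0) = 0 + (y == x)%:R * g s.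
  by rewrite add0r; case: eqP; rewrite ?mul1r ?mul0r.
rewrite (_ : (fun k => _) = fun k => '[W k, E k] + (y == x)%:R * '[W k, stack_vect k s]).
  apply: tends_lin => //; move=> e e0.
  have M0 : 0 <= M by apply: le_trans (WM 0%N).
  have [|N Ne] := gram x y s (e := e / (M + 1)); first by rewrite divr_gt0 // ltr_wpDl.
  exists N => k /Ne; rewrite subr0 ltr_pdivlMr ?ltr_wpDl // => h.
  rewrite (le_lt_trans (inner_cauchy_schwarz _ _)) // (le_lt_trans _ h) // mulrC.
  by rewrite ler_wpM2l // (le_trans (WM k)) // lerDl.
apply/funext => k; rewrite /E innerBr innerZr conjC_nat subrK.
by [].
Qed.

Lemma gen_op_bound k x y : `|gen_op k x y| <= (2 + 2 * `|b x.2|) * `|y|.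
Proof.
have [M M0 Ms] : exists2 M, M = 2 + 2 * `|b x.2| & forall y,
    `|(S k (x.2, false) + b x.2 *: star (S k (x.2, true))) y| <= M * `|y|.
  exists (2 + 2 * `|b x.2|) => // z; rewrite (le_trans (ler_normD _ _)) // mulrDl.
  rewrite lerD // normrZ mulrAC mulrC ler_wpM2r //.
  exact: star_bound.
rewrite /gen_op; case: x.1; last by rewrite -M0 Ms.
rewrite (le_trans (opnormP _ _)) // ler_wpM2r // (le_trans (opnorm_star_le _)) // -M0.
by apply: opnorm_le; rewrite // M0 addr_ge0 // mulr_ge0.
Qed.

Lemma word_bound w : exists M, forall k, `|(\prod_(x <- w) gen_op k x) (om k)| <= M.
Proof.
elim: w => [|x w [M IH]].
  by exists 1 => k; rewrite big_nil -(@ler_pXn2r _ 2) ?nnegrE // inner_normE om1 expr1n.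
exists ((2 + 2 * `|b x.2|) * M) => k; rewrite big_cons bop_mulE.
by rewrite (le_trans (gen_op_bound _ _ _)) // ler_wpM2l // addr_ge0 // mulr_ge0.
Qed.

(** All coordinates of the word vector are followed, not only the vacuum one. Moved to the other
    side of the inner product, S becomes its adjoint acting on the stack, which is [push] in the
    limit, and the adjoint of S becomes S, which lengthens the stack and is exactly [pop]. *)
Lemma stack_word_tends w s :
  tends (fun k => '[(\prod_(x <- w) gen_op k x) (om k), stack_vect k s])
    (stack_word (fun=> 1) b w (@stack_vac _ _) s).
Proof.
elim: w s => [|[e i] w IH] s.
  rewrite (_ : (fun k => _) = fun=> (s == [::])%:R); first exact: tends_cst.
  apply/funext => k; rewrite big_nil; case: s => [|x s] /=; first exact: om1.
  by rewrite -[LHS]bop_star_adjP -[bop_adj _ _]/(star (S k x) _) om0 inner0l.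
have [M WM] := word_bound w; set g := stack_word _ _ _ _ in IH *.
pose W k := (\prod_(x <- w) gen_op k x) (om k).
rewrite /= -/g /stack_circ; case: e => /=.
  rewrite conjC1 mul1r.
  rewrite (_ : (fun k => _) = fun k => '[W k, stack_vect k ((i, false) :: s)] +
      (b i)^* * '[W k, star (S k (i, true)) (stack_vect k s)]).
    by apply: tends_lin; [exact: IH | apply: push_tends WM _].
  apply/funext => k; rewrite big_cons bop_mulE /gen_op /= innerDl innerZl.
  by rewrite bop_star_adjP (bop_adjP (S k (i, true))).
rewrite mul1r.
rewrite (_ : (fun k => _) = fun k => '[W k, star (S k (i, false)) (stack_vect k s)] +
    b i * '[W k, stack_vect k ((i, true) :: s)]).
  by apply: tends_lin; [apply: push_tends WM _ | exact: IH].
apply/funext => k; rewrite big_cons bop_mulE /gen_op /= innerDl innerZl.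
by rewrite bop_star_adjP (bop_adjP (S k (i, false))).
Qed.

End Asymptotics.

(** * The Haar state on words containing adjoints *)

Section StarredWords.
Variables (R : realType) (G : nzHilbertType R[i]) (e : nat -> G).
Local Notation C := R[i].
Hypothesis e_on : forall m n, '[e m, e n] = (m == n)%:R.
Variables (N : nat) (F : 'M[C]_N) (c : nat -> C) (B : C).
Hypotheses (FF : F *m map_mx Num.conj F = - 1%:M).
Hypothesis c_gt0 : forall n, 0 < c n.+1.
Hypothesis c_le : forall n, c n.+1 <= B.
Variables (K : ladder F^T c) (H : ladder F c).
Variables (A : cstarAlgType C) (u : 'M[A]_N) (h : A -> C) (f : {lrmorphism A -> bop G}).
Hypothesis uF : OF_relations F u.
Hypothesis hh : haar_state u h.
Hypothesis fu : map_mx f u = model_mx e_on c_gt0 c_le K H.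

Definition coef_span (a : A) : Prop :=
  exists d : 'I_N -> 'I_N -> C, a = \sum_m \sum_n d m n *: u m n.

Lemma entry_span a b : coef_span (u a b).
Proof.
exists (fun m n => (a == m)%:R * (b == n)%:R).
rewrite (eq_bigr (fun m => (a == m)%:R *: u m b)) ?delta_suml // => m _.
rewrite -[in RHS](delta_suml b (u m)) scaler_sumr; apply: eq_bigr => n _.
by rewrite scalerA.
Qed.

Lemma coef_spanZ d a : coef_span a -> coef_span (d *: a).
Proof.
move=> [d' ->]; exists (fun m n => d * d' m n); rewrite scaler_sumr.
by apply: eq_bigr => m _; rewrite scaler_sumr; apply: eq_bigr => n _; rewrite scalerA.
Qed.

(* Since F conj(F) = -1, the relation U = F conj(U) F^-1 expresses the adjoints
   of the generators linearly in the generators. *)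
Lemma star_entry_span a b : coef_span (star (u a b)).
Proof.
have Fu : F \in unitmx.
  by have /mulmx1_unit[] : F *m (- map_mx Num.conj F) = 1%:M by rewrite mulmxN FF opprK.
exists (fun s r => - (F a s)^* * F r b).
transitivity (- \sum_r F r b *: \sum_s (F a s)^* *: u s r); last first.
  under eq_bigr do rewrite scaler_sumr.
  rewrite exchange_big /= -sumrN; apply: eq_bigr => s _; rewrite -sumrN.
  by apply: eq_bigr => r _; rewrite scalerA mulNr scaleNr mulrC.
under eq_bigr do rewrite -(uF_entry_star uF Fu) scaler_sumr.
rewrite exchange_big /= -[LHS](delta_suml b (fun q => star (u a q))) -sumrN.
apply: eq_bigr => q _; have /matrixP/(_ q b) := conjFF FF; rewrite !mxE => qb.
under eq_bigr do rewrite scalerA; rewrite -scaler_suml.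
rewrite -scaleNr; congr (_ *: _); rewrite eq_sym -[LHS]opprK -qb.
by congr (- _); apply: eq_bigr => r _; rewrite mxE mulrC.
Qed.

(** Each factor is expanded in the generators and moved into a prefix [entries u s], over which the
    induction is generalized; for a pure product of generators, [haar_vacuum] applies. *)
Lemma haar_word (I : Type) (L : seq I) (a : I -> A) : (forall r, coef_span (a r)) ->
  h (\prod_(r <- L) a r) = '[f (\prod_(r <- L) a r) (Om0 e K H), Om0 e K H].
Proof.
move=> sp; have [[h_lin h1 _] _] := hh.
have hD : {morph h : x y / x + y} by move=> x y; rewrite -[x]scale1r h_lin scale1r mul1r.
have h0 : h 0 = 0 by apply: (addrI (h 0)); rewrite -hD !addr0.
have hZ d x : h (d *: x) = d * h x by rewrite -[d *: x]addr0 h_lin h0 addr0.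
suff E s : h (entries u s * \prod_(r <- L) a r) =
    '[f (entries u s * \prod_(r <- L) a r) (Om0 e K H), Om0 e K H].
  by have := E [::]; rewrite {1 2}/entries big_nil mul1r.
elim: L s => [|r L IH] s.
  rewrite big_nil mulr1 (haar_vacuum FF s uF hh fu); congr ('[bop_fun _ _, _]).
  by rewrite /entries rmorph_prod; apply: eq_bigr => x _; rewrite -fu mxE.
rewrite big_cons; have [d ->] := sp r; set X := \prod_(r <- L) a r in IH *.
have -> : entries u s * ((\sum_m \sum_n d m n *: u m n) * X) =
    \sum_m \sum_n d m n *: (entries u (rcons s (m, n)) * X).
  rewrite mulr_suml mulr_sumr; apply: eq_bigr => m _.
  rewrite mulr_suml mulr_sumr; apply: eq_bigr => n _.
  by rewrite /entries big_rcons /= -scalerAl -scalerAr mulrA.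
pose g x := h x - '[f x (Om0 e K H), Om0 e K H].
have gD : {morph g : x y / x + y}.
  by move=> x y; rewrite /g hD raddfD innerDl opprD addrACA.
have g0 : g 0 = 0 by apply: (addrI (g 0)); rewrite -gD !addr0.
apply/eqP; rewrite -subr_eq0 -/(g _); apply/eqP.
rewrite (big_morph g gD g0) big1 // => m _; rewrite (big_morph g gD g0) big1 // => n _.
by rewrite /g hZ linearZ innerZl IH subrr.
Qed.

End StarredWords.

Lemma small_inverse (R : realType) (M e : R[i]) : 0 <= M -> 0 < e ->
  exists N, forall k, (N <= k)%N -> (k.+1)%:R^-1 * M < e.
Proof.
move=> M0 e0.
have hm := ge0_RRe M0; have hd := ge0_RRe (ltW e0); rewrite hd ltcR in e0.
exists (Num.truncn (complex.Re M / complex.Re e)) => k Nk.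
rewrite mulrC ltr_pdivrMr ?ltr0n // hm hd.
rewrite -[k.+1%:R](rmorph_nat (real_complex R)) -rmorphM ltcR mulrC -ltr_pdivrMr //.
rewrite -truncn_lt_nat // divr_ge0 //; last exact: ltW.
by rewrite -ler0c -hm.
Qed.

(** * The letters of the model for F(k) *)

Section Letters.
Variables (R : realType) (lam : nat -> R).
Hypothesis lam1 : forall i, 1 < lam i.
Local Notation C := R[i].
Variables (G : nzHilbertType R[i]) (e : nat -> G).
Hypothesis e_on : forall m n, '[e m, e n] = (m == n)%:R.

Local Notation F k := (Fmat lam k).
Local Notation t k := (NF (F k)).
Local Notation c k := (cseq (t k)).

Lemma NF_ge2 k : 2 <= t k.
Proof. by rewrite (le_trans _ (NF_ge lam1 k)) // ler_nat. Qed.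

Definition cseqNF_gt0 k n : 0 < c k n.+1 := cseq_gt0 (NF_ge2 k) n.

Lemma cseqNF_le k n : c k n.+1 <= (t k - 1)^-1.
Proof. by case/andP: (cseq_bound (NF_ge2 k) n.+1). Qed.

Variables (K : forall k, ladder (F k)^T (c k)) (H : forall k, ladder (F k) (c k)).

Local Notation D k := (@raiser R G e e_on _ (F k)
  (c k) ((t k - 1)^-1) (cseqNF_gt0 k) (cseqNF_le k) (K k) (H k)).
Local Notation om k := (Om0 e (K k) (H k)).

(** In the first row and in column i + 1 (counted from 0) of F(k) there is one nonzero entry each,
    so [Dl] and [Dr] at this position are multiples of single raisers. Their indices are those of
    the letters (i, false) and (i, true). *)
Definition letter_row k (x : nat * bool) : 'I_(k.+1 + k.+1) :=
  if x.2 then lshift k.+1 ord0 else rshift k.+1 ord0.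
Definition letter_col k (x : nat * bool) : 'I_(k.+1 + k.+1) :=
  if x.2 then rshift k.+1 (inord x.1.+1) else lshift k.+1 (inord x.1.+1).

(** The sign on the letters (i, true) cancels that of the block -D of F(k), so that the coefficient
    in [model_zk] is + sqrt lambda. *)
Definition letter_op k (x : nat * bool) : bop G :=
  ((if x.2 then -1 else 1) * sqrtC (t k)) *: D k (letter_row k x) (letter_col k x).

Lemma letter_raises k x : raises e (D k (letter_row k x) (letter_col k x))
  (fun n => lup (K k) n (letter_row k x)) (fun n => lup (H k) n (letter_col k x)).
Proof. exact: raiser_raises. Qed.

Lemma NF_ge0 k : 0 <= t k. Proof. exact: le_trans (NF_ge2 k). Qed.

Lemma sqrtNF_ge0 k : 0 <= sqrtC (t k). Proof. by rewrite sqrtC_ge0 NF_ge0. Qed.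

Lemma letter_om1 k : '[om k, om k] = 1.
Proof. exact: Om0_norm. Qed.

Lemma letter_om0 k x : star (letter_op k x) (om k) = 0.
Proof.
case: (letter_raises k x) => _ _ h _.
by rewrite /letter_op starZ -[LHS]/(_ *: star (D k _ _) _) h scaler0.
Qed.

(** The square of the norm is at most N_F / (N_F - 1) <= 2 <= 2^2, uniformly in k. *)
Lemma letter_bound k x y : `|letter_op k x y| <= 2 * `|y|.
Proof.
rewrite -(@ler_pXn2r _ 2) ?nnegrE ?mulr_ge0 // -[letter_op k x y]/(_ *: D k _ _ y).
rewrite normrZ normrM (ger0_norm (sqrtNF_ge0 k)) !exprMn sqrtCK.
have -> : `|if x.2 then -1 else 1 : C| = 1 by case: ifP; rewrite ?normrN normr1.
rewrite expr1n mul1r (le_trans (ler_wpM2l (NF_ge0 k) (raiser_bound _ _ _ _ _ _ _ _))) //.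
rewrite mulrA ler_wpM2r ?exprn_ge0 // (@le_trans _ _ 2) //; last first.
  by rewrite -natrX ler_nat.
rewrite ler_pdivrMr ?t1_gt0 ?NF_ge2 // mulr_natl mulr2n -[leLHS](subrK 1).
by rewrite lerD2l lerBrDr NF_ge2.
Qed.

Lemma stack_blk k s : exists X : 'M[C]_(ldim (K k) (size s), ldim (H k) (size s)),
  stack_vect (fun k => om k) letter_op k s = @blk R G e _ _ _ X.
Proof.
elim: s => [|x s [X Xe]] /=; first by eexists.
case: (letter_raises k x) => h _ _ _.
rewrite Xe h -blkZ.
by eexists.
Qed.

Lemma stack_bound k s : `|stack_vect (fun k => om k) letter_op k s| <= 2 ^+ size s.
Proof.
elim: s => [|x s IH] /=.
  by rewrite -(@ler_pXn2r _ 2) ?nnegrE // inner_normE letter_om1 expr1n.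
by rewrite (le_trans (letter_bound _ _ _)) // exprS ler_wpM2l.
Qed.

(** Both letter rows belong to the first diagonal entry of D, which is 1, so the scalar is 1 or
    -1. *)
Lemma ltw_row k x : exists a d, (forall m, ltw (K k) m (letter_row k x) = d *: lup (K k) m a) /\
  `|d| <= 1.
Proof.
case: x => i [].
  exists (rshift _ ord0), 1; split; last by rewrite normr1.
  by move=> m; rewrite ltwE Fmat_rowl //= invr1.
exists (lshift _ ord0), (-1); split; last by rewrite normrN1.
by move=> m; rewrite ltwE Fmat_rowr.
Qed.

Lemma ltw_col k x : (x.1 < k)%N -> exists b d,
  (forall m, ltw (H k) m (letter_col k x) = d *: lup (H k) m b) /\
  `|d| <= (dval lam x.1.+1)%:C%C.
Proof.
case: x => i b /= ik.
have ii : (inord i.+1 : 'I_k.+1) = i.+1 :> nat by rewrite inordK.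
have d1 : 1 <= (dval lam i.+1)%:C%C by rewrite (lecR 1) dval_ge1.
have d0 : 0 <= (dval lam i.+1)%:C%C by apply: le_trans d1.
case: b; rewrite /letter_col /=.
  exists (lshift _ (inord i.+1)), (dval lam i.+1)^-1%:C%C; split.
    by move=> m; rewrite -[LHS]/(\sum_m' _) Fmat_colr // ii.
  by rewrite fmorphV normfV ger0_norm // (le_trans _ d1) // invf_le1 // (lt_le_trans _ d1).
exists (rshift _ (inord i.+1)), (- (dval lam i.+1)%:C%C); split.
  by move=> m; rewrite -[LHS]/(\sum_m' _) Fmat_coll // ii.
by rewrite normrN ger0_norm.
Qed.

Lemma letter_eq k x y : (x.1 < k)%N -> (y.1 < k)%N ->
  (letter_row k x == letter_row k y) && (letter_col k x == letter_col k y) = (y == x).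
Proof.
case: x y => i a [j b] /= ik jk; rewrite xpair_eqE /letter_row /letter_col /=.
have ij : ((inord i.+1 : 'I_k.+1) == inord j.+1) = (j == i).
  by rewrite -val_eqE /= !inordK // eqSS eq_sym.
by case: a b => -[]; rewrite ?eq_lrshift ?eq_rlshift ?andbF //
  ?eqxx ?eq_lshift ?eq_rshift ij ?andbT.
Qed.

Lemma letter_gram x y s (eps : C) : 0 < eps -> exists N, forall k, (N <= k)%N ->
  `|star (letter_op k x) (stack_vect (fun k => om k) letter_op k (y :: s)) -
    (y == x)%:R *: stack_vect (fun k => om k) letter_op k s| < eps.
Proof.
move=> eps0; pose M : C := (dval lam x.1.+1)%:C%C * (dval lam y.1.+1)%:C%C.
have M0 : 0 <= M.
  by rewrite mulr_ge0 // ler0c ltW // dval_gt0.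
(* In [gram_estimate], b1 <= B, b2 <= B M and b1 b2 <= B M, whence B + 2 (B + B M + B M) = B (3 + 4
   M) with B <= 1 / (k + 1); the power of 2 bounds the stack vector. *)
have M1 : 0 <= (3 + 4 * M) * 2 ^+ size s.
  by rewrite mulr_ge0 ?exprn_ge0 // addr_ge0 // mulr_ge0.
have [N hN] := small_inverse M1 eps0.
(* Beyond both indices [inord] returns the true column, so distinct letters have distinct
   positions. *)
exists (maxn N (maxn x.1.+1 y.1.+1)) => k; rewrite !geq_max => /and3P[/hN hk xk yk].
apply: le_lt_trans hk; set E := stack_vect _ _ k s.
have [X EX] := stack_blk k s; rewrite -/E in EX.
set B := (t k - 1)^-1.
have sg (a : bool) : `|if a then -1 else 1 : C| = 1 by case: a; rewrite ?normrN normr1.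
have -> : star (letter_op k x) (stack_vect (fun k => om k) letter_op k (y :: s)) -
   (y == x)%:R *: E = ((if x.2 then -1 else 1) * (if y.2 then -1 else 1)) *:
   (t k *: star (D k (letter_row k x) (letter_col k x))
      (D k (letter_row k y) (letter_col k y) E)
    - (y == x)%:R *: E).
  rewrite scalerBr !scalerA; congr (_ - _); last first.
    congr (_ *: _); case: (y =P x) => [->|_]; last by rewrite mulr0.
    by case: ifP; rewrite ?mulrNN !mulr1.
  rewrite -[stack_vect _ _ k (y :: s)]/(letter_op k y E) /letter_op starZ.
  rewrite -[LHS]/(_ *: star (D k _ _) (_ *: D k _ _ E)) bopZ scalerA.
  congr (_ *: _); rewrite rmorphM /= (CrealP (ger0_real (sqrtNF_ge0 k))).
  rewrite -[in RHS](sqrtCK (t k)) expr2 mulrACA; congr (_ * _ * _).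
  by apply: conj_Creal; case: ifP; rewrite ?rpredN rpred1.
rewrite normrZ normrM !sg !mul1r EX -(letter_eq xk yk).
have [a [da [ha da1]]] := ltw_row k x; have [a' [da' [ha' da1']]] := ltw_row k y.
have [b [db [hb db1]]] := ltw_col xk; have [b' [db' [hb' db1']]] := ltw_col yk.
have B0 : 0 <= B by rewrite invr_ge0 ltW // t1_gt0 // NF_ge2.
have ct n : `|t k * c k n.+1 - 1| <= B := cseq_t (NF_ge2 k) n.
have ct2 n : `|t k * c k n.+1| <= 2.
  by rewrite ger0_norm ?cseq_t_le2 ?NF_ge2 // mulr_ge0 ?NF_ge0 // ltW ?cseqNF_gt0.
have := gram_estimate e_on (cseqNF_gt0 k) (cseqNF_le k) ct ct2 X
  (letter_raises k x)
  (letter_raises k y)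
  ha ha' hb hb' erefl erefl.
move=> /le_trans; apply; rewrite [leRHS]mulrA ler_pM //.
- by rewrite addr_ge0 // mulr_ge0 // !addr_ge0 // !mulr_ge0.
- have Bk : B <= k.+1%:R^-1.
    rewrite /B lef_pV2 ?posrE ?ltr0n ?t1_gt0 ?NF_ge2 // lerBrDr natr1.
    exact: NF_ge.
  have B1 : B <= 1 by rewrite t1_le1 // NF_ge2.
  apply: le_trans (ler_wpM2r _ Bk); last by rewrite addr_ge0 // mulr_ge0.
  have h1 : B * (`|da| * `|da'|) <= B by rewrite ler_piMr // mulr_ile1.
  have h2 : B * (`|db| * `|db'|) <= B * M by rewrite ler_wpM2l // ler_pM.
  have h3 : B * (`|da| * `|da'|) * (B * (`|db| * `|db'|)) <= B * M.
    by rewrite -[leRHS]mul1r ler_pM ?mulr_ge0 // (le_trans h1).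
  rewrite -/B (_ : B * (3 + 4 * M) = B + 2 * (B + B * M + B * M)); last first.
    by ring.
  by rewrite lerD2l ler_wpM2l // !lerD.
by rewrite -EX; exact: stack_bound.
Qed.

Lemma model_zk k i : (i < k)%N ->
  sqrtC (t k) *: model_mx e_on (cseqNF_gt0 k) (cseqNF_le k) (K k) (H k)
    (lshift _ ord0) (lshift _ (inord i.+1)) =
  letter_op k (i, false) + (Num.sqrt (lam i))%:C%C *: star (letter_op k (i, true)).
Proof.
move=> ik; rewrite mxE /model.
have ii : (inord i.+1 : 'I_k.+1) = i.+1 :> nat by rewrite inordK.
have -> : (lshift k.+1 (ord0 : 'I_k.+1) == lshift k.+1 (inord i.+1)) = false.
  by rewrite eq_lshift -val_eqE /= ii.
rewrite scale0r addr0 scalerDr /letter_op /letter_row /letter_col /= mul1r; congr (_ + _).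
  by rewrite /Dl Fmat_rowl //= invr1 scale1r.
rewrite /Dr Fmat_coll // ii /= !starZ !scalerA mulN1r; congr (_ *: _).
rewrite mulrC !conj_Creal ?rpredN ?ger0_real ?sqrtNF_ge0 ?ler0c ?sqrtr_ge0 //.
by rewrite mulrN mulNr.
Qed.

End Letters.

Lemma fock_orthonormal (R : realType) (H F : nzHilbertType R[i]) (tens : seq H -> F) :
  full_fock tens -> exists e : nat -> F, forall m n, '[e m, e n] = (m == n)%:R.
Proof.
move=> [tin _]; have [x x0] := @nontrivial_subdef _ H.
pose xi := `|x|^-1 *: x.
have xi1 : '[xi, xi] = 1.
  rewrite -inner_normE /xi normrZ normfV normr_id mulVf ?expr1n //.
  by rewrite normr_eq0.
exists (fun n => tens (nseq n xi)) => m n; rewrite tin !size_nseq.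
case: eqP => // ->; rewrite big1 // => i _.
by rewrite !nth_nseq ltn_ord xi1.
Qed.

Lemma ladder_pair (R : realType) (lam : nat -> R) k : (forall i, 1 < lam i) ->
  inhabited (ladder (Fmat lam k)^T (cseq (NF (Fmat lam k)))) /\
  inhabited (ladder (Fmat lam k) (cseq (NF (Fmat lam k)))).
Proof.
move=> lam1; have t2 := NF_ge2 lam1 k; have FF := Fmat_conj k lam1.
split; apply: ladder_exists => //; try exact: cseq_gt0.
- by rewrite -map_trmx -trmx_mul (conjFF FF) raddfN /= trmx1.
- by move=> n; rewrite -NF_adjmx NF_tr cseqS.
- by move=> n; rewrite -NF_adjmx cseqS.
Qed.

Theorem theorem5p2 (R : realType)
  (* the free Araki-Woods factor Gamma = Gamma(HR, U)'' *)
  (HR : hilbertType (idfun : R -> R)) (U : R -> HR -> HR)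
  (H : nzHilbertType R[i]) (iota : HR -> H)
  (F : nzHilbertType R[i]) (tens : seq H -> F) (Gamma : set (bop F))
  (* the generators z_{i+1} and the parameters lambda_{i+1} *)
  (lam : nat -> R) (z : nat -> bop F)
  (* C(O_{F(k)}^+), its generating matrix and its Haar state *)
  (A : nat -> cstarAlgType R[i])
  (u : forall k, 'M[A k]_(k.+1 + k.+1)) (h : forall k, A k -> R[i]) :
  separable HR ->
  orthogonal_rep U ->
  almost_periodic U ->
  complexification iota ->
  full_fock tens ->
  free_araki_woods U iota tens Gamma ->
  Gamma = vN_gen (range z) ->
  free_family (vacuum tens) z ->
  (forall i, exists a b : R[i], gen_circular a b (vacuum tens) (z i)) ->
  (forall i, vacuum tens (star (z i) * z i) = 1) ->
  (forall i, vacuum tens (z i * star (z i)) = (lam i)%:C%C) ->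
  (forall i, 1 < lam i) ->
  (forall k, free_orthogonal (Fmat lam k) (u k)) ->
  (forall k, haar_state (u k) (h k)) ->
  forall (l : nat) (eps : 'I_l -> bool) (i : 'I_l -> nat),
    (fun k => h k (\prod_(r < l) starpow (eps r) (zk lam (u k) (i r))))
      @ \oo --> (vacuum tens (\prod_(r < l) starpow (eps r) (z (i r))) : R[i]^o).
Proof.
move=> _ _ _ _ Ft _ _ z_free z_circ z_l z_r lam1 OF haar l eps i.
apply: tends_cvg.
pose b j : R[i] := (Num.sqrt (lam j))%:C%C.
pose w := [seq (eps r, i r) | r <- index_enum 'I_l].
have marg j v : vacuum tens (\prod_(e <- v) starpow e (z j)) =
    stack_moment (fun=> 1) b [seq (e, j) | e <- v].
  apply: (gen_circular_marginal _ (z_circ j) (z_l j) (z_r j)) => //.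
  by rewrite ltW // (lt_trans ltr01).
have := free_stack_moment (scalar_vacuum tens) (vacuum1 Ft) z_free marg w.
rewrite big_map /= => ->.
(* The given Fock space also hosts the models of all the quantum groups, one for each k, along an
   orthonormal sequence of tensor powers of one unit vector. *)
have [e e_on] := fock_orthonormal Ft.
have inh (T : Type) : inhabited T -> T.
  by move=> T0; apply: (projT1 (cid (_ : exists _ : T, True))); case: T0 => x; exists x.
pose K k := inh _ (proj1 (ladder_pair k lam1)).
pose L k := inh _ (proj2 (ladder_pair k lam1)).
have := stack_word_tends b (letter_om1 e_on K L) (letter_om0 lam1 e_on K L)
  (letter_bound lam1 e_on K L) (letter_gram lam1 e_on K L) w [::].
move=> lim eps' /lim[N hN].
(* From here on k exceeds every index occurring in the moment, so each [zk] is a genuine z_(i,k). *)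
exists (maxn N (\max_r (i r).+1)) => k; rewrite geq_max => /andP[/hN + ik].
congr (`|_ - _| < _); rewrite big_map /=.
have [uF univ] := OF k.
have [f [f_star fu _]] := univ _ _ (model_relations e_on (Fmat_conj k lam1)
  (cseqNF_gt0 lam1 k) (cseqNF_le lam1 k) (K k) (L k)).
rewrite (haar_word (Fmat_conj k lam1) uF (haar k) fu); last first.
  move=> r; rewrite /zk; case: (eps r) => /=.
    rewrite starZ; apply: coef_spanZ.
    exact: (star_entry_span (Fmat_conj k lam1) uF).
  by apply: coef_spanZ; exact: entry_span.
rewrite rmorph_prod; congr ('[bop_fun _ _, _]); apply: eq_bigr => r _.
have fz : f (zk lam (u k) (i r)) = letter_op lam1 e_on K L k (i r, false) +
    b (i r) *: star (letter_op lam1 e_on K L k (i r, true)).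
  rewrite -model_zk; last by apply: leq_trans ik; exact: (leq_bigmax r).
  by rewrite /zk linearZ -fu mxE.
by rewrite /gen_op /= -fz; case: (eps r); rewrite //= f_star.
Qed.
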